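(* There is a choice of thresholds $\eta_0(\delta,m)>0$ (for $\delta\in(0,1/2)$ and integers $m\ge1$) such that, with ''admissible'' defined relative to these thresholds, the following holds. Let $p$ be an admissible Hardy field function, let $(X,\Sigma,\mu)$ be a non-atomic $\sigma$-finite measure space and let $\tau$ be a measure-preserving $\mathbb{Z}$-action on $X$. Then for every $f\in L^r(X)$, $1\le r<\infty$, the series $$\mathcal{H}_pf(x)=\sum_{n=1}^\infty\frac{e^{2\pi i p(n)}}{n}\,\tau^nf(x)$$ converges (i.e. its partial sums converge) for $\mu$-a.e. $x\in X$.
   Context: Here $\tau^nf$ denotes $f$ composed with the $n$-th iterate of the invertible measure-preserving transformation generating the action. Hardy fields: consider real-valued functions of a real variable defined and continuous for all large $s$; two are equivalent if they coincide for all large $s$. The equivalence classes (germs) form a ring $B$. A Hardy field is a subfield of $B$ closed under differentiation, and $\mathcal{U}$ denotes the union of all Hardy fields. For $\delta\in(0,1/2)$, $M\ge1$ and an integer $m\ge1$, let $\mathcal{N}_{\delta,M,m}$ be the set of $p\in\mathcal{U}$ (with a representative defined and $m+2$ times continuously differentiable on $[1,\infty)$) for which there exist $\alpha\in[\delta,1-\delta]$ and $0<\eta\le\eta_0(\delta,m)$ such that $$\tfrac1M s^{m+\alpha-\eta-j}\le p^{(j)}(s)\le M s^{m+\alpha+\eta-j}\quad\text{for all } s\ge1,\ j=0,\dots,m+1,$$ $$\tfrac1M s^{\alpha-\eta-2}\le |p^{(m+2)}(s)|\le M s^{\alpha+\eta-2}\quad\text{for all } s\ge1.$$ Here $\eta_0(\delta,m)>0$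 is a sufficiently small threshold depending only on $\delta$ and $m$ (the paper writes $\eta\ll_{\delta,m}1$). A function $p$ is called admissible if it belongs to some class $\mathcal{N}_{\delta,M,m}$. *)

(* Defs.v *)
From HB Require Import structures.
From mathcomp Require Import all_boot all_order all_algebra.
From mathcomp Require Import all_classical all_reals all_analysis.
From mathcomp Require Import complex.

Set Implicit Arguments.
Unset Strict Implicit.
Unset Printing Implicit Defensive.

Import Order.TTheory GRing.Theory Num.Theory.
Import numFieldNormedType.Exports.

Local Open Scope classical_set_scope.
Local Open Scope ring_scope.

(* Germs at +oo are represented by total functions R -> R modulo [germ_eq];
   the values of a representative outside a neighbourhood of +oo are junk. *)
Definition germ_eq (R : realType) (f g : R -> R) : Prop :=
  \forall s \near +oo, f s = g s.

(* A set of germs is a set of functions saturated for [germ_eq]. The fields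
   below say that [H] is such a set, that its germs are germs of continuous
   functions, that it is a subfield of the ring of all these germs, and that it
   is closed under differentiation. *)
Record is_hardy_field (R : realType) (H : set (R -> R)) : Prop := {
  hardy_germ : forall f g, germ_eq f g -> H f -> H g ;
  hardy_continuous : forall f, H f -> \forall s \near +oo, {for s, continuous f} ;
  hardy1 : H (fun=> 1) ;
  hardyB : forall f g, H f -> H g -> H (fun s => f s - g s) ;
  hardyM : forall f g, H f -> H g -> H (fun s => f s * g s) ;
  hardyV : forall f, H f -> ~ germ_eq f (fun=> 0) ->
    exists2 g, H g & germ_eq (fun s => f s * g s) (fun=> 1) ;
  hardy_derivable : forall f, H f -> \forall s \near +oo, derivable f s 1 ;
  hardy_derive : forall f, H f -> H (derive1 f)
}.

Definition hardy_union (R : realType) : set (R -> R) :=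
  [set p | exists2 H, is_hardy_field H & H p].

(* Derivatives of functions on a set [A]: increments stay in [A], so that the
   derivative at the left endpoint of [1, +oo[ is the right derivative. *)
Definition derivable_on (R : realType) (A : set R) (f : R -> R) (s : R) : Prop :=
  cvg (h^-1 * (f (s + h) - f s) @[h --> within [set h | A (s + h)] 0^']).

Definition derive_on (R : realType) (A : set R) (f : R -> R) : R -> R :=
  fun s => lim (h^-1 * (f (s + h) - f s) @[h --> within [set h | A (s + h)] 0^']).

Definition deriven_on (R : realType) (A : set R) (j : nat) (f : R -> R) : R -> R :=
  iter j (derive_on A) f.

Definition continuously_derivable_on (R : realType) (A : set R) (k : nat)
    (f : R -> R) : Prop :=
  (forall j s, (j < k)%N -> A s -> derivable_on A (deriven_on A j f) s) /\
  {within A, continuous (deriven_on A k f)}.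

Definition Nclass (R : realType) (eta0 : R -> nat -> R) (delta M : R) (m : nat) :
    set (R -> R) :=
  [set p | let D j := deriven_on `[1, +oo[ j p in
    [/\ hardy_union p,
        continuously_derivable_on `[1, +oo[ m.+2 p &
        exists alpha eta : R,
        [/\ delta <= alpha <= 1 - delta,
            0 < eta <= eta0 delta m,
            (forall (j : nat) (s : R), (j <= m.+1)%N -> 1 <= s ->
               M^-1 * s `^ (m%:R + alpha - eta - j%:R) <= D j s
                 <= M * s `^ (m%:R + alpha + eta - j%:R)) &
            (forall s : R, 1 <= s ->
               M^-1 * s `^ (alpha - eta - 2) <= `|D m.+2 s|
                 <= M * s `^ (alpha + eta - 2))]]].

Definition admissible (R : realType) (eta0 : R -> nat -> R) (p : R -> R) : Prop :=
  exists (delta M : R) (m : nat),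
    [/\ 0 < delta < 2^-1, 1 <= M, (1 <= m)%N & Nclass eta0 delta M m p].

Definition atom d (X : measurableType d) (R : realType)
    (mu : {measure set X -> \bar R}) (A : set X) : Prop :=
  [/\ measurable A, (0 < mu A)%E &
      forall B, measurable B -> B `<=` A -> (mu B < mu A)%E -> mu B = 0%E].

Definition non_atomic d (X : measurableType d) (R : realType)
    (mu : {measure set X -> \bar R}) : Prop :=
  forall A, ~ atom mu A.

Record measure_preserving_Zaction d (X : measurableType d) (R : realType)
    (mu : {measure set X -> \bar R}) (tau : int -> X -> X) : Prop := {
  Zaction0 : forall x, tau 0 x = x ;
  ZactionD : forall a b x, tau (a + b) x = tau a (tau b x) ;
  Zaction_measurable : forall a, measurable_fun setT (tau a) ;
  Zaction_preserving : forall a A, measurable A -> mu (tau a @^-1` A) = mu A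
}.

Definition complex_Lspace d (X : measurableType d) (R : realType)
    (mu : {measure set X -> \bar R}) (r : R) (f : X -> R[i]) : Prop :=
  [/\ measurable_fun setT (fun x => complex.Re (f x)),
      measurable_fun setT (fun x => complex.Im (f x)) &
      finite_norm mu r%:E (fun x => ComplexField.Normc.normc (f x))].

Definition expi (R : realType) (t : R) : R[i] := Complex (cos t) (sin t).

(* [tau 1] is the transformation generating the action. *)
Definition hilbert_partial_sum (R : realType) (X : Type) (p : R -> R)
    (tau : int -> X -> X) (f : X -> R[i]) (x : X) (N : nat) : R[i] :=
  \sum_(1 <= n < N.+1)
    expi (2 * pi * p n%:R) / n%:R * f (iter n (tau 1) x).

(* Main.v *)
Require Import Defs.
From HB Require Import structures.
From mathcomp Require Import all_boot all_order all_algebra.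
From mathcomp Require Import all_classical all_reals all_analysis.
From mathcomp Require Import complex.
From mathcomp Require Import measurable_realfun.
From mathcomp Require Import zify ring lra.
Import Order.TTheory GRing.Theory Num.Theory.
Import numFieldNormedType.Exports.
Local Open Scope classical_set_scope.
Local Open Scope ring_scope.
Set Implicit Arguments.
Unset Strict Implicit.
Unset Printing Implicit Defensive.

(** Let [G] be the [m+1]-st derivative of [p]. Van der Corput's inequality, applied [m] times,
    and the Kusmin-Landau bound for the resulting phases show that the dyadic blocks [v_j] of
    [cos (2 pi p(n) + phi) / n] satisfy [|sum_n v_j(n+d) v_j'(n)| <= C 2^-j w^j'] with [w < 1],
    for all [j' <= j] and all [d] that are not small compared with [2^j'].

    With [T_j] the operator of kernel [v_j], this gives a weak type (1,1) bound for the maximal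
    partial sums on the integers. After a Calderon-Zygmund decomposition [F = g + sum_l b_l] at
    height [1], the good part is controlled in [l^2], scale by scale. For fixed [s] the terms
    [T_j b_(j-s)] gain [w^s] in [l^2] from the correlation bound; outside a set of size
    [2^-s |F|_1] at most [4^s] of them are nonzero at a given point, so that the
    Rademacher-Menshov inequality controls their partial sums at the cost of a factor [s^2].

    Transference carries both the weak type bound and the [l^2] bounds over to the measure space.
    If [f] is bounded and lies in [L^q], then in the [j]-th block its values below [k^j] are
    negligible, and the [l^2] gain [w^j] beats the number of cut points needed to follow the
    partial sums within the block, so that the Borel-Cantelli lemma gives convergence. If [f] is
    integrable, the weak type bound applies to the parts of [f] above large heights. Every [f] in
    [L^r] is the sum of a bounded function in [L^r] and an integrable one. *)

(** * Exponential sums *)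

(** Since [p] grows faster than linearly, the kernel is too rough for the usual gain from bad
    functions of mean zero. The [b_l] are therefore plain restrictions of [F], and all smallness
    comes from oscillation. An [l^2] bound for a sum over [j] does not control its partial sums, and
    a logarithmic loss in the number of scales would be fatal; hence the interest in the number of
    nonzero terms. The groups of indices in the Rademacher-Menshov inequality then depend on the
    point [x]. For a pair of scales [j' <= j] this dependence is only through the dyadic interval of
    length [2^j'] around [x], and the correlation estimate tolerates any bounded weight that is
    constant on such intervals. All kernels are real: cosine and sine are the phases [0] and [-pi/2]
    of one kernel, and a product of two cosines splits into the cosines of the sum and of the
    difference of the phases. In the sum the leading derivatives are both nonnegative and cannot
    cancel; in the difference they nearly cancel when [d] is small, which is the origin of the
    excluded range of [d]. *)

Lemma sin_small_bounds (R : realType) (t : R) :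
  0 <= t <= 1 -> t / 2 <= sin t <= t.
Proof.
have le_id (s : R) : 0 <= s -> sin s <= s.
  rewrite le_eqVlt => /predU1P[<-|s0]; first by rewrite sin0.
  have [|c _] := @MVT R sin cos 0 s s0.
  by apply: continuous_subspaceT => x; exact: continuous_sin.
  rewrite sin0 !subr0 => ->; rewrite ler_piMl ?(ltW s0) ?cos_le1//.
move=> /andP[t0 t1]; rewrite le_id// andbT.
move: t0; rewrite le_eqVlt => /predU1P[<-|t0]; first by rewrite sin0 mul0r.
have [|c] := @MVT R sin cos 0 t t0.
  by apply: continuous_subspaceT => x; exact: continuous_sin.
rewrite in_itv/= => /andP[c0 ct].
rewrite sin0 !subr0 => ->; rewrite mulrC ler_pM2r//.
have h0 : 0 <= sin (c / 2).
  have p2 := pi_ge2 R.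
  by apply: sin_ge0_pi; apply/andP; split; lra.
have h1 : sin (c / 2) <= c / 2 by apply: le_id; lra.
(* The half-angle formula gives cos c = 1 - 2 sin^2 (c / 2) >= 1 - c^2 / 2 >= 1 / 2. *)
have -> : c = c / 2 + c / 2 by field.
rewrite cosD -!expr2 cos2sin2; nra.
Qed.

Lemma norm_sin_bounds (R : realType) (t : R) :
  `|t| <= 1 -> `|t| / 2 <= `|sin t| <= `|t|.
Proof.
move=> t1; wlog t0 : t t1 / 0 <= t => [H|].
  have [|/ltW] := leP 0 t; first exact: H.
  by rewrite -oppr_ge0 => /H; rewrite sinN !normrN; apply.
rewrite !(ger0_norm t0) in t1 *.
have /andP[a b] : t / 2 <= sin t <= t by rewrite sin_small_bounds ?t0.
by rewrite ger0_norm ?a ?b//; apply: le_trans a; rewrite divr_ge0.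
Qed.

Lemma kusmin_landau (R : realType) (th : nat -> R) (L : nat) (rho r : R) :
  0 < rho -> 0 <= r ->
  (forall i, (i < L)%N -> rho <= `|th i.+1 - th i| <= 1) ->
  (forall i, (i.+1 < L)%N -> `|(th i.+2 - th i.+1) - (th i.+1 - th i)| <= r) ->
  `|\sum_(i < L) cos (th i)| <= 6 / rho + 4 * L%:R * r / rho ^+ 2.
Proof.
move=> rho0 r0; case: L => [|L] D1 D2.
  by rewrite big_ord0 normr0 mulr0 !mul0r addr0 divr_ge0// ltW.
pose x i := (th i.+1 - th i) / 2; pose c i := cos (x i) / sin (x i).
have xb i : (i <= L)%N -> rho / 4 <= `|sin (x i)|.
  move=> /D1/andP[h1 h2]; have /norm_sin_bounds/andP[h3 _] : `|x i| <= 1.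
    rewrite normrM (@ger0_norm _ 2^-1) ?invr_ge0//; lra.
  apply: le_trans h3; rewrite normrM (@ger0_norm _ 2^-1) ?invr_ge0//; lra.
have sx0 i : (i <= L)%N -> sin (x i) != 0.
  by move=> /xb h; rewrite -normr_gt0; apply: lt_le_trans h; rewrite divr_gt0.
have cb i : (i <= L)%N -> `|c i| <= 4 / rho.
  move=> iL; rewrite normrM normfV ler_pdivrMr ?normr_gt0 ?sx0//.
  apply: (le_trans (cos_max _)); rewrite mulrAC ler_pdivlMr// mul1r.
  by have := xb _ iL; lra.
have dcb i : (i < L)%N -> `|c i - c i.+1| <= 8 * r / rho ^+ 2.
  move=> iL; have h1 := sx0 _ (ltnW iL); have h2 := sx0 _ iL.
  (* The second differences of [th] enter only here: [x i.+1 - x i] is half of one. *)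
  have -> : c i - c i.+1 = sin (x i.+1 - x i) / (sin (x i) * sin (x i.+1)).
    by rewrite sinB /c; field; rewrite h1 h2.
  rewrite normrM normfV normrM ler_pdivrMr ?mulr_gt0 ?normr_gt0//.
  have h3 : `|sin (x i.+1 - x i)| <= r / 2.
    have e : `|x i.+1 - x i| <= r / 2.
      rewrite (_ : _ - _ = ((th i.+2 - th i.+1) - (th i.+1 - th i)) / 2).
        by rewrite normrM (@ger0_norm _ 2^-1) ?invr_ge0// ler_pM2r// D2.
      by rewrite /x; field.
    have /andP[_ a2] := D1 i.+1 iL; have /andP[_ a1] := D1 i (ltnW iL).
    have e2 : `|x i.+1 - x i| <= 1.
      rewrite /x -mulrBl normrM (@ger0_norm _ 2^-1) ?invr_ge0//.
      have := ler_normB (th i.+2 - th i.+1) (th i.+1 - th i); lra.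
    by have /andP[_] := norm_sin_bounds e2 => /le_trans; apply.
  apply: (le_trans h3).
  have := ler_pM _ _ (xb _ (ltnW iL)) (xb _ iL).
  rewrite !divr_ge0 ?(ltW rho0)// => /(_ isT isT) h4.
  apply: (@le_trans _ _ (8 * r / rho ^+ 2 * (rho / 4 * (rho / 4)))).
    rewrite le_eqVlt; apply/orP; left; apply/eqP; field; exact: lt0r_neq0.
  by rewrite ler_wpM2l// divr_ge0 ?mulr_ge0 ?exprn_ge0 ?(ltW rho0)//.
(* [cos a + cos b = cot ((b - a) / 2) * (sin b - sin a)] makes the sum telescope up to the
   variation of the cotangents. *)
have key i : (i <= L)%N -> cos (th i) + cos (th i.+1) = c i * (sin (th i.+1) - sin (th i)).
  move=> iL; pose a := (th i + th i.+1) / 2.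
  have -> : th i.+1 = a + x i by rewrite /a /x; field.
  have -> : th i = a - x i by rewrite /a /x; field.
  by rewrite (cosD a (x i)) (sinD a (x i)) cosB sinB /c; field; exact: sx0.
have main n : (n <= L)%N ->
    `|\sum_(i < n.+1) (cos (th i) + cos (th i.+1)) - c n * sin (th n.+1)|
    <= 4 / rho + n%:R * (8 * r / rho ^+ 2).
  elim: n => [|n IH] nL.
    rewrite big_ord1 /= key// mulrBr addrAC subrr add0r normrN normrM mul0r addr0.
    by rewrite -[leRHS]mulr1 ler_pM ?cb ?sin_max.
  rewrite big_ord_recr /= key//.
  rewrite (_ : _ - _ = (\sum_(i < n.+1) (cos (th i) + cos (th i.+1)) - c n * sin (th n.+1))
     + (c n - c n.+1) * sin (th n.+1)); last by ring.
  apply: (le_trans (ler_normD _ _)).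
  set T := 8 * r / rho ^+ 2 in IH dcb *.
  have -> : n.+1%:R * T = n%:R * T + T by rewrite -natr1 mulrDl mul1r.
  rewrite addrA lerD// ?IH ?(ltnW nL)//.
  by rewrite normrM -[leRHS]mulr1 ler_pM ?dcb ?sin_max.
have := main _ (leqnn L); rewrite big_split /=.
have -> : \sum_(i < L.+1) cos (th i.+1) =
    \sum_(i < L.+1) cos (th i) + cos (th L.+1) - cos (th 0).
  by rewrite [in RHS]big_ord_recl big_ord_recr /=; ring.
set S := \sum_(i < L.+1) _ => h.
have c1 := cb _ (leqnn L); have s1 := sin_max (th L.+1).
have k1 := cos_max (th L.+1); have k2 := cos_max (th 0).
have ce : `|c L * sin (th L.+1)| <= 4 / rho.
  by rewrite normrM -[leRHS]mulr1 ler_pM.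
have r1 : 1 <= rho^-1.
  rewrite invf_ge1//; have /andP[h1 h2] := D1 0%N isT; exact: le_trans h2.
set w := 8 * r / rho ^+ 2 in h *.
have -> : 4 * L.+1%:R * r / rho ^+ 2 = L.+1%:R * w / 2 by rewrite /w; field; exact: lt0r_neq0.
have w0 : 0 <= w by rewrite /w divr_ge0 ?mulr_ge0 ?exprn_ge0 ?(ltW rho0)//.
rewrite -natr1 mulrDl mul1r mulrDl.
move: h ce k1 k2; rewrite !ler_norml => /andP[? ?] /andP[? ?] /andP[? ?] /andP[? ?].
apply/andP; split; lra.
Qed.

Lemma cauchy_schwarz_sum (R : realFieldType) (I : Type) (s : seq I) (P : pred I)
    (a b : I -> R) :
  (\sum_(i <- s | P i) a i * b i) ^+ 2 <=
  (\sum_(i <- s | P i) a i ^+ 2) * \sum_(i <- s | P i) b i ^+ 2.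
Proof.
elim: s => [|i s IH]; first by rewrite !big_nil expr0n mul0r.
rewrite !big_cons; case: (P i) => //.
set S := \sum_(j <- s | P j) a j * b j in IH *.
set A := \sum_(j <- s | P j) a j ^+ 2 in IH *.
set B := \sum_(j <- s | P j) b j ^+ 2 in IH *.
have A0 : 0 <= A by apply: sumr_ge0 => j _; exact: sqr_ge0.
have B0 : 0 <= B by apply: sumr_ge0 => j _; exact: sqr_ge0.
suff : 0 <= A * b i ^+ 2 + B * a i ^+ 2 - 2 * S * (a i * b i).
  move=> h; rewrite sqrrD mulrDl !mulrDr exprMn.
  rewrite -subr_ge0 (_ : _ - _ = (A * B - S ^+ 2) +
    (A * b i ^+ 2 + B * a i ^+ 2 - 2 * S * (a i * b i))); last by ring.
  by rewrite addr_ge0// subr_ge0.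
(* If [A = 0] then [S = 0] by the induction hypothesis; otherwise multiplication by [A] completes a
   square. *)
move: A0; rewrite le_eqVlt => /predU1P[A0|A0].
  move: IH; rewrite -A0 mul0r => S0.
  have /eqP -> : S == 0 by rewrite -sqrf_eq0 eq_le S0 sqr_ge0.
  by rewrite mulr0 !mul0r add0r subr0 mulr_ge0// sqr_ge0.
rewrite -(pmulr_rge0 _ A0).
rewrite (_ : A * (_ - _) = (A * b i - S * a i) ^+ 2 + a i ^+ 2 * (A * B - S ^+ 2)); last by ring.
by rewrite addr_ge0 ?sqr_ge0// mulr_ge0 ?sqr_ge0// subr_ge0.
Qed.

Lemma sqr_sum_le (R : realFieldType) (n : nat) (a : nat -> R) :
  (\sum_(i < n) a i) ^+ 2 <= n%:R * \sum_(i < n) a i ^+ 2.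
Proof.
have := @cauchy_schwarz_sum R 'I_n (index_enum 'I_n) xpredT (fun=> 1) a.
under eq_bigr do rewrite mul1r.
by under [X in _ <= X * _]eq_bigr do rewrite expr1n; rewrite sumr_const card_ord.
Qed.

Lemma sum_shift_support (R : nmodType) (G : nat -> R) (L H h : nat) :
  (h <= H)%N -> (forall n, ~~ (H <= n < H + L)%N -> G n = 0) ->
  \sum_(n < L + H) G (n + h)%N = \sum_(i < L) G (H + i)%N.
Proof.
move=> hH G0.
rewrite -(big_mkord xpredT (fun n => G (n + h)%N)) -(big_mkord xpredT (fun n => G (H + n)%N)).
under [RHS]eq_bigr do rewrite addnC.
have -> : \sum_(0 <= n < L + H) G (n + h)%N = \sum_(h <= n < L + H + h) G n.
  transitivity (\sum_(0 + h <= n < L + H + h) G n); last by rewrite add0n.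
  by rewrite big_addn addnK.
have -> : \sum_(0 <= i < L) G (i + H)%N = \sum_(H <= n < L + H) G n.
  transitivity (\sum_(0 + H <= n < L + H) G n); last by rewrite add0n.
  by rewrite big_addn addnK.
rewrite (big_cat_nat hH) /=; last by lia.
rewrite big1_seq ?add0r; last first.
  by move=> i /=; rewrite mem_index_iota => hi; apply: G0; lia.
rewrite (@big_cat_nat _ _ _ (L + H)) /=; [|lia|lia].
rewrite [X in _ + X]big1_seq ?addr0// => i /=; rewrite mem_index_iota => hi.
by apply: G0; lia.
Qed.

(** Average over windows of length [H] and apply Cauchy-Schwarz. The sine windows [B] are added to
    the cosine windows [A] because only [C * C + D * D] collapses to the cosine of a phase
    difference. *)
Lemma van_der_corput (R : realType) (th : nat -> R) (L H N : nat) (S : R) :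
  (L <= N)%N -> 0 <= S ->
  (forall h, (0 < h < H)%N ->
    `|\sum_(i < L - h) cos (th (i + h)%N - th i)| <= S) ->
  (H%:R * \sum_(i < L) cos (th i)) ^+ 2 <=
  (N + H)%:R * (H%:R * N%:R + H%:R ^+ 2 * S).
Proof.
move=> LN S0 hS.
(* The sequence is moved to [H, ..., H + L - 1] and extended by zero, so that the windows starting
   at [n >= 0] meet every term exactly [H] times and no index is negative. *)
pose in_ n := (H <= n < H + L)%N.
pose C n := if in_ n then cos (th (n - H)%N) else 0.
pose D n := if in_ n then sin (th (n - H)%N) else 0.
pose A n := \sum_(h < H) C (n + h)%N.
pose B n := \sum_(h < H) D (n + h)%N.
pose Q d k := C k * C (k + d)%N + D k * D (k + d)%N.
have Q0 d n : ~~ in_ n -> Q d n = 0.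
  by move=> /negbTE h; rewrite /Q /C /D h !mul0r addr0.
have QE d : \sum_(i < L) Q d (H + i)%N = \sum_(i < L - d) cos (th (i + d)%N - th i).
  rewrite -(big_mkord xpredT (fun i => Q d (H + i)%N)).
  rewrite -(big_mkord xpredT (fun i => cos (th (i + d)%N - th i))).
  rewrite (@big_cat_nat _ _ _ (L - d)) /=; [|lia|lia].
  rewrite [X in _ + X]big1_seq ?addr0.
    apply: eq_big_nat => i hi; rewrite /Q /C /D /in_ leq_addr ltn_add2l.
    have -> : (i < L)%N by lia.
    have -> : (H <= H + i + d < H + L)%N by lia.
    have -> : (H + i + d - H = i + d)%N by lia.
    by rewrite /= addKn cosB; ring.
  move=> i /=; rewrite mem_index_iota => hi; rewrite /Q /C /D.
  have /negbTE-> : ~~ in_ (H + i + d)%N by rewrite /in_; lia.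
  by rewrite !mulr0 addr0.
have bQ d h : (h <= H)%N -> (d < H)%N ->
    \sum_(n < L + H) Q d (n + h)%N <= if d == 0%N then N%:R else S.
  move=> hH dH; rewrite (@sum_shift_support _ (Q d) L H h hH); last by move=> n /Q0.
  rewrite QE; case: eqP => [->|/eqP d0].
    rewrite subn0; under eq_bigr do rewrite addn0 subrr cos0.
    by rewrite sumr_const card_ord ler_nat.
  by apply: (le_trans (ler_norm _)); apply: hS; rewrite lt0n d0.
have sumA : H%:R * (\sum_(i < L) cos (th i)) = \sum_(n < L + H) A n.
  rewrite exchange_big /= -[in LHS](card_ord H) -sum1_card natr_sum mulr_suml.
  apply: eq_bigr => h _; rewrite mul1r sum_shift_support ?(ltnW (ltn_ord h))//.
    by apply: eq_bigr => i _; rewrite /C /in_ leq_addr ltn_add2l ltn_ord /= addKn.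
  by move=> n /negbTE; rewrite /C /in_ => ->.
rewrite sumA; apply: (le_trans (sqr_sum_le _ _)).
have AB : \sum_(n < L + H) A n ^+ 2 <= \sum_(n < L + H) (A n ^+ 2 + B n ^+ 2).
  by apply: ler_sum => n _; rewrite lerDl sqr_ge0.
apply: (@le_trans _ _ ((L + H)%:R * (H%:R * N%:R + H%:R ^+ 2 * S))); last first.
  by rewrite ler_wpM2r ?ler_nat ?leq_add2r// addr_ge0// mulr_ge0// exprn_ge0.
rewrite ler_wpM2l//; apply: (le_trans AB).
have -> : \sum_(n < L + H) (A n ^+ 2 + B n ^+ 2) =
   \sum_(h < H) \sum_(h' < H) \sum_(n < L + H)
     (C (n + h)%N * C (n + h')%N + D (n + h)%N * D (n + h')%N).
  rewrite [RHS](eq_bigr (fun h : 'I_H => \sum_(n < L + H) \sum_(h' < H)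
     (C (n + h)%N * C (n + h')%N + D (n + h)%N * D (n + h')%N))); last first.
    by move=> h _; rewrite exchange_big.
  rewrite [RHS]exchange_big; apply: eq_bigr => n _ /=.
  rewrite !expr2 /A /B !big_distrlr /= -big_split; apply: eq_bigr => h _ /=.
  by rewrite -big_split.
apply: (@le_trans _ _ (\sum_(h < H) \sum_(h' < H) if h == h' then N%:R else S)).
  apply: ler_sum => h _; apply: ler_sum => h' _.
  wlog hh : h h' / (h <= h')%N => [W|].
    have [/W//|/ltnW/W] := leqP h h'; rewrite eq_sym.
    by under eq_bigr do rewrite mulrC (mulrC (D _)).
  have := @bQ (h' - h)%N h (ltnW (ltn_ord h)); rewrite /Q.
  under eq_bigr do rewrite -!addnA subnKC//.
  have -> : (h' - h == 0)%N = (h == h') by rewrite subn_eq0 -val_eqE eqn_leq hh.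
  by apply; have := ltn_ord h'; lia.
rewrite (_ : _ + _ = \sum_(h < H) (N%:R + H%:R * S)); last first.
  by rewrite sumr_const card_ord -mulr_natl; ring.
apply: ler_sum => h _; rewrite (bigD1 h)//= eqxx lerD2l.
apply: (@le_trans _ _ (\sum_(h' < H) S)); last by rewrite sumr_const card_ord mulr_natl.
rewrite [leRHS](bigD1 h)//= -[leLHS]add0r lerD//.
by apply: ler_sum => i; rewrite eq_sym => /negbTE ->.
Qed.

Lemma MVT_step (R : realType) (f df : R -> R) (a h : R) : 0 < h ->
  (forall s, a <= s <= a + h -> is_derive s 1 f (df s)) ->
  exists2 c, a <= c <= a + h & f (a + h) - f a = h * df c.
Proof.
move=> h0 fd; have ah : a < a + h by rewrite ltrDl.
have [||c] := @MVT R f df a (a + h) ah.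
- by move=> s; rewrite in_itv/= => /andP[/ltW s1 /ltW s2]; apply: fd; rewrite s1.
- apply: derivable_within_continuous => s; rewrite in_itv/= => sab.
  by have [] := fd _ sab.
by rewrite in_itv/= addrAC subrr add0r mulrC => /andP[/ltW c1 /ltW c2] e; exists c => //; rewrite c1.
Qed.

Lemma is_derive_difference (R : realType) (f : R -> R) (s h d1 d2 : R) :
  is_derive s 1 f d1 -> is_derive (s + h) 1 f d2 ->
  is_derive s 1 (fun t => f (t + h) - f t) (d2 - d1).
Proof.
move=> f1 f2; have f3 : is_derive s 1 (f \o shift h) d2.
  rewrite -[d2]mulr1; apply: (@is_derive1_comp R f (shift h) s d2 1).
    exact: is_derive_shift.
exact: is_deriveB.
Qed.

(* Induction on the number of derivatives: the van der Corput inequality replaces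
   [f] by its differences, which trades [rho], [rho'] and [r] for [h * rho],
   [h * rho'] and [h * r]. *)
Lemma exp_sum_bound (R : realType) (k : nat) :
  forall (f : nat -> R -> R) (a : R) (L N H : nat) (rho rho' r y : R),
  (L <= N)%N -> (0 < H <= N)%N -> 0 < rho -> 0 <= r -> 0 <= y <= 1 ->
  (forall i s, (i <= k.+1)%N -> a <= s <= a + L%:R ->
     is_derive s 1 (f i) (f i.+1 s)) ->
  (forall s, a <= s <= a + L%:R -> rho <= `|f k.+1 s| <= rho') ->
  (forall s, a <= s <= a + L%:R -> `|f k.+2 s| <= r) ->
  H%:R ^+ k * rho' <= 1 -> 6 / rho <= 4 * N%:R / H%:R ->
  r / rho ^+ 2 <= H%:R^-1 -> H%:R^-1 <= y ^+ (2 ^ k) ->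
  `|\sum_(i < L) cos (f 0%N (a + i%:R))| <= 8 * N%:R * y.
Proof.
elim: k => [|k IH] f a L N H rho rho' r y LN /andP[H0 HN] rho0 r0 /andP[y0 y1]
  fd fk fk1 Hrho rhoN rrho Hy.
  rewrite expr0 mul1r in Hrho; rewrite expn0 expr1 in Hy.
  have nin (i : nat) (s : R) : (i < L)%N -> a + i%:R <= s <= a + i%:R + 1 -> a <= s <= a + L%:R.
    move=> iL /andP[s1 s2]; apply/andP; split.
      by apply: le_trans s1; rewrite lerDl.
    by apply: (le_trans s2); rewrite -addrA lerD2l natr1 ler_nat.
  apply: (le_trans (@kusmin_landau R (fun i => f 0%N (a + i%:R)) L rho r rho0 r0 _ _)).
  - move=> i iL; have [|c ci] := @MVT_step R (f 0%N) (f 1%N) (a + i%:R) 1 ltr01.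
      by move=> s /nin - /(_ iL); apply: fd.
    rewrite -natr1 addrA mul1r => ->; have /andP[f1 f2] := fk _ (nin _ _ iL ci).
    by rewrite f1 (le_trans f2).
  - move=> i iL; pose g s := f 0%N (s + 1) - f 0%N s.
    have sub1 s : a + i%:R <= s <= a + i%:R + 1 -> a <= s <= a + L%:R.
      by apply: nin; lia.
    have sub2 s : a + i%:R <= s <= a + i%:R + 1 -> a <= s + 1 <= a + L%:R.
      by move=> s1; apply: (nin i.+1) => //; rewrite -natr1 addrA !lerD2r.
    have [|c ci] := @MVT_step R g (fun s => f 1%N (s + 1) - f 1%N s) (a + i%:R) 1 ltr01.
      by move=> s si; apply: is_derive_difference; apply: fd => //; [exact: sub1|exact: sub2].
    rewrite mul1r /g; have -> : i.+2%:R = i%:R + 1 + 1 :> R by rewrite !natr1.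
    rewrite -natr1 !addrA => ->.
    have [|e ei ->] := @MVT_step R (f 1%N) (f 2%N) c 1 ltr01.
      move=> s /andP[s1 s2]; apply: fd => //; apply/andP; split.
        by have /sub1/andP[h _] := ci; exact: le_trans s1.
      by have /sub2/andP[_ h] := ci; exact: le_trans h.
    rewrite mul1r; apply: fk1; move: ei => /andP[e1 e2]; apply/andP; split.
      by have /sub1/andP[h _] := ci; exact: le_trans e1.
    by have /sub2/andP[_ h] := ci; exact: le_trans h.
  have h1 : 4 * L%:R * r / rho ^+ 2 <= 4 * N%:R * y.
    rewrite -(mulrA (4 * L%:R)) ler_pM ?mulr_ge0 ?invr_ge0 ?exprn_ge0 ?(ltW rho0)//.
      by rewrite ler_wpM2l// ler_nat.
    exact: le_trans rrho Hy.
  have h2 : 6 / rho <= 4 * N%:R * y.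
    by apply: (le_trans rhoN); rewrite ler_wpM2l// mulr_ge0.
  by apply: (le_trans (lerD h2 h1)); rewrite -mulrDl -mulrDl; have -> : 4 + 4 = 8 :> R by ring.
have H0' : 0 < H%:R :> R by rewrite ltr0n.
have rho'0 : 0 <= rho'.
  have /andP[h1 h2] : rho <= `|f k.+2 a| <= rho' by apply: fk; rewrite lexx lerDl ler0n.
  exact: le_trans (ltW rho0) (le_trans h1 h2).
(* The differences are estimated with [y ^+ 2] in place of [y]: each van der Corput step costs a
   square root, whence the exponent [2 ^ k]. *)
have := @van_der_corput R (fun i => f 0%N (a + i%:R)) L H N (8 * N%:R * y ^+ 2) LN.
rewrite !mulr_ge0 ?exprn_ge0// => /(_ isT) vdC.
have {vdC} : (H%:R * \sum_(i < L) cos (f 0%N (a + i%:R))) ^+ 2 <=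
    (N + H)%:R * (H%:R * N%:R + H%:R ^+ 2 * (8 * N%:R * y ^+ 2)).
  apply: vdC => h /andP[h0 hH].
  have [Lh|hL] := leqP L h.
    by move: Lh; rewrite -subn_eq0 => /eqP ->; rewrite big_ord0 normr0 !mulr_ge0 ?exprn_ge0.
  have h0' : 0 < h%:R :> R by rewrite ltr0n.
  have h1' : 1 <= h%:R :> R by rewrite ler1n.
  have hin s : a <= s <= a + (L - h)%:R ->
      forall c, s <= c <= s + h%:R -> a <= c <= a + L%:R.
    rewrite natrB ?(ltnW hL)// => /andP[s1 s2] c /andP[c1 c2].
    by apply/andP; split; lra.
  have step i s : (i <= k.+2)%N -> a <= s <= a + (L - h)%:R ->
      exists2 c, a <= c <= a + L%:R & `|f i (s + h%:R) - f i s| = h%:R * `|f i.+1 c|.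
    move=> ik /hin sh; have [|c /sh ci ->] := @MVT_step R (f i) (f i.+1) s h%:R h0'.
      by move=> t /sh; exact: fd.
    by exists c => //; rewrite normrM normr_nat.
  under eq_bigr do rewrite natrD addrA.
  apply: (@IH (fun i s => f i (s + h%:R) - f i s) a (L - h)%N N H (h%:R * rho)
     (h%:R * rho') (h%:R * r)) => //; rewrite ?mulr_gt0 ?mulr_ge0 ?H0//.
  - by rewrite (leq_trans (leq_subr _ _)).
  - by rewrite exprn_ile1.
  - move=> i s ik sab; have sh := hin _ sab; apply: is_derive_difference; apply: fd.
    + exact: leqW ik.
    + by apply: sh; rewrite lexx lerDl ler0n.
    + exact: leqW ik.
    + by apply: sh; rewrite lexx lerDl ler0n.
  - move=> s /step - /(_ k.+1 (leqnSn _)) [c /fk/andP[c1 c2] ->].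
    by rewrite !ler_pM2l// c1.
  - by move=> s /step - /(_ k.+2 (leqnn _)) [c /fk1 c1 ->]; rewrite !ler_pM2l.
  - apply: le_trans Hrho; rewrite mulrA exprSr ler_wpM2r// ler_wpM2l ?exprn_ge0//.
    by rewrite ler_nat ltnW.
  - apply: le_trans rhoN; rewrite ler_wpM2l// lef_pV2 ?posrE ?mulr_gt0//.
    by rewrite ler_peMl// ltW.
  - apply: le_trans rrho; rewrite exprMn.
    have -> : h%:R * r / (h%:R ^+ 2 * rho ^+ 2) = (r / rho ^+ 2) / h%:R.
      by field; rewrite !lt0r_neq0.
    by rewrite ler_piMr ?divr_ge0 ?exprn_ge0 ?(ltW rho0)// invf_le1.
  - by rewrite -exprM mulnC -expnSr.
set S := \sum_(i < L) _ => vdC.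
have Hy2 : H%:R^-1 <= y ^+ 2.
  apply: (le_trans Hy); rewrite expnS mulnC exprM -[leRHS]expr1 -exprM mulnC exprM.
  by rewrite ler_wiXn2l ?sqr_ge0 ?exprn_ile1// expn_gt0.
rewrite -(@ler_pXn2r _ 2)// ?nnegrE ?mulr_ge0// real_normK ?num_real//.
rewrite -(@ler_pM2l _ (H%:R ^+ 2)) ?exprn_gt0// -exprMn.
apply: (le_trans vdC).
have HN' : H%:R <= N%:R :> R by rewrite ler_nat.
have e1 : H%:R * N%:R <= H%:R ^+ 2 * N%:R * y ^+ 2.
  by rewrite expr2 -!mulrA ler_wpM2l// mulrCA ler_peMr// -ler_pdivrMl// mulr1.
have e2 : (N + H)%:R <= 2 * N%:R :> R by rewrite natrD; lra.
(* The diagonal counts for 1 and the correlations for 8, so the total is 18 [X]; the 64 [X] allowed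
   leaves the constant 8 unchanged by the induction. *)
apply: (@le_trans _ _ ((2 * N%:R) * (9 * (H%:R ^+ 2 * N%:R * y ^+ 2)))).
  rewrite ler_pM ?addr_ge0 ?mulr_ge0 ?exprn_ge0//; lra.
have : 0 <= H%:R ^+ 2 * N%:R ^+ 2 * y ^+ 2 by rewrite !mulr_ge0 ?exprn_ge0.
rewrite !exprMn; set X := _ * _ * _ => X0.
have -> : 2 * N%:R * (9 * (H%:R ^+ 2 * N%:R * y ^+ 2)) = 18 * X by rewrite /X; ring.
have -> : H%:R ^+ 2 * (8 ^+ 2 * N%:R ^+ 2 * y ^+ 2) = 64 * X by rewrite /X; ring.
lra.
Qed.

Lemma is_derive_combination (R : realType) (f1 f2 : R -> R) (s k sg c d1 d2 : R) :
  is_derive s 1 f1 d1 -> is_derive s 1 f2 d2 ->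
  is_derive s 1 (fun t => k * (f1 t + sg * f2 t) + c) (k * (d1 + sg * d2)).
Proof.
move=> h1 h2; rewrite -[X in is_derive _ _ _ X]addr0.
apply: (@is_deriveD R R R _ (cst c)).
Qed.

(** The lower bound on [df] is local while [d] may be arbitrarily large. As [df] has a constant
    sign, the increment over the first [N] units is not undone later. *)
Lemma derivative_gap (R : realType) (f df : R -> R) (s d N z : R) :
  0 < N -> 0 < d -> 0 <= z -> (forall t, s <= t -> is_derive t 1 f (df t)) ->
  (forall t, s <= t -> 0 <= df t) \/ (forall t, s <= t -> df t <= 0) ->
  (forall t, s <= t <= s + N -> z <= `|df t|) ->
  Num.min d N * z <= `|f (s + d) - f s|.
Proof.
move=> N0 d0 z0 fd sgn dz.
have step t h : s <= t -> 0 < h ->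
    exists2 c, t <= c <= t + h & f (t + h) - f t = h * df c.
  move=> st h0; apply: MVT_step => // u /andP[u1 _]; apply: fd; exact: le_trans u1.
have [dN|Nd] := leP d N.
  have [c /andP[c1 c2] ->] := step s d (lexx _) d0.
  rewrite normrM (gtr0_norm d0) ler_pM2l// dz// c1 (le_trans c2)// lerD2l//.
have [c /andP[c1 c2] e1] := step s N (lexx _) N0.
have [||c' /andP[c1' c2'] e2] := step (s + N) (d - N).
- by rewrite lerDl ltW.
- by rewrite subr_gt0.
have c'0 : s <= c' by apply: le_trans c1'; rewrite lerDl ltW.
have -> : f (s + d) - f s = N * df c + (d - N) * df c'.
  rewrite -e1 -e2 (_ : s + N + (d - N) = s + d); ring.
have dc : z <= `|df c| by rewrite dz// c1.
have dN : 0 <= d - N by rewrite subr_ge0 ltW.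
case: sgn => sgn; have := sgn _ c1; have := sgn _ c'0.
  move=> h1 h2; rewrite ger0_norm ?addr_ge0// ?mulr_ge0// ?(ltW N0)//.
  rewrite ger0_norm// in dc; apply: (@le_trans _ _ (N * df c)).
    by rewrite ler_pM2l.
  by rewrite lerDl mulr_ge0.
move=> h1 h2; rewrite ler0_norm; last first.
  by rewrite -oppr_ge0 opprD addr_ge0// oppr_ge0 mulr_ge0_le0// ltW.
rewrite ler0_norm// in dc; rewrite opprD; apply: (@le_trans _ _ (N * - df c)).
  by rewrite ler_pM2l.
by rewrite mulrN lerDl oppr_ge0 mulr_ge0_le0.
Qed.

(** In the application [A] is N^alpha, [Q] is N^eta and [k] is 2 pi. The sign [sg] selects the sum
    or the difference of two phases; the difference is handled by one more derivative, which needs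
    [d] to be at least [N / E]. The factor 64 is the loss between [N] and [4 N] in
    [powR_dyadic_bounds]. *)
Lemma phase_sum_bound (R : realType) (f : nat -> R -> R) (m d a L N E : nat)
    (A Q M y k sg c : R) :
  (forall i (s : R), (i <= m.+1)%N -> N%:R <= s -> is_derive s 1 (f i) (f i.+1 s)) ->
  (forall s : R, N%:R <= s -> 0 <= f m.+1 s <= M * A * Q / N%:R) ->
  (forall s : R, N%:R <= s -> `|f m.+2 s| <= M * A * Q / N%:R ^+ 2) ->
  (forall s : R, N%:R <= s <= 4 * N%:R -> A / (64 * M * N%:R * Q) <= f m.+1 s) ->
  (forall s : R, N%:R <= s <= 4 * N%:R -> A / (64 * M * N%:R ^+ 2 * Q) <= `|f m.+2 s|) ->
  (forall s : R, N%:R <= s -> 0 <= f m.+2 s) \/ (forall s : R, N%:R <= s -> f m.+2 s <= 0) ->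
  1 <= M -> 0 < A -> 1 <= Q -> (0 < E <= N)%N ->
  E%:R ^+ m * (16 * M * A * Q) <= N%:R -> 96 * M * E%:R ^+ 2 * Q <= A ->
  16 * 64 ^+ 2 * M ^+ 3 * Q ^+ 3 * E%:R ^+ 3 <= A ->
  0 <= y <= 1 -> E%:R^-1 <= y ^+ (2 ^ m) ->
  1 <= k <= 8 -> sg = 1 \/ sg = -1 /\ (N <= E * d)%N ->
  (N <= a)%N -> (a + L <= 2 * N)%N ->
  `|\sum_(i < L) cos (k * (f 0%N (a%:R + i%:R + d%:R) + sg * f 0%N (a%:R + i%:R)) + c)|
  <= 8 * N%:R * y.
Proof.
move=> fd up1 up2 lo1 lo2 sgn M1 A0 Q1 /andP[E0 EN] c1 c2 c3 y01 Ey /andP[k1 k8] sg1 Na aL.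
have N0 : 0 < N%:R :> R by rewrite ltr0n (leq_trans E0).
have E0' : 0 < E%:R :> R by rewrite ltr0n.
have M0 : 0 < M by apply: lt_le_trans M1.
have Q0 : 0 < Q by apply: lt_le_trans Q1.
have k0 : 0 < k by apply: lt_le_trans k1.
have d0 : 0 <= d%:R :> R by [].
pose g i s := k * (f i (s + d%:R) + sg * f i s) + (if i is 0%N then c else 0).
have Ns (s : R) : a%:R <= s <= a%:R + L%:R -> N%:R <= s <= 2 * N%:R.
  move=> /andP[s1 s2]; apply/andP; split.
    by apply: le_trans s1; rewrite ler_nat.
  by apply: (le_trans s2); rewrite -natrD -natrM ler_nat.
have Nsd (s : R) : N%:R <= s -> N%:R <= s + d%:R by move=> h; lra.
have sgn1 : `|sg| = 1.
  by case: sg1 => [->|[-> _]]; rewrite ?normrN normr1.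
have ub (x z u : R) : `|x| <= u -> `|z| <= u -> `|k * (x + sg * z)| <= 16 * u.
  move=> xu zu; rewrite normrM (gtr0_norm k0).
  have h1 : `|x + sg * z| <= 2 * u.
    by apply: (le_trans (ler_normD _ _)); rewrite normrM sgn1 mul1r; lra.
  apply: (@le_trans _ _ (8 * (2 * u))); last by lra.
  by rewrite ler_pM// ltW.
have gM i s : (0 < i)%N -> g i s = k * (f i (s + d%:R) + sg * f i s).
  by case: i => // i _; rewrite /g addr0.
(* For [sg = -1] the bound on [f m.+2] is multiplied by a distance that may be as small as [N / E];
   this is the factor [E] lost here. *)
pose rho := A / (64 * M * E%:R * N%:R * Q).
have rho0 : 0 < rho by rewrite /rho divr_gt0// !mulr_gt0.
have glow (s : R) : N%:R <= s <= 2 * N%:R -> rho <= `|f m.+1 (s + d%:R) + sg * f m.+1 s|.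
  move=> /andP[s1 s2].
  case: sg1 => [->|[-> NEd]].
    rewrite mul1r ger0_norm; last first.
      by have /andP[? _] := up1 _ s1; have /andP[? _] := up1 _ (Nsd _ s1); rewrite addr_ge0.
    have /andP[h1 _] := up1 _ (Nsd _ s1).
    have h2 : A / (64 * M * N%:R * Q) <= f m.+1 s by apply: lo1; rewrite s1/=; lra.
    apply: (@le_trans _ _ (f m.+1 s)); last by rewrite lerDr.
    apply: le_trans h2; rewrite /rho ler_wpM2l ?(ltW A0)// lef_pV2 ?posrE ?mulr_gt0//.
    have e1 : 1 <= E%:R :> R by rewrite ler1n.
    by rewrite ler_wpM2r ?(ltW Q0)// ler_wpM2r ?(ltW N0)// ler_peMr// mulr_ge0// ltW.
  have d1 : 0 < d%:R :> R.
    rewrite ltr0n lt0n; apply/eqP => de; move: NEd; rewrite de muln0 leqn0 => /eqP Ne.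
    by rewrite Ne ltxx in N0.
  rewrite mulN1r.
  have gap := @derivative_gap R (f m.+1) (f m.+2) s d%:R N%:R
     (A / (64 * M * N%:R ^+ 2 * Q)) N0 d1.
  apply: le_trans (gap _ _ _ _).
  - have -> : rho = N%:R / E%:R * (A / (64 * M * N%:R ^+ 2 * Q)).
      by rewrite /rho; field; rewrite !lt0r_neq0.
    rewrite ler_pM2r; last by rewrite divr_gt0// !mulr_gt0// exprn_gt0.
    rewrite le_min; apply/andP; split; rewrite ler_pdivrMr//.
      by rewrite -natrM ler_nat mulnC.
    by rewrite ler_peMr ?ler1n// ltW.
  - by rewrite divr_ge0 ?(ltW A0)// ltW// !mulr_gt0// exprn_gt0.
  - by move=> t st; apply: fd => //; exact: le_trans st.
  - by case: sgn => sgn; [left|right] => t st; apply: sgn; exact: le_trans st.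
  - move=> t /andP[t1 t2]; apply: lo2; rewrite (le_trans s1 t1) (le_trans t2)//.
    by clear - s2 N0; lra.
apply: (@exp_sum_bound R m g a%:R L N E rho (16 * (M * A * Q / N%:R))
  (16 * (M * A * Q / N%:R ^+ 2)) y) => //.
- by rewrite -(leq_add2l a) (leq_trans aL)// mul2n -addnn leq_add2r.
- by rewrite E0.
- by rewrite mulr_ge0// divr_ge0 ?exprn_ge0// !mulr_ge0// ltW.
- move=> i s im /Ns/andP[s1 s2]; rewrite (gM i.+1)//; apply: is_derive_combination.
    have h : is_derive (s + d%:R) 1 (f i) (f i.+1 (s + d%:R)) by apply: fd => //; exact: Nsd.
    rewrite -[X in is_derive _ _ _ X]mulr1.
    by apply: (@is_derive1_comp R (f i) (shift d%:R)); exact: is_derive_shift.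
  exact: fd.
- move=> s /Ns sN; have /andP[s1 s2] := sN; rewrite gM//; apply/andP; split.
    rewrite normrM (gtr0_norm k0); apply: (le_trans (glow _ sN)).
    by rewrite ler_peMl.
  have /andP[h1 h2] := up1 _ s1; have /andP[h3 h4] := up1 _ (Nsd _ s1).
  by apply: ub; rewrite ger0_norm.
- move=> s /Ns/andP[s1 s2]; rewrite gM//; apply: ub; apply: up2 => //; exact: Nsd.
- have -> : E%:R ^+ m * (16 * (M * A * Q / N%:R)) = E%:R ^+ m * (16 * M * A * Q) / N%:R.
    by ring.
  by rewrite ler_pdivrMr// mul1r.
- have -> : 6 / rho = 4 * N%:R / E%:R * (96 * M * E%:R ^+ 2 * Q / A).
    by rewrite /rho; field; rewrite !lt0r_neq0.
  by rewrite ler_piMr ?divr_ge0 ?mulr_ge0// ler_pdivrMr// mul1r.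
- have -> : 16 * (M * A * Q / N%:R ^+ 2) / rho ^+ 2 =
      E%:R^-1 * (16 * 64 ^+ 2 * M ^+ 3 * Q ^+ 3 * E%:R ^+ 3 / A).
    by rewrite /rho; field; rewrite !lt0r_neq0.
  by rewrite ler_piMr// ler_pdivrMr// mul1r.
Qed.

(** * From the growth conditions on [p] to exponential sums *)

Lemma derive_on_is_derive (R : realType) (A : set R) (f : R -> R) (s : R) :
  nbhs s A -> derivable_on A f s -> is_derive s 1 f (derive_on A f s).
Proof.
move=> As fs.
(* At an interior point the restriction of the increments to [A] is no restriction near [0]. *)
have FE : within [set h | A (s + h)] 0^' = 0^'.
  have A0 : \forall h \near 0^', A (s + h).
    apply: cvg_within; apply: (@cvgD _ _ _ (nbhs (0 : R)) _ (cst s) id s 0).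
    - exact: cvg_cst.
    - exact: cvg_id.
    - by rewrite addr0.
  apply/seteqP; split=> U HU; last first.
    exact: (@cvg_within _ _ _ [set h | A (s + h)] U HU).
  by apply: filterS2 A0 HU => h /= Ah; apply.
have EE : (fun h => h^-1 * (f (s + h) - f s)) =
    (fun h => h^-1 *: ((f \o shift s) (h *: 1) - f s)).
  by apply/funext => h; rewrite /= [h *: 1]mulr1 (addrC h).
by apply: DeriveDef; move: fs; rewrite /derivable_on /derive_on /derivable /derive FE EE.
Qed.

Lemma nbhs_itv1_infty (R : realType) (s : R) : 1 < s -> nbhs s `[1, +oo[%classic.
Proof.
move=> s1; near=> x; rewrite /= in_itv/= andbT ltW//; near: x.
exact: lt_nbhsr.
Unshelve. all: by end_near. Qed.

(** The last derivative is bounded below only in absolute value; continuity supplies the constant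
    sign that [derivative_gap] asks for. *)
Lemma sign_const (R : realType) (g : R -> R) :
  {within `[1, +oo[%classic, continuous g} -> (forall s, 1 <= s -> g s != 0) ->
  (forall s, 1 <= s -> 0 <= g s) \/ (forall s, 1 <= s -> g s <= 0).
Proof.
move=> gc g0.
have key x y : 1 <= x -> 1 <= y -> 0 < g x -> 0 <= g y.
  move=> x1 y1 gx; have [//|gy] := leP 0 (g y).
  pose a := Num.min x y; pose b := Num.max x y.
  have ab : a <= b by rewrite ge_min le_max lexx.
  have a1 : 1 <= a by rewrite le_min x1.
  have [||c] := @IVT R g a b 0 ab.
  - apply: continuous_subspaceW gc => t /=; rewrite !in_itv/= andbT => /andP[+ _].
    exact: le_trans.
  - rewrite /a /b; have [xy|xy] := leP x y.
      by rewrite min_r ?max_l ?(ltW gy) ?(ltW gx)//; apply: ltW; apply: lt_trans gx.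
    by rewrite min_l ?max_r ?(ltW gy) ?(ltW gx)//; apply: ltW; apply: lt_trans gx.
  by rewrite in_itv/= => /andP[ac _] gc0; move: (g0 c (le_trans a1 ac)); rewrite gc0 eqxx.
have [g1|g1] := leP (g 1) 0; [right|left] => s s1; last exact: (key 1).
by have [//|gs] := leP (g s) 0; have := key s 1 s1 (lexx _) gs => g1'; move: (g0 1 (lexx _)); rewrite eq_le g1 g1'.
Qed.

Lemma powR_dyadic_bounds (R : realType) (N s e : R) :
  1 <= N -> 0 <= e <= 3 -> N <= s <= 4 * N ->
  N `^ (- e) / 64 <= s `^ (- e).
Proof.
move=> N1 /andP[e0 e3] /andP[s1 s2].
have N0 : 0 < N by apply: lt_le_trans N1.
have s0 : 0 < s by apply: lt_le_trans s1.
have h1 : s `^ e <= (4 * N) `^ e by rewrite ge0_ler_powR// nnegrE ?mulr_ge0// ltW.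
have h2 : 4 `^ e <= 64 :> R.
  apply: (@le_trans _ _ (4 `^ 3)); first by rewrite ler_powR// ler1n.
  by rewrite (powR_mulrn 3)// !exprS expr0; lra.
rewrite !powRN -invfM lef_pV2 ?posrE ?mulr_gt0 ?powR_gt0//.
by apply: (le_trans h1); rewrite powRM ?(ltW N0)// mulrC ler_wpM2l// powR_ge0.
Qed.

Lemma powR_opp_le (R : realType) (N s e : R) : 0 < N -> 0 <= e -> N <= s ->
  s `^ (- e) <= N `^ (- e).
Proof.
move=> N0 e0 Ns; have s0 : 0 < s by apply: lt_le_trans Ns.
rewrite !powRN lef_pV2 ?posrE ?powR_gt0//.
by rewrite ge0_ler_powR// nnegrE ltW.
Qed.

Lemma weighted_sum_bound (R : realFieldType) (c W : nat -> R) (B : R) (n : nat) :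
  (forall k, (k <= n)%N -> `|\sum_(i < k) c i| <= B) ->
  (forall k, (k < n)%N -> W k.+1 <= W k) -> (forall k, (k <= n)%N -> 0 <= W k) ->
  `|\sum_(i < n) c i * W i| <= B * W 0%N.
Proof.
move=> cB Wd W0.
(* Abel summation: with the boundary term subtracted, each step adds a partial sum of [c] times a
   decrement of [W]. *)
have key k : (k <= n)%N ->
    `|\sum_(i < k) c i * W i - (\sum_(i < k) c i) * W k| <= B * (W 0%N - W k).
  elim: k => [|k IH] kn; first by rewrite !big_ord0 mul0r !subrr normr0 mulr0.
  rewrite !big_ord_recr/=.
  set T := \sum_(i < k) c i * W i in IH *; set U := \sum_(i < k) c i in IH *.
  have -> : T + c k * W k - (U + c k) * W k.+1 =
      (T - U * W k) + (U + c k) * (W k - W k.+1) by ring.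
  have -> : B * (W 0%N - W k.+1) = B * (W 0%N - W k) + B * (W k - W k.+1) by ring.
  apply: (le_trans (ler_normD _ _)); apply: lerD; first exact: IH (ltnW kn).
  have d0 : 0 <= W k - W k.+1 by rewrite subr_ge0 Wd.
  rewrite normrM (ger0_norm d0) ler_wpM2r//.
  by have := cB k.+1 kn; rewrite big_ord_recr.
have k1 := key n (leqnn n).
have -> : B * W 0%N = B * (W 0%N - W n) + B * W n by ring.
rewrite -[X in `|X|](subrK ((\sum_(i < n) c i) * W n)).
apply: (le_trans (ler_normD _ _)); apply: lerD => //.
by rewrite normrM (ger0_norm (W0 _ (leqnn _))) ler_wpM2r ?W0 ?cB.
Qed.

(** * Correlations of dyadic blocks *)

Definition block (R : nmodType) (u : nat -> R) (j n : nat) : R :=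
  if (2 ^ j <= n < 2 ^ j.+1)%N then u n else 0.

(** This is all that the sequel retains of [p]. Arbitrary ranges [a <= n < b] make the conditions
    stable under truncation of [u]. Differences below [gap j'] will be estimated by size alone, at a
    cost that [osc_gap] keeps within [w ^+ j']. *)
Record oscillating_kernel (R : realType) (u : nat -> R) (C w : R)
    (gap : nat -> nat) : Prop := {
  osc_const : 1 <= C ;
  osc_ratio : 2^-1 <= w < 1 ;
  osc_bound : forall n, `|u n| <= n%:R^-1 ;
  osc_gap : forall j, (gap j)%:R <= C * 2 ^+ j * w ^+ j ;
  osc_correlation : forall j j' d a b, (j' <= j)%N -> (gap j' <= d)%N ->
    `|\sum_(a <= n < b) block u j (n + d)%N * block u j' n| <= C * w ^+ j' / 2 ^+ j }.

(* With [q > 7 m / delta] and [N = 2 ^ j], the power [E ^ (7 m)] of [E = 2 ^ (j / q)] is at most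
   [N ^ delta], which absorbs every power of [E] lost in the estimates. *)
Definition eta0 (R : realType) (delta : R) (m : nat) : R :=
  (Num.truncn (7 * m%:R / delta)).+1%:R^-1.

Lemma sum_nat_support (R : nmodType) (G : nat -> R) (a b a1 b1 : nat) :
  (forall n, ~~ (a1 <= n < b1)%N -> G n = 0) ->
  \sum_(a <= n < b) G n =
  \sum_(i < minn b b1 - maxn a a1) G (maxn a a1 + i)%N.
Proof.
move=> G0; set l := maxn a a1; set h := minn b b1.
have [lh|hl] := leqP l h; last first.
  have -> : (h - l = 0)%N by apply/eqP; rewrite subn_eq0 ltnW.
  rewrite big_ord0 big1_seq// => n /=; rewrite mem_index_iota => ni.
  by apply: G0; move: hl; rewrite /l /h; lia.
have al : (a <= l)%N by rewrite leq_maxl.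
have hb : (h <= b)%N by rewrite geq_minl.
rewrite (big_cat_nat al) /=; last exact: leq_trans hb.
rewrite [X in X + _]big1_seq ?add0r; last first.
  move=> n /=; rewrite mem_index_iota => ni; apply: G0; move: ni lh; rewrite /l /h; lia.
rewrite (big_cat_nat lh hb) /= [X in _ + X]big1_seq ?addr0; last first.
  move=> n /=; rewrite mem_index_iota => ni; apply: G0; move: ni lh; rewrite /l /h; lia.
rewrite -(big_mkord xpredT (fun i => G (l + i)%N)).
under [RHS]eq_bigr do rewrite addnC.
transitivity (\sum_(0 + l <= n < h) G n); first by rewrite add0n.
by rewrite big_addn.
Qed.

(* With [N = 2 ^ j], [A = N ^ alpha], [Q = N ^ eta] and [E = 2 ^ (j / q)], these are the
   size conditions of [phase_sum_bound]. *)
Lemma dyadic_size_conditions (R : realType) (delta alpha eta M : R) (m q j : nat) :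
  let N : R := 2 ^+ j in let E : R := 2 ^+ (j %/ q) in
  let A := N `^ alpha in let Q := N `^ eta in
  0 < delta -> (0 < q)%N -> (1 <= m)%N -> 7 * m%:R / delta <= q%:R ->
  delta <= alpha <= 1 - delta -> 0 < eta <= q%:R^-1 -> 1 <= M ->
  16 * 64 ^+ 2 * 8 * M ^+ 3 <= E ->
  [/\ 1 <= Q, E ^+ m * (16 * M * A * Q) <= N, 96 * M * E ^+ 2 * Q <= A &
      16 * 64 ^+ 2 * M ^+ 3 * Q ^+ 3 * E ^+ 3 <= A].
Proof.
move=> N E A Q d0 q0 m1 qd /andP[a1 a2] /andP[e0 eq] M1 cE.
have M0 : 0 < M by apply: lt_le_trans M1.
have q0' : 0 < q%:R :> R by rewrite ltr0n.
have NE : N = 2 `^ j%:R by rewrite /N powR_mulrn.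
have EE k : E ^+ k = 2 `^ ((j %/ q) * k)%:R by rewrite /E powR_mulrn// exprM.
have two1 : 1 <= 2 :> R by lra.
have M3 : M <= M ^+ 3 by rewrite exprS ler_peMr ?(ltW M0)// exprn_ege1.
have E1 : 1 <= E by rewrite /E exprn_ege1.
have E0 : 0 < E by apply: lt_le_trans E1.
have jq : (j %/ q)%:R <= j%:R / q%:R :> R.
  by rewrite ler_pdivlMr// -natrM ler_nat leq_divM.
have jd : ((j %/ q) * (7 * m))%:R <= j%:R * delta.
  rewrite natrM; apply: (@le_trans _ _ (j%:R / q%:R * (7 * m)%:R)).
    by rewrite ler_wpM2r.
  rewrite -mulrA ler_wpM2l// ler_pdivrMl//.
  by move: qd; rewrite ler_pdivrMr// natrM.
have cA : E ^+ (7 * m) <= A.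
  rewrite EE /A NE -powRrM ler_powR//; apply: (le_trans jd).
  by rewrite ler_wpM2l.
have A0 : 0 < A by rewrite /A powR_gt0// NE powR_gt0.
have cN : E ^+ (7 * m) * A <= N.
  rewrite EE /A NE -powRrM -powRD ?pnatr_eq0 ?implybT// ler_powR//.
  apply: (@le_trans _ _ (j%:R * delta + j%:R * alpha)); first by rewrite lerD2r.
  by rewrite -mulrDr -[leRHS]mulr1 ler_wpM2l//; lra.
have Q1 : 1 <= Q.
  rewrite /Q NE -powRrM -[leLHS](powRr0 2) ler_powR// mulr_ge0// ltW//.
have QE : Q <= 2 * E.
  rewrite /Q /E -exprS NE -powRrM -powR_mulrn// ler_powR//.
  apply: (@le_trans _ _ (j%:R / q%:R)); first by rewrite ler_wpM2l.
  by rewrite ler_pdivrMr// -natrM ler_nat ltnW// ltn_ceil.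
have Q0 : 0 <= Q by apply: le_trans Q1.
have cM : 192 * M <= E.
  by apply: le_trans cE; clear - M3 M0; nra.
have powE a b : (a <= b)%N -> E ^+ a <= E ^+ b by move=> ab; exact: ler_weXn2l.
split=> //.
- apply: le_trans cN; rewrite (_ : _ * _ = (16 * M * Q) * E ^+ m * A); last by ring.
  rewrite ler_wpM2r ?(ltW A0)//; apply: (@le_trans _ _ (E ^+ (2 + m))); last first.
    by apply: powE; clear - m1; lia.
  rewrite exprD ler_wpM2r ?exprn_ge0 ?(ltW E0)//.
  apply: (@le_trans _ _ (16 * M * (2 * E))).
    by rewrite ler_wpM2l// mulr_ge0// ltW.
  by rewrite expr2 mulrA ler_wpM2r ?(ltW E0)//; clear - cM M0; lra.
- apply: le_trans cA; apply: (@le_trans _ _ (E ^+ 4)); last by apply: powE; clear - m1; lia.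
  apply: (@le_trans _ _ (96 * M * E ^+ 2 * (2 * E))).
    by rewrite ler_wpM2l// !mulr_ge0 ?exprn_ge0// ltW.
  rewrite (_ : _ * _ = 192 * M * E ^+ 3); last by ring.
  by rewrite [leRHS]exprS ler_wpM2r// exprn_ge0// ltW.
- apply: le_trans cA; apply: (@le_trans _ _ (E ^+ 7)); last by apply: powE; clear - m1; lia.
  apply: (@le_trans _ _ (16 * 64 ^+ 2 * M ^+ 3 * (2 * E) ^+ 3 * E ^+ 3)).
    rewrite ler_wpM2r ?exprn_ge0 ?(ltW E0)// ler_wpM2l ?mulr_ge0 ?exprn_ge0 ?(ltW M0)//.
    by rewrite lerXn2r// nnegrE// mulr_ge0// ltW.
  rewrite (_ : _ * _ = (16 * 64 ^+ 2 * 8 * M ^+ 3) * E ^+ 6); last by ring.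
  by rewrite [leRHS]exprS ler_wpM2r// exprn_ge0// ltW.
Qed.

Lemma half_root (R : realType) (K : nat) : (0 < K)%N ->
  exists2 w : R, 2^-1 <= w < 1 & w ^+ K = 2^-1.
Proof.
move=> K0; have K0' : 0 < K%:R :> R by rewrite ltr0n.
have wK : (2 `^ (- K%:R^-1)) ^+ K = 2^-1 :> R.
  by rewrite -powR_mulrn ?powR_ge0// -powRrM mulNr mulVf ?lt0r_neq0// powR_inv1.
exists (2 `^ (- K%:R^-1)) => //; apply/andP; split.
  rewrite -(@powR_inv1 _ 2)// ler_powR ?ler1n// lerN2 invf_le1//.
  by rewrite ler1n.
rewrite ltNge; apply/negP => /(exprn_ege1 K); rewrite wK; lra.
Qed.

Lemma powR_split1 (R : realType) (N a e : R) : 0 < N ->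
  N `^ (- (1 - a - e)) = N `^ a * N `^ e / N.
Proof.
move=> N0; have N0' := lt0r_neq0 N0.
rewrite (_ : - (1 - a - e) = a + e - 1); last by ring.
by rewrite powRB ?powRD ?N0' ?implybT// powRr1// ltW.
Qed.

Lemma powR_split2 (R : realType) (N a e : R) : 0 < N ->
  N `^ (- (2 - a - e)) = N `^ a * N `^ e / N ^+ 2.
Proof.
move=> N0; rewrite (_ : - (2 - a - e) = - (1 - (a - 1) - e)); last by ring.
rewrite powR_split1// powRB ?lt0r_neq0 ?implybT// powRr1 ?ltW//.
by field; rewrite lt0r_neq0.
Qed.

Lemma admissible_phase_sum (R : realType) (p : R -> R) :
  admissible (@eta0 R) p ->
  exists J q : nat, exists w : R,
  [/\ (0 < q)%N, 2^-1 <= w < 1,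
      forall j, (J <= j)%N -> (2 ^+ (j %/ q))^-1 <= w ^+ j &
      forall (j d a L : nat) (sg c : R), (J <= j)%N ->
        sg = 1 \/ sg = -1 /\ (2 ^ (j - j %/ q) <= d)%N ->
        (2 ^ j <= a)%N -> (a + L <= 2 ^ j.+1)%N ->
        `|\sum_(i < L) cos (2 * pi * (p (a + i + d)%:R + sg * p (a + i)%:R) + c)|
        <= 8 * 2 ^+ j * w ^+ j].
Proof.
move=> [delta [M [m [/andP[d0 d2] M1 m1 [_ [pd pc] [alpha [eta [/andP[a1 a2] /andP[e0 eq] b1 b2]]]]]]]].
set f := fun j => deriven_on `[1, +oo[ j p.
pose q := (Num.truncn (7 * m%:R / delta)).+1.
have q0 : (0 < q)%N by [].
have qd : 7 * m%:R / delta <= q%:R by apply: ltW; exact: truncnS_gt.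
have M0 : 0 < M by apply: lt_le_trans M1.
have m1' : 1 <= m%:R :> R by rewrite ler1n.
(* This keeps the exponent [1 - alpha - eta] nonnegative, so that the upper bounds on the
   derivatives decrease in [s]. *)
have etad : eta <= delta.
  apply: (le_trans eq); rewrite /eta0 -/q -[leRHS]invrK lef_pV2 ?posrE ?invr_gt0 ?ltr0n//.
  apply: le_trans qd; rewrite ler_peMl ?invr_ge0 ?(ltW d0)//; clear - m1'; lra.
(* With [w ^+ K = 2^-1] the power [(w ^+ j) ^+ (2 ^ m)] is 2^(-j / (2 q)); the extra 2 absorbs the
   rounding in [j %/ q], as j <= 2 q (j %/ q) once the quotient is positive. *)
pose K := (2 * q * 2 ^ m)%N.
have K0 : (0 < K)%N by rewrite !muln_gt0 expn_gt0.
have [w w1 wK] := @half_root R K K0.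
have /andP[wl wu] := w1.
have w0 : 0 <= w by apply: le_trans wl; rewrite invr_ge0.
(* The size that [dyadic_size_conditions] requires of [E]; 2^(j %/ q) reaches it from [J = e * q]
   on. *)
pose c := 16 * 64 ^+ 2 * 8 * M ^+ 3.
pose e := (Num.truncn c).+1.
have ce : c <= 2 ^+ e.
  apply: (@le_trans _ _ e%:R); first by apply: ltW; exact: truncnS_gt.
  by rewrite -natrX ler_nat ltnW// ltn_expl.
pose J := (e * q)%N.
have Jq j : (J <= j)%N -> (e <= j %/ q)%N by rewrite leq_divRL.
have Ey j : (J <= j)%N -> (2 ^+ (j %/ q))^-1 <= (w ^+ j) ^+ (2 ^ m).
  move=> /Jq ej; rewrite -exprVn -wK -!exprM ler_wiXn2l ?(ltW wu)//.
  have h1 : (j <= 2 * q * (j %/ q))%N.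
    apply: (leq_trans (ltnW (ltn_ceil j q0))).
    by rewrite mulnC -mulnA mulnCA leq_pmul2l// mul2n -addnn -[X in (X <= _)%N]addn1 leq_add2l (leq_trans _ ej).
  by rewrite /K (mulnAC (2 * q)%N) leq_mul2r h1 orbT.
exists J, q, w; split => //.
  move=> j Jj; apply: (le_trans (Ey _ Jj)).
  rewrite -[leRHS]expr1 ler_wiXn2l ?exprn_ge0 ?exprn_ile1 ?(ltW wu)// expn_gt0//.
move=> j d a L sg cc Jj sgd ja aL.
have Ege := Jq _ Jj.
have j0 : (0 < j)%N.
  by rewrite lt0n; apply/eqP => j0; move: Ege; rewrite j0 div0n /e.
have N1 : 1 < (2 ^ j)%:R :> R by rewrite ltr1n -[X in (X < _)%N](expn0 2) ltn_exp2l.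
have N0 : 0 < (2 ^ j)%:R :> R by apply: lt_trans N1.
have cE : c <= 2 ^+ (j %/ q) by apply: (le_trans ce); rewrite ler_weXn2l// ler1n.
have := @dyadic_size_conditions R delta alpha eta M m q j d0 q0 m1 qd _ _ M1 cE.
rewrite a1 a2 e0 -!(natrX _ 2) => /(_ isT eq) [Q1 s1 s2 s3].
have ub1 (s : R) : (2 ^ j)%:R <= s -> 1 <= s by move=> h; exact: le_trans (ltW N1) h.
have A0 : 0 < (2 ^ j)%:R `^ alpha by rewrite powR_gt0.
have eA1 : m%:R + alpha + eta - m.+1%:R = - (1 - alpha - eta).
  by rewrite -natr1; ring.
have eA2 : m%:R + alpha - eta - m.+1%:R = - (1 - alpha - - eta).
  by rewrite -natr1; ring.
have eB1 : alpha + eta - 2 = - (2 - alpha - eta) by ring.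
have eB2 : alpha - eta - 2 = - (2 - alpha - - eta) by ring.
have pN : (2 ^ j)%:R `^ (- eta) = ((2 ^ j)%:R `^ eta)^-1 by rewrite powRN.
have Q0 : 0 < (2 ^ j)%:R `^ eta by apply: lt_le_trans Q1.
under eq_bigr do rewrite !natrD.
apply: (@phase_sum_bound R f m d a L (2 ^ j) (2 ^ (j %/ q))
   ((2 ^ j)%:R `^ alpha) ((2 ^ j)%:R `^ eta) M (w ^+ j) (2 * pi) sg cc) => //.
- move=> i s im sN; apply: derive_on_is_derive.
    by apply: nbhs_itv1_infty; exact: lt_le_trans sN.
  by apply: pd => //; rewrite /= in_itv/= andbT ub1.
- move=> s sN; have /andP[h1 h2] := b1 m.+1 s (leqnn _) (ub1 _ sN).
  apply/andP; split.
    by apply: le_trans h1; rewrite mulr_ge0 ?invr_ge0 ?powR_ge0// ltW.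
  apply: (le_trans h2); rewrite -!mulrA ler_pM2l// mulrA -powR_split1// eA1.
  by apply: powR_opp_le => //; clear - a2 etad; lra.
- move=> s sN; have /andP[h1 h2] := b2 s (ub1 _ sN).
  apply: (le_trans h2); rewrite -!mulrA ler_pM2l// mulrA -powR_split2// eB1.
  by apply: powR_opp_le => //; clear - a2 etad d2 d0; lra.
- move=> s /andP[sN s4]; have /andP[h1 h2] := b1 m.+1 s (leqnn _) (ub1 _ sN).
  apply: le_trans h1; rewrite eA2.
  apply: (@le_trans _ _ (M^-1 * ((2 ^ j)%:R `^ (- (1 - alpha - - eta)) / 64))).
    rewrite powR_split1// pN le_eqVlt; apply/orP; left; apply/eqP.
    by field; rewrite !lt0r_neq0.
  rewrite ler_pM2l ?invr_gt0//; apply: powR_dyadic_bounds => //; first exact: ltW.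
  + by apply/andP; split; clear - a1 a2 d0 d2 e0 etad; lra.
  + by rewrite sN.
- move=> s /andP[sN s4]; have /andP[h1 h2] := b2 s (ub1 _ sN).
  apply: le_trans h1; rewrite eB2.
  apply: (@le_trans _ _ (M^-1 * ((2 ^ j)%:R `^ (- (2 - alpha - - eta)) / 64))).
    rewrite powR_split2// pN le_eqVlt; apply/orP; left; apply/eqP.
    by field; rewrite !lt0r_neq0.
  rewrite ler_pM2l ?invr_gt0//; apply: powR_dyadic_bounds => //; first exact: ltW.
  + by apply/andP; split; clear - a1 a2 d0 d2 e0 etad; lra.
  + by rewrite sN.
- have [||h|h] := @sign_const R (f m.+2).
  + exact: pc.
  + move=> s s1'; have /andP[h1 _] := b2 s s1'.
    rewrite -normr_gt0; apply: lt_le_trans h1.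
    by rewrite mulr_gt0 ?invr_gt0// powR_gt0//; exact: lt_le_trans s1'.
  + by left => s /ub1; exact: h.
  + by right => s /ub1; exact: h.
- by rewrite expn_gt0 leq_pexp2l// leq_div.
- by rewrite exprn_ge0// exprn_ile1// ltW.
- by rewrite natrX; exact: Ey.
- have := pi_ge2 R; have := pihalf_lt2 R; set t := pi; clear; move=> ? ?.
  by apply/andP; split; lra.
- case: sgd => [->|[-> dd]]; [by left|right; split=> //].
  apply: (@leq_trans (2 ^ (j %/ q) * 2 ^ (j - j %/ q))); last by rewrite leq_pmul2l// expn_gt0.
  by rewrite -expnD subnKC// leq_div.
- by rewrite -expnS.
Qed.

(** The phase estimates start at scale [J], so smaller [n] are removed. The free phase [phi] treats
    cosine and sine at once. *)
Definition trig_kernel (R : realType) (p : R -> R) (J : nat) (phi : R) (n : nat) : R :=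
  if (2 ^ J <= n)%N then cos (2 * pi * p n%:R + phi) / n%:R else 0.

Lemma admissible_oscillating_kernel (R : realType) (p : R -> R) :
  admissible (@eta0 R) p ->
  exists (J : nat) (C w : R) (gap : nat -> nat),
    forall phi, oscillating_kernel (trig_kernel p J phi) C w gap.
Proof.
move=> /admissible_phase_sum[J [q [w [q0 /andP[wl wu] Ew phase]]]].
have w0 : 0 < w by apply: lt_le_trans wl; rewrite invr_gt0.
(* The gap is N / E, the least [d] for which the difference of phases is controlled. The 8 comes
   from the phase sums, and [(w ^+ J)^-1] pays for the gaps at scales below [J]. *)
exists J, (8 + (w ^+ J)^-1), w, (fun j => 2 ^ (j - j %/ q))%N => phi.
have wJ0 : 0 < (w ^+ J)^-1 by rewrite invr_gt0 exprn_gt0.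
have C8 : 8 <= 8 + (w ^+ J)^-1 by rewrite lerDl ltW.
split => //.
- by apply: le_trans C8; rewrite ler1n.
- by rewrite wl wu.
- move=> n; rewrite /trig_kernel; case: ifP => _; last by rewrite normr0 invr_ge0.
  by rewrite normrM normfV normr_nat ler_piMl ?invr_ge0// cos_max.
- move=> j; have jq : (j %/ q <= j)%N by rewrite leq_div.
  have -> : (2 ^ (j - j %/ q))%:R = 2 ^+ j * (2 ^+ (j %/ q))^-1 :> R.
    by rewrite natrX -[X in _ = 2 ^+ X / _](subnK jq) exprD mulfK// expf_neq0.
  rewrite (mulrC _ (2 ^+ j)) -mulrA ler_pM2l ?exprn_gt0//.
  have [Jj|jJ] := leqP J j.
    apply: (le_trans (Ew _ Jj)); rewrite ler_peMl ?exprn_ge0 ?(ltW w0)//.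
    by apply: le_trans C8; rewrite ler1n.
  apply: (@le_trans _ _ 1).
    by rewrite invf_le1 ?exprn_gt0// exprn_ege1// ler1n.
  apply: (@le_trans _ _ ((w ^+ J)^-1 * w ^+ J)).
    by rewrite mulVf// expf_neq0// lt0r_neq0.
  apply: ler_pM => //; first exact: ltW.
  - by rewrite exprn_ge0// ltW.
  - by rewrite lerDr.
  - by rewrite ler_wiXn2l ?(ltW w0) ?(ltW wu)// ltnW.
move=> j j' d a b jj gd.
set u := trig_kernel p J phi.
have rhs0 : 0 <= (8 + (w ^+ J)^-1) * w ^+ j' / 2 ^+ j.
  by rewrite divr_ge0 ?exprn_ge0// mulr_ge0 ?exprn_ge0 ?(ltW w0)// addr_ge0// ltW.
have [Jj'|j'J] := leqP J j'; last first.
  rewrite big1 ?normr0// => n _; rewrite [X in _ * X](_ : _ = 0) ?mulr0//.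
  rewrite /block; case: ifP => // /andP[_ n2]; rewrite /u /trig_kernel leqNgt.
  by rewrite (leq_trans n2)// leq_pexp2l.
rewrite (@sum_nat_support _ _ a b (maxn (2 ^ j') (2 ^ j - d))
   (minn (2 ^ j'.+1) (2 ^ j.+1 - d))); last first.
  move=> n hn; rewrite /block.
  case: ifP => [/andP[n1 n2]|]; last by rewrite mul0r.
  case: ifP => [/andP[n3 n4]|]; last by rewrite mulr0.
  by exfalso; move: hn => /negP; apply; clear - n1 n2 n3 n4; lia.
set a0 := maxn a _; set b0 := minn b _; set L := (b0 - a0)%N.
have a0' : (2 ^ j' <= a0)%N by rewrite /a0; clear; lia.
have a0j : (2 ^ j <= a0 + d)%N by rewrite /a0; clear; lia.
have n0 : (0 < 2 ^ j')%N by rewrite expn_gt0.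
pose W i : R := ((a0 + i + d)%:R * (a0 + i)%:R)^-1.
pose th n : R := 2 * pi * p n%:R + phi.
pose c i : R := cos (th (a0 + i + d)%N) * cos (th (a0 + i)%N).
have LE : (0 < L)%N -> (a0 + L <= 2 ^ j'.+1)%N /\ (a0 + L + d <= 2 ^ j.+1)%N.
  by rewrite /L /b0 => L0; clear - L0; lia.
have -> : \sum_(i < L) block u j (a0 + i + d)%N * block u j' (a0 + i)%N =
    \sum_(i < L) c i * W i.
  apply: eq_bigr => i _; have [|L1 L2] := LE; first exact: leq_ltn_trans (ltn_ord i).
  rewrite /block /u /trig_kernel.
  have iL := ltn_ord i.
  have -> : (2 ^ j <= a0 + i + d < 2 ^ j.+1)%N by clear - a0j L2 iL; lia.
  have -> : (2 ^ j' <= a0 + i < 2 ^ j'.+1)%N by clear - a0' L1 iL; lia.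
  have JJ : (2 ^ J <= 2 ^ j')%N by rewrite leq_exp2l.
  have -> : (2 ^ J <= a0 + i + d)%N by clear - a0' JJ; lia.
  have -> : (2 ^ J <= a0 + i)%N by clear - a0' JJ; lia.
  by rewrite /c /W invfM mulrACA.
have pos i : 0 < (a0 + i)%:R :> R by rewrite ltr0n addn_gt0 (leq_trans n0).
have posd i : 0 < (a0 + i + d)%:R :> R by rewrite ltr0n -addnA addn_gt0 (leq_trans n0).
have cB k : (k <= L)%N -> `|\sum_(i < k) c i| <= 8 * 2 ^+ j' * w ^+ j'.
  move=> kL; have [->|k0] := posnP k.
    by rewrite big_ord0 normr0 !mulr_ge0 ?exprn_ge0// ltW.
  have [|L1 _] := LE; first exact: leq_trans kL.
  have akL : (a0 + k <= 2 ^ j'.+1)%N by apply: leq_trans L1; rewrite leq_add2l.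
  (* Product to sum: the constant phases add up to [2 * phi] in one cosine and cancel in the
     other. *)
  have p1 := phase j' d a0 k 1 (2 * phi) Jj' (or_introl erefl) a0' akL.
  have p2 := phase j' d a0 k (-1) 0 Jj' (or_intror (conj erefl gd)) a0' akL.
  have -> : \sum_(i < k) c i =
     (\sum_(i < k) cos (2 * pi * (p (a0 + i + d)%:R + 1 * p (a0 + i)%:R) + 2 * phi) +
      \sum_(i < k) cos (2 * pi * (p (a0 + i + d)%:R + -1 * p (a0 + i)%:R) + 0)) / 2.
    rewrite -big_split mulr_suml; apply: eq_bigr => i _ /=.
    rewrite (_ : _ + 2 * phi = th (a0 + i + d)%N + th (a0 + i)%N); last by rewrite /th; ring.
    rewrite (_ : _ + 0 = th (a0 + i + d)%N - th (a0 + i)%N); last by rewrite /th; ring.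
    by rewrite cosD cosB /c; field.
  rewrite normrM [`|2^-1|]ger0_norm ?invr_ge0// ler_pdivrMr//.
  apply: (le_trans (ler_normD _ _)); apply: (le_trans (lerD p1 p2)).
  by rewrite mulr_natr mulr2n.
apply: (le_trans (@weighted_sum_bound _ c W _ L cB _ _)).
- move=> k _; rewrite /W lef_pV2 ?posrE ?mulr_gt0// ler_pM ?ler_nat//.
    by rewrite leq_add2r leq_add2l.
  by rewrite leq_add2l.
- by move=> k _; rewrite /W invr_ge0 mulr_ge0.
have W0 : W 0%N <= (2 ^+ j * 2 ^+ j')^-1.
  rewrite /W addn0 lef_pV2 ?posrE; last 2 first.
  - by rewrite mulr_gt0// -(addn0 a0).
  - by rewrite mulr_gt0// exprn_gt0.
  by rewrite -!natrX ler_pM// ler_nat.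
have B0 : 0 <= 8 * 2 ^+ j' * w ^+ j' by rewrite !mulr_ge0 ?exprn_ge0// ltW.
apply: (le_trans (ler_wpM2l B0 W0)).
have -> : 8 * 2 ^+ j' * w ^+ j' / (2 ^+ j * 2 ^+ j') = 8 * w ^+ j' / 2 ^+ j :> R.
  by field; rewrite !expf_neq0.
by rewrite ler_pM2r ?invr_gt0 ?exprn_gt0// ler_pM2r ?exprn_gt0.
Qed.

(** Natural subtraction sends [y <= x] to [0], where every block vanishes; thus only [y > x]
    contributes. *)
Definition blockop (R : realType) (V : nat) (u : nat -> R) (j : nat) (b : nat -> R)
    (x : nat) : R :=
  \sum_(y < V) block u j (y - x)%N * b y.

Lemma block0 (R : nmodType) (u : nat -> R) (j : nat) : block u j 0 = 0.
Proof. by rewrite /block leqNgt expn_gt0. Qed.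

Lemma block_norm (R : realType) (u : nat -> R) (j n : nat) :
  (forall n, `|u n| <= n%:R^-1) -> `|block u j n| <= (2 ^+ j)^-1.
Proof.
move=> ub; rewrite /block; case: ifP => [/andP[n1 n2]|_]; last first.
  by rewrite normr0 invr_ge0 exprn_ge0.
apply: (le_trans (ub n)); rewrite lef_pV2 ?posrE ?exprn_gt0// ?ltr0n.
  by rewrite -natrX ler_nat.
by rewrite (leq_trans _ n1)// expn_gt0.
Qed.

Lemma block_sum_norm (R : realType) (u : nat -> R) (j y V : nat) :
  (forall n, `|u n| <= n%:R^-1) -> \sum_(x < V) `|block u j (y - x)%N| <= 1.
Proof.
move=> ub; rewrite -(big_mkord xpredT (fun x => `|block u j (y - x)%N|)).
rewrite (@sum_nat_support _ _ 0 V (y.+1 - 2 ^ j.+1) (y.+1 - 2 ^ j)); last first.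
  move=> n hn; rewrite /block; case: ifP; last by rewrite normr0.
  have : (0 < 2 ^ j)%N by rewrite expn_gt0.
  by move: hn; rewrite expnS; clear; lia.
set L := (_ - _)%N.
have LB : (L <= 2 ^ j)%N by rewrite /L expnS; clear; lia.
apply: (@le_trans _ _ (\sum_(i < L) (2 ^+ j)^-1)).
  by apply: ler_sum => i _; exact: block_norm.
rewrite sumr_const card_ord -[leLHS]mulr_natl ler_pdivrMr ?exprn_gt0// mul1r.
by rewrite -natrX ler_nat.
Qed.

Lemma ler_sum_support (R : numDomainType) (G G' : nat -> R) (V m k : nat) :
  (forall n, 0 <= G' n) -> (forall n, (n < V)%N -> G n <= if (m <= n < k)%N then G' n else 0) ->
  \sum_(n < V) G n <= \sum_(m <= n < k) G' n.
Proof.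
move=> G'0 GG'; pose h n := if (m <= n < k)%N then G' n else 0.
have h0 n : 0 <= h n by rewrite /h; case: ifP.
have hs n : ~~ (m <= n < k)%N -> h n = 0 by rewrite /h => /negbTE ->.
have -> : \sum_(m <= n < k) G' n = \sum_(m <= n < k) h n.
  by apply: eq_big_nat => n nmk; rewrite /h nmk.
apply: (@le_trans _ _ (\sum_(0 <= n < maxn V k) h n)).
  rewrite -(big_mkord xpredT G) [leRHS](@big_cat_nat _ _ _ V)//= ?leq_maxl//.
  rewrite -[leLHS]addr0 lerD ?sumr_ge0// big_nat [leRHS]big_nat.
  by apply: ler_sum => n /andP[_]; exact: GG'.
rewrite (sum_nat_support _ _ hs) (sum_nat_support m k hs) minnn maxnn max0n.
by rewrite (minn_idPr _)// leq_maxr.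
Qed.

Section Correlation.
Context (R : realType) (u : nat -> R) (C w : R) (gap : nat -> nat)
  (osc : oscillating_kernel u C w gap) (V : nat).

Let kernel (theta : nat -> R) j j' y y' : R :=
  \sum_(x < V) theta (x %/ 2 ^ j')%N * (block u j (y - x)%N * block u j' (y' - x)%N).

(* As [x] runs over the support of [block u j' (y' - x)], the quotient [x %/ 2 ^ j']
   takes at most two values. *)
Lemma kernel_off_diagonal theta j j' y' d : (j' <= j)%N -> (gap j' <= d)%N ->
  (y' < V)%N -> (forall k, `|theta k| <= 1) ->
  `|kernel theta j j' (y' + d) y'| <= 2 * (C * w ^+ j' / 2 ^+ j).
Proof.
move=> jj gd yV th1; set B := (2 ^ j')%N.
have B0 : (0 < B)%N by rewrite expn_gt0.
pose h x := theta (x %/ B)%N * (block u j (y' + d - x)%N * block u j' (y' - x)%N).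
pose G n := block u j (n + d)%N * block u j' n.
have -> : kernel theta j j' (y' + d) y' = \sum_(0 <= n < y'.+1) theta ((y' - n) %/ B)%N * G n.
  transitivity (\sum_(x < y'.+1) h x).
    rewrite /kernel -/h -(big_mkord xpredT h) (@big_cat_nat _ _ _ y'.+1)//=.
    rewrite big_mkord [X in _ + X]big1_seq ?addr0// => n; rewrite mem_index_iota => /andP[_ /andP[n1 _]].
    by rewrite /h (_ : (y' - n = 0)%N) ?block0 ?mulr0//; apply/eqP; rewrite subn_eq0 ltnW.
  rewrite big_mkord (reindex_inj rev_ord_inj) /=; apply: eq_bigr => n _.
  have ny := ltn_ord n.
  rewrite /h /G subSS (_ : (y' + d - (y' - n) = n + d)%N); last by clear - ny; lia.
  by rewrite (_ : (y' - (y' - n) = n)%N); last by clear - ny; lia.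
set c := (y' %/ B)%N; set r := (y' %% B)%N.
have ye : (y' = c * B + r)%N by rewrite /c /r -divn_eq.
have rB : (r < B)%N by rewrite ltn_mod.
set z := minn (B + r).+1 y'.+1.
have zY : (z <= y'.+1)%N by rewrite geq_minr.
have GB n : ~~ (B <= n < 2 * B)%N -> G n = 0.
  by move=> nB; rewrite /G [block u j' n]/block expnS (negbTE nB) mulr0.
rewrite (big_cat_nat (leq0n z) zY) /=.
have e1 : \sum_(0 <= n < z) theta ((y' - n) %/ B)%N * G n =
    theta (c - 1)%N * \sum_(0 <= n < z) G n.
  rewrite mulr_sumr; apply: eq_big_nat => n /andP[_ nz].
  have [/andP[n1 n2]|/GB ->] := boolP (B <= n < 2 * B)%N; last by rewrite !mulr0.
  have c0 : (0 < c)%N.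
    rewrite lt0n; apply/eqP => c0; move: ye nz rB n1; rewrite c0 /z; clear; lia.
  have -> : ((y' - n) %/ B = c - 1)%N; last by [].
  have -> : (y' - n = (c - 1) * B + (B + r - n))%N.
    rewrite mulnBl mul1n; have : (B <= c * B)%N by rewrite leq_pmull.
    by move: ye nz n1; rewrite /z; clear; lia.
  rewrite divnMDl// divn_small ?addn0//; move: rB n1; clear; lia.
have e2 : \sum_(z <= n < y'.+1) theta ((y' - n) %/ B)%N * G n =
    theta (c - 2)%N * \sum_(z <= n < y'.+1) G n.
  rewrite mulr_sumr; apply: eq_big_nat => n /andP[nz ny].
  have [/andP[n1 n2]|/GB ->] := boolP (B <= n < 2 * B)%N; last by rewrite !mulr0.
  have c0 : (1 < c)%N.
    rewrite ltnNge; apply/negP => c1; have : (c * B <= B)%N by rewrite -[leqRHS]mul1n leq_mul2r c1 orbT.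
    by move: ye nz ny; rewrite /z; clear; lia.
  have -> : ((y' - n) %/ B = c - 2)%N; last by [].
  have -> : (y' - n = (c - 2) * B + (2 * B + r - n))%N.
    rewrite mulnBl; have : (2 * B <= c * B)%N by rewrite leq_mul2r c0 orbT.
    by move: ye nz ny n2; rewrite /z; clear; lia.
  rewrite divnMDl// divn_small ?addn0//; move: rB n2 nz ny; rewrite /z; clear; lia.
rewrite e1 e2 mulrDl mul1r; apply: (le_trans (ler_normD _ _)).
have part a b t : `|theta t * \sum_(a <= n < b) G n| <= C * w ^+ j' / 2 ^+ j.
  rewrite normrM -[leRHS]mul1r ler_pM//; exact: (osc_correlation osc).
by apply: lerD.
Qed.

(** Three ranges of the distance: from [2 ^ j.+1] on the blocks do not overlap, below the gap only
    their sizes are used, and in between they oscillate. For [y < y'] and [j' < j] the product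
    vanishes, since [y - x >= 2 ^ j] puts [y' - x] beyond the block [j']. *)
Lemma kernel_bound theta j j' y y' : (j' <= j)%N -> (y < V)%N -> (y' < V)%N ->
  (forall k, `|theta k| <= 1) ->
  forall dist, dist = ((y - y') + (y' - y))%N ->
  `|kernel theta j j' y y'| <=
    (if (dist < gap j')%N then (2 ^+ j)^-1 else 0) +
    (if (dist < 2 ^ j.+1)%N then 2 * (C * w ^+ j' / 2 ^+ j) else 0).
Proof.
move=> jj yV y'V th1 dist distE; have ub := osc_bound osc.
have /andP[wl _] := osc_ratio osc.
have kap0 : 0 <= 2 * (C * w ^+ j' / 2 ^+ j).
  rewrite mulr_ge0// divr_ge0 ?exprn_ge0// mulr_ge0 ?exprn_ge0//.
    by rewrite (le_trans _ (osc_const osc)).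
  by apply: le_trans wl; rewrite invr_ge0.
have [far|near] := leqP (2 ^ j.+1)%N dist.
  rewrite [kernel _ _ _ _ _]big1 ?normr0 ?addr_ge0//.
    by case: ifP => // _; rewrite invr_ge0 exprn_ge0.
  move=> x _; rewrite /block.
  case: ifP => [/andP[a1 a2]|]; last by rewrite mul0r mulr0.
  case: ifP => [/andP[a3 a4]|]; last by rewrite !mulr0.
  have h1 : (2 ^ j'.+1 <= 2 ^ j.+1)%N by rewrite leq_exp2l.
  have h2 : (0 < 2 ^ j)%N by rewrite expn_gt0.
  have h3 : (0 < 2 ^ j')%N by rewrite expn_gt0.
  by exfalso; move: far; rewrite distE; clear - h1 h2 h3 a1 a2 a3 a4; lia.
have [close|off] := ltnP dist (gap j').
  rewrite -[leLHS]addr0 lerD//; apply: (le_trans (ler_norm_sum _ _ _)).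
  apply: (@le_trans _ _ (\sum_(x < V) (2 ^+ j)^-1 * `|block u j' (y' - x)%N|)).
    apply: ler_sum => x _; rewrite !normrM -[leRHS]mul1r ler_pM// ?mulr_ge0//.
    by rewrite ler_wpM2r// block_norm.
  by rewrite -mulr_sumr ler_piMr ?invr_ge0 ?exprn_ge0// block_sum_norm.
rewrite add0r; have [yy|yy] := leqP y' y.
  have -> : y = (y' + dist)%N by rewrite distE; clear - yy; lia.
  exact: kernel_off_diagonal.
have [jj'|] := eqVneq j' j.
  rewrite (_ : kernel theta j j' y y' = kernel theta j j' (y + dist) y).
    exact: kernel_off_diagonal.
  apply: eq_bigr => x _; rewrite jj' (_ : (y + dist)%N = y') 1?[in RHS]mulrC; last first.
    by rewrite distE; clear - yy; lia.
  by rewrite [RHS]mulrC (mulrC (block _ _ _)).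
move=> jj'; have {}jj' : (j' < j)%N by rewrite ltn_neqAle jj' jj.
rewrite [kernel _ _ _ _ _]big1 ?normr0// => x _; rewrite /block.
case: ifP => [/andP[a1 a2]|]; last by rewrite mul0r mulr0.
case: ifP => [/andP[a3 a4]|]; last by rewrite !mulr0.
have h1 : (2 ^ j'.+1 <= 2 ^ j)%N by rewrite leq_exp2l.
by exfalso; clear - h1 a1 a4 yy; lia.
Qed.

(** A Schur-type estimate: the sum over [y'] is bounded uniformly in [y], through the local mass of
    [b']. Taking [B' = 0] covers functions bounded by 1, taking [B' = 2 ^+ l] the bad part of scale
    [l]. The weight [theta] is there for the groups of indices of the Rademacher-Menshov
    inequality. *)
Lemma correlation_bound theta j j' (b b' : nat -> R) (B' : R) : (j' <= j)%N ->
  (forall k, `|theta k| <= 1) -> 0 <= B' <= 2 ^+ j ->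
  (forall m n, (m <= n)%N -> \sum_(m <= y < n) `|b' y| <= 2 * (n - m)%:R + 4 * B') ->
  `|\sum_(x < V) theta (x %/ 2 ^ j')%N * (blockop V u j b x * blockop V u j' b' x)|
  <= (\sum_(y < V) `|b y|) * (28 * C * w ^+ j' + 4 * B' / 2 ^+ j).
Proof.
move=> jj th1 /andP[B0 Bj] mass.
have C1 := osc_const osc; have /andP[wl wu] := osc_ratio osc.
have w0 : 0 <= w by apply: le_trans wl; rewrite invr_ge0.
have P0 : 0 < 2 ^+ j :> R by rewrite exprn_gt0.
set kap := C * w ^+ j' / 2 ^+ j.
have kap0 : 0 <= kap by rewrite divr_ge0 ?(ltW P0)// mulr_ge0 ?exprn_ge0// (le_trans _ C1).
have -> : \sum_(x < V) theta (x %/ 2 ^ j')%N * (blockop V u j b x * blockop V u j' b' x) =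
    \sum_(y < V) \sum_(y' < V) b y * b' y' * kernel theta j j' y y'.
  under [RHS]eq_bigr do under eq_bigr do rewrite mulr_sumr.
  under [RHS]eq_bigr do rewrite exchange_big.
  rewrite [RHS]exchange_big; apply: eq_bigr => x _ /=.
  rewrite /blockop big_distrlr /= mulr_sumr; apply: eq_bigr => y _.
  by rewrite mulr_sumr; apply: eq_bigr => y' _; ring.
have near (g y : nat) (c : R) : 0 <= c ->
    \sum_(y' < V) `|b' y'| * (if ((y - y') + (y' - y) < g)%N then c else 0) <=
    c * (4 * g%:R + 4 * B').
  move=> c0.
  apply: (@le_trans _ _ (\sum_(y - g <= y' < y + g) c * `|b' y'|)); last first.
    rewrite -mulr_sumr ler_wpM2l//; apply: (le_trans (mass _ _ _)); first by clear; lia.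
    rewrite lerD2r (_ : 4 * g%:R = 2 * (2 * g)%:R); last by rewrite natrM; ring.
    by rewrite ler_pM2l// ler_nat; clear; lia.
  apply: (@ler_sum_support R (fun y' => `|b' y'| *
    (if ((y - y') + (y' - y) < g)%N then c else 0)) (fun y' => c * `|b' y'|)) => n /=; first by rewrite mulr_ge0.
  move=> _.
  case: ifP => h; last by rewrite mulr0; case: ifP => // _; rewrite mulr_ge0.
  by rewrite (_ : (y - g <= n < y + g)%N) 1?mulrC//; move: h; clear; lia.
rewrite mulr_suml; apply: (le_trans (ler_norm_sum _ _ _)); apply: ler_sum => y _.
apply: (le_trans (ler_norm_sum _ _ _)).
under eq_bigr do rewrite !normrM -mulrA.
rewrite -mulr_sumr ler_wpM2l//.
apply: (@le_trans _ _ (\sum_(y' < V) (`|b' y'| * (if ((y - y') + (y' - y) < gap j')%N then (2 ^+ j)^-1 else 0) +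
   `|b' y'| * (if ((y - y') + (y' - y) < 2 ^ j.+1)%N then 2 * kap else 0)))).
  apply: ler_sum => y' _; rewrite -mulrDr ler_wpM2l//.
  exact: kernel_bound.
rewrite big_split /=; have h2 : 0 <= 2 * kap by rewrite mulr_ge0.
have h1 : 0 <= (2 ^+ j)^-1 :> R by rewrite invr_ge0 ltW.
apply: (le_trans (lerD (near _ _ _ h1) (near _ _ _ h2))).
have gb := osc_gap osc j'.
have g1 : (2 ^+ j)^-1 * (4 * (gap j')%:R) <= 4 * C * w ^+ j'.
  rewrite mulrC ler_pdivrMr//; apply: (@le_trans _ _ (4 * (C * 2 ^+ j' * w ^+ j'))).
    by rewrite ler_pM2l.
  rewrite (_ : 4 * C * w ^+ j' * 2 ^+ j = 4 * (C * 2 ^+ j * w ^+ j')); last by ring.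
  rewrite ler_pM2l// ler_wpM2r ?exprn_ge0// ler_wpM2l ?(le_trans _ C1)//.
  by rewrite ler_weXn2l// ler1n.
have g2 : 2 * kap * (4 * (2 ^ j.+1)%:R) = 16 * C * w ^+ j'.
  by rewrite /kap natrX exprS; field; rewrite lt0r_neq0.
have g3 : 2 * kap * (4 * B') <= 8 * C * w ^+ j'.
  rewrite (_ : 8 * C * w ^+ j' = 2 * kap * (4 * 2 ^+ j)).
    by rewrite ler_wpM2l// ler_pM2l.
  by rewrite /kap; field; rewrite lt0r_neq0.
rewrite !mulrDr g2 (mulrC _ (4 * B')).
(* The shares of 28: 4 from the gap, 16 from the oscillating range, 8 from the term [4 * B'] in that
   range. *)
rewrite (_ : 28 * C * w ^+ j' = 4 * C * w ^+ j' + 16 * C * w ^+ j' + 8 * C * w ^+ j'); last by ring.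
move: g1 g3; rewrite /kap; clear; lra.
Qed.
End Correlation.

(** * Weak type (1,1) on the integers *)

Lemma interval_sum_le (R : numDomainType) (G : nat -> R) (V m n : nat) :
  (forall y, 0 <= G y) -> (forall y, (V <= y)%N -> G y = 0) ->
  \sum_(m <= y < n) G y <= \sum_(y < V) G y.
Proof.
move=> G0 GV; rewrite big_geq_mkord big_mkcond /= -(big_mkord xpredT G).
apply: (@ler_sum_support R (fun y => if (m <= y)%N then G y else 0)) => // y _.
rewrite leq0n /=; have [Vy|yV] := leqP V y; last by case: ifP.
by rewrite GV// if_same.
Qed.

Lemma divn_pow2 (x l k : nat) : (l <= k)%N -> (x %/ 2 ^ k = x %/ 2 ^ l %/ 2 ^ (k - l))%N.
Proof. by move=> lk; rewrite -divnMA -expnD subnKC. Qed.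

Lemma sum_dyadic (R : nmodType) (G : nat -> R) (B m n : nat) : (m <= n)%N ->
  \sum_(m * B <= y < n * B) G y = \sum_(m <= i < n) \sum_(i * B <= y < i.+1 * B) G y.
Proof.
elim: n => [|n IH]; first by rewrite leqn0 => /eqP ->; rewrite !big_geq.
rewrite leq_eqVlt => /predU1P[->|]; first by rewrite !big_geq.
rewrite ltnS => mn; rewrite big_nat_recr//= -IH// -big_cat_nat//= leq_mul2r ?mn ?orbT//.
by rewrite leqnSn orbT.
Qed.

(** * Calderon-Zygmund decomposition at height 1 *)

Section CalderonZygmund.
Context (R : realType) (F : nat -> R) (P : nat).
Hypothesis F_supp : forall y, (2 ^ P <= y)%N -> F y = 0.
Hypothesis F_total : \sum_(y < 2 ^ P) `|F y| <= 2 ^+ P.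

Definition dmass (l i : nat) : R := \sum_(i * 2 ^ l <= y < i.+1 * 2 ^ l) `|F y|.

Definition bad (l i : nat) : bool := 2 ^+ l < dmass l i.

(* One more than the largest scale of a bad dyadic interval containing [x], or [0]. *)
Definition lvl (x : nat) : nat := \max_(l < P | bad l (x %/ 2 ^ l)) l.+1.

Definition bpart (l x : nat) : R := if lvl x == l.+1 then F x else 0.

Definition gpart (x : nat) : R := if lvl x == 0%N then F x else 0.

Definition sel (l i : nat) : bool := lvl (i * 2 ^ l) == l.+1.

Let pow2_gt0 l : (0 < 2 ^ l)%N. Proof. by rewrite expn_gt0. Qed.

(** By [F_total] an interval of length at least [2 ^ P] has average at most 1; this keeps the
    stopping scales finite in number. *)
Lemma bad_lt l i : bad l i -> (l < P)%N.
Proof.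
rewrite /bad ltNge; apply: contraNltn => Pl.
apply: (le_trans (interval_sum_le _ _ _ _)).
- by move=> y; exact: normr_ge0.
- by move=> y /F_supp ->; rewrite normr0.
- by apply: (le_trans F_total); rewrite ler_weXn2l// ler1n.
Qed.

Lemma bad_lvl l x : bad l (x %/ 2 ^ l) -> (l < lvl x)%N.
Proof.
by move=> bl; exact: (@leq_bigmax_cond _ (fun l : 'I_P => bad l (x %/ 2 ^ l)%N)
  (fun l : 'I_P => l.+1) (Ordinal (bad_lt bl))).
Qed.

Lemma lvlS x l : lvl x = l.+1 ->
  bad l (x %/ 2 ^ l) /\ (forall k, (l < k)%N -> ~~ bad k (x %/ 2 ^ k)).
Proof.
move=> lx; split.
  have [A0|A0] := posnP #|[pred k : 'I_P | bad k (x %/ 2 ^ k)]|.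
    by move: lx; rewrite /lvl big_pred0// => k; exact: (card0_eq A0 k).
  have [k kA] := @eq_bigmax_cond _ [pred k : 'I_P | bad k (x %/ 2 ^ k)] (fun k => k.+1) A0.
  move=> h; have : lvl x = k.+1 by rewrite -h.
  by rewrite lx => -[->].
by move=> k lk; apply/negP => /bad_lvl; rewrite lx ltnS leqNgt lk.
Qed.

Lemma lvl_le x : (lvl x <= P)%N.
Proof. by apply/bigmax_leqP => i _. Qed.

(** Badness at scales [l] and above is decided by the dyadic interval of length [2 ^ l], so stopping
    at scale [l] selects whole intervals. *)
Lemma lvl_sel x l : (lvl x == l.+1) = sel l (x %/ 2 ^ l).
Proof.
have key (x' y : nat) : (x' %/ 2 ^ l = y %/ 2 ^ l)%N -> lvl x' = l.+1 -> lvl y = l.+1.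
  move=> xy /lvlS [bl nb]; apply/eqP; rewrite eqn_leq bad_lvl -?xy// andbT.
  rewrite leqNgt; apply/negP => ly.
  case ey : (lvl y) ly => [//|k]; rewrite ltnS => lk.
  have [bk _] := lvlS ey; move: (nb k lk).
  by rewrite (divn_pow2 _ (ltnW lk)) xy -divn_pow2 ?bk// ltnW.
have e : (x %/ 2 ^ l = (x %/ 2 ^ l * 2 ^ l) %/ 2 ^ l)%N by rewrite mulnK.
by apply/eqP/eqP; apply: key.
Qed.

(** The factor 2 comes from the dyadic parent, which is not bad by maximality. *)
Lemma dmass_sel l i : sel l i -> 2 ^+ l < dmass l i <= 2 * 2 ^+ l.
Proof.
move=> /eqP/lvlS; rewrite mulnK// => -[bl nb]; apply/andP; split => //.
have := nb l.+1 (ltnSn _); rewrite /bad -leNgt -exprS; apply: le_trans.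
have -> : (i * 2 ^ l %/ 2 ^ l.+1 = i %/ 2)%N by rewrite (divn_pow2 _ (leqnSn l)) mulnK// subSnn.
have ie := divn_eq i 2; have i2 : (i %% 2 < 2)%N by rewrite ltn_mod.
rewrite /dmass expnS.
have h1 : ((i %/ 2) * (2 * 2 ^ l) <= i * 2 ^ l)%N.
  by rewrite mulnA leq_mul2r leq_divM orbT.
have h2 : (i.+1 * 2 ^ l <= (i %/ 2).+1 * (2 * 2 ^ l))%N.
  by rewrite mulnA leq_mul2r; apply/orP; right; clear - ie i2; lia.
rewrite [leRHS](big_cat_nat h1)/=; last by apply: leq_trans h2; rewrite leq_mul2r leqnSn orbT.
rewrite [X in _ <= _ + X](@big_cat_nat _ _ _ (i.+1 * 2 ^ l))//=; last by rewrite leq_mul2r leqnSn orbT.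
rewrite addrCA lerDl addr_ge0// sumr_ge0//.
Qed.

Lemma bpart_interval l i (y : nat) : (i * 2 ^ l <= y < i.+1 * 2 ^ l)%N ->
  bpart l y = if sel l i then F y else 0.
Proof.
move=> /andP[y1 y2]; rewrite /bpart lvl_sel (_ : (y %/ 2 ^ l)%N = i)//.
by apply/eqP; rewrite eqn_leq -ltnS ltn_divLR// y2 leq_divRL.
Qed.

Lemma sum_bpart_dyadic l i :
  \sum_(i * 2 ^ l <= y < i.+1 * 2 ^ l) `|bpart l y| = if sel l i then dmass l i else 0.
Proof.
case: ifP => si.
  by apply: eq_big_nat => y /bpart_interval ->; rewrite si.
by rewrite big_nat big1// => y /bpart_interval ->; rewrite si normr0.
Qed.

(** Rounding the endpoints to multiples of [2 ^ l] lengthens the interval by at most [2 ^ l] on each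
    side, and selected intervals have average at most 2. This is the mass hypothesis of
    [correlation_bound]. *)
Lemma bpart_mass l m n : (m <= n)%N ->
  \sum_(m <= y < n) `|bpart l y| <= 2 * (n - m)%:R + 4 * 2 ^+ l.
Proof.
move=> mn; set B := (2 ^ l)%N; pose i0 := (m %/ B)%N; pose i1 := (n %/ B).+1.
have i0m : (i0 * B <= m)%N by rewrite leq_divM.
have ni1 : (n <= i1 * B)%N by rewrite ltnW// ltn_ceil// pow2_gt0.
have mi0 : (m <= i0 * B + B)%N by rewrite addnC -mulSn ltnW// ltn_ceil// pow2_gt0.
have i1n : (i1 * B <= n + B)%N by rewrite mulSn addnC leq_add2r leq_divM.
have i01 : (i0 <= i1)%N by rewrite leqW// leq_div2r.
apply: (@le_trans _ _ (\sum_(i0 * B <= y < i1 * B) `|bpart l y|)).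
  rewrite [leRHS](big_cat_nat i0m) /=; last exact: leq_trans ni1.
  rewrite [X in _ + X](big_cat_nat mn ni1) /= addrCA lerDl addr_ge0// sumr_ge0//.
apply: (@le_trans _ _ (\sum_(i0 <= i < i1) (2 * 2 ^+ l))).
  rewrite sum_dyadic// big_nat [leRHS]big_nat; apply: ler_sum => i _.
  rewrite sum_bpart_dyadic; case: ifP => [/dmass_sel/andP[]//|_].
  by rewrite mulr_ge0// exprn_ge0.
rewrite sumr_const_nat -[_ *+ (i1 - i0)]mulr_natl -(natrX _ 2) -!natrM -natrD ler_nat -/B.
rewrite mulnCA mulnBl; move: mi0 i1n mn; clear; set X := (i1 * B)%N; set Y := (i0 * B)%N; lia.
Qed.

Lemma CZ_decomposition x : F x = gpart x + \sum_(l < P) bpart l x.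
Proof.
rewrite /gpart /bpart; have := lvl_le x; case: (lvl x) => [_|l lP].
  by rewrite big1 ?addr0.
rewrite add0r (bigD1 (Ordinal lP))//= eqxx big1 ?addr0// => i il.
by rewrite eqSS eq_sym -(inj_eq val_inj) /= in il *; rewrite (negbTE il).
Qed.

Lemma gpart_le1 x : `|gpart x| <= 1.
Proof.
rewrite /gpart; case: eqP => [lx|_]; last by rewrite normr0.
have : ~~ bad 0 (x %/ 2 ^ 0) by apply/negP => /bad_lvl; rewrite lx.
by rewrite /bad -leNgt divn1 /dmass !muln1 big_nat1.
Qed.

Lemma sum_bpart_le : \sum_(l < P) \sum_(x < 2 ^ P) `|bpart l x| <= \sum_(x < 2 ^ P) `|F x|.
Proof.
rewrite exchange_big; apply: ler_sum => x _ /=; rewrite /bpart.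
have := lvl_le x; case: (lvl x) => [_|l lP].
  by rewrite big1// => i _; rewrite normr0.
rewrite (bigD1 (Ordinal lP))//= eqxx big1 ?addr0// => i il.
by rewrite eqSS eq_sym -(inj_eq val_inj) /= in il *; rewrite (negbTE il) normr0.
Qed.

Lemma sel_ge l i : (2 ^ (P - l) <= i)%N -> sel l i = false.
Proof.
move=> Pi; apply/negP => si; have /andP[+ _] := dmass_sel si.
have lP : (l < P)%N by move: si => /eqP/lvlS[/bad_lt].
rewrite ltNge /dmass big_nat big1 ?exprn_ge0// => y /andP[y1 _].
rewrite F_supp ?normr0//; apply: leq_trans y1.
by rewrite -[P](subnK (ltnW lP)) expnD leq_mul2r Pi orbT.
Qed.

Lemma sel_count l : (l <= P)%N ->
  2 ^+ l * \sum_(i < 2 ^ (P - l)) (sel l i)%:R <= \sum_(x < 2 ^ P) `|bpart l x|.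
Proof.
move=> lP; have -> : \sum_(x < 2 ^ P) `|bpart l x| = \sum_(0 * 2 ^ l <= x < 2 ^ (P - l) * 2 ^ l) `|bpart l x|.
  by rewrite -expnD subnK// mul0n big_mkord.
rewrite sum_dyadic// big_mkord mulr_sumr; apply: ler_sum => i _.
rewrite sum_bpart_dyadic; case: ifP => [/dmass_sel/andP[/ltW]|]; by rewrite ?mulr1 ?mulr0.
Qed.

Lemma sum_sel_shift l c : (l <= P)%N ->
  \sum_(x < 2 ^ P) (sel l (x %/ 2 ^ l + c))%:R <= \sum_(x < 2 ^ P) `|bpart l x|.
Proof.
move=> lP; apply: le_trans (sel_count lP).
have -> : \sum_(x < 2 ^ P) (sel l (x %/ 2 ^ l + c))%:R =
    \sum_(0 * 2 ^ l <= x < 2 ^ (P - l) * 2 ^ l) (sel l (x %/ 2 ^ l + c))%:R :> R.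
  by rewrite -expnD subnK// mul0n big_mkord.
rewrite sum_dyadic// big_mkord.
apply: (@le_trans _ _ (\sum_(i < 2 ^ (P - l)) 2 ^+ l * (sel l (i + c))%:R)).
  apply: ler_sum => i _; rewrite (eq_big_nat _ _ (F2 := fun=> (sel l (i + c))%:R)).
    by rewrite sumr_const_nat -mulnBl subSnn mul1n -[_ *+ (2 ^ l)]mulr_natl natrX.
  move=> x /andP[x1 x2]; do 3 f_equal; congr (_ + _)%N.
  by apply/eqP; rewrite eqn_leq -ltnS ltn_divLR// x2 leq_divRL.
rewrite -mulr_sumr ler_wpM2l ?exprn_ge0//.
apply: (@le_trans _ _ (\sum_(c <= i < 2 ^ (P - l) + c) (sel l i)%:R)).
  rewrite -(big_mkord xpredT (fun i => (sel l (i + c))%:R)).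
  rewrite -{2}[c]add0n big_addn addnK//.
apply: interval_sum_le => // y /sel_ge ->//.
Qed.
End CalderonZygmund.

(** * The Rademacher-Menshov inequality *)

Lemma rademacher_menshov (R : realFieldType) (c : nat -> R) (K W n : nat) :
  (n <= 2 ^ K)%N -> (2 ^ K <= W)%N ->
  (\sum_(0 <= k < n) c k) ^+ 2 <=
  K.+1%:R * \sum_(l < K.+1) \sum_(i < W) (\sum_(i * 2 ^ l <= k < i.+1 * 2 ^ l) c k) ^+ 2.
Proof.
move=> nK KW; pose S m := \sum_(0 <= k < m) c k.
(* Clearing the binary digits of [n] one at a time cuts the sum into one piece per digit. After
   Cauchy-Schwarz each squared piece is replaced by the sum over all dyadic intervals of its length,
   which is independent of [n]. *)
pose d l := S (n %/ 2 ^ l * 2 ^ l)%N - S (n %/ 2 ^ l.+1 * 2 ^ l.+1)%N.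
have -> : \sum_(0 <= k < n) c k = \sum_(l < K.+1) d l.
  rewrite -(big_mkord xpredT d).
  under eq_bigr do rewrite /d -opprB.
  rewrite sumrN (telescope_sumr (fun i => S (n %/ 2 ^ i * 2 ^ i)%N))// opprB.
  rewrite expn0 divn1 muln1 divn_small ?mul0n; last first.
    by apply: (leq_ltn_trans nK); rewrite ltn_exp2l.
  have -> : S 0%N = 0 by rewrite /S big_geq.
  by rewrite subr0.
apply: (le_trans (sqr_sum_le _ _)); rewrite ler_wpM2l//; apply: ler_sum => l _.
have lK : (l <= K)%N by rewrite -ltnS.
have Q0 i : 0 <= (\sum_(i * 2 ^ l <= k < i.+1 * 2 ^ l) c k) ^+ 2 by rewrite sqr_ge0.
have aK : (n %/ 2 ^ l <= 2 ^ (K - l))%N.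
  rewrite -(mulKn (2 ^ (K - l)) (expn_gt0 2 l : (0 < 2 ^ l)%N)) -expnD subnKC//.
  exact: leq_div2r.
rewrite /d (divn_pow2 _ (leqnSn l)) subSnn expn1.
set a := (n %/ 2 ^ l)%N in aK *.
(* The parity of [a] is the digit of [n] at place [l]: for an even [a] the piece is empty. *)
have [ao|ae] := boolP (odd a); last first.
  have -> : (a %/ 2 * 2 ^ l.+1 = a * 2 ^ l)%N.
    by rewrite expnS mulnA; congr (_ * _)%N; rewrite divnK// dvdn2.
  by rewrite subrr expr0n sumr_ge0.
have a0 : (0 < a)%N by case: (a) ao.
have e : (a %/ 2 * 2 ^ l.+1 = a.-1 * 2 ^ l)%N.
  rewrite expnS mulnA; congr (_ * _)%N.
  by have := divn_eq a 2; rewrite modn2 ao; clear; lia.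
have aW : (a.-1 < W)%N.
  rewrite (leq_trans _ KW)// (leq_trans _ (leq_pexp2l _ (leq_subr l K)))//.
  by rewrite prednK.
rewrite (bigD1 (Ordinal aW))//= e /S.
rewrite (@big_cat_nat _ _ _ (a.-1 * 2 ^ l) 0 (a * 2 ^ l))//=; last first.
  by rewrite leq_mul2r leq_pred orbT.
by rewrite addrAC subrr add0r prednK// lerDl sumr_ge0.
Qed.

(** Restricting a double sum to pairs in the same class of [q] leaves a sum of squares: this links
    the form used for correlations to the one that is visibly nonnegative. *)
Lemma class_square_sum (R : realFieldType) (q : nat -> nat) (a : nat -> R) (P W : nat) :
  (forall j, (j < P)%N -> (q j < W)%N) ->
  \sum_(j < P) \sum_(j' < P) (q j == q j')%:R * (a j * a j') =
  \sum_(i < W) (\sum_(j < P) (i == q j :> nat)%:R * a j) ^+ 2.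
Proof.
move=> qW; under [RHS]eq_bigr => i _.
  rewrite expr2 big_distrlr /=.
  under eq_bigr do under eq_bigr do rewrite mulrACA.
  over.
rewrite [RHS]exchange_big; apply: eq_bigr => j _ /=.
rewrite [RHS]exchange_big; apply: eq_bigr => j' _ /=.
rewrite -mulr_suml; congr (_ * _).
rewrite (bigD1 (Ordinal (qW _ (ltn_ord j))))//= eqxx mul1r big1 ?addr0// => i.
by rewrite -(inj_eq val_inj) /= => /negbTE ->; rewrite mul0r.
Qed.

(* The partial sums are indexed by the number of active terms left, so that only the number
   of active terms, and not [P], enters the logarithmic loss. *)
Lemma tail_sqr_le (R : realFieldType) (a : nat -> R) (act : pred nat) (P K J : nat) :
  let N j := (\sum_(j <= i < P) act i)%N in
  (forall j, ~~ act j -> a j = 0) -> (N 0 < 2 ^ K)%N -> (J <= P)%N ->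
  (\sum_(J <= j < P) a j) ^+ 2 <=
  K.+1%:R * \sum_(l < K.+1) \sum_(j < P) \sum_(j' < P)
    (N j %/ 2 ^ l == N j' %/ 2 ^ l)%N%:R * (a j * a j').
Proof.
move=> N a0 NK JP.
have Nmono i j : (i <= j)%N -> (j <= P)%N -> (N j <= N i)%N.
  by move=> ij jP; rewrite {2}/N (big_cat_nat ij jP) /= leq_addl.
have Nstrict i j : act i -> (i < j)%N -> (j <= P)%N -> (N j < N i)%N.
  move=> ai ij jP; apply: (leq_ltn_trans (Nmono _ _ ij jP)).
  by rewrite {2}/N big_ltn ?ai// (leq_trans ij).
pose c k := \sum_(j < P) (N j == k)%:R * a j.
have cE m n : \sum_(m <= k < n) c k = \sum_(j < P) (m <= N j < n)%N%:R * a j.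
  rewrite exchange_big; apply: eq_bigr => j _ /=; rewrite -mulr_suml; congr (_ * _).
  have [/andP[mN Nn]|h] := boolP (m <= N j < n)%N; last first.
    rewrite big1_seq// => k /=; rewrite mem_index_iota => hk.
    by case: eqP => // e; rewrite e hk in h.
  rewrite (bigD1_seq (N j)) ?mem_index_iota ?mN ?Nn ?iota_uniq//= eqxx big1 ?addr0// => k.
  by rewrite eq_sym => /negbTE ->.
(* An active [j < J] has [N j > N J], and every [j >= J] has [N j <= N J]; thus a tail in [j] is an
   initial sum in [k]. *)
have -> : \sum_(J <= j < P) a j = \sum_(0 <= k < (N J).+1) c k.
  rewrite cE big_geq_mkord big_mkcond; apply: eq_bigr => j _ /=.
  rewrite ltnS; have [Jj|jJ] := leqP J j; first by rewrite Nmono ?mul1r// ltnW.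
  have [aj|/a0 ->] := boolP (act j); last by rewrite mulr0.
  by rewrite leqNgt Nstrict// mul0r.
pose W := (2 ^ K + P.+1)%N.
have NJ : (N J < 2 ^ K)%N by apply: leq_ltn_trans NK; exact: Nmono.
apply: (le_trans (@rademacher_menshov R c K W _ NJ (leq_addr _ _))).
rewrite ler_wpM2l//; apply: ler_sum => l _.
have inE' m (i : nat) : (i * 2 ^ l <= m < i.+1 * 2 ^ l)%N = (i == m %/ 2 ^ l)%N.
  by rewrite -leq_divRL ?expn_gt0// -ltn_divLR ?expn_gt0// ltnS [RHS]eqn_leq.
rewrite (@class_square_sum R (fun j => N j %/ 2 ^ l)%N a P W).
  by rewrite le_eqVlt; apply/orP; left; apply/eqP; apply: eq_bigr => i _; rewrite cE;
    under eq_bigr do rewrite inE'.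
move=> j jP; have NP : (N j <= P)%N.
  rewrite /N; apply: (@leq_trans (\sum_(j <= i < P) 1)); last by rewrite sum_nat_const_nat muln1 leq_subr.
  by apply: leq_sum => i _; case: (act i).
by rewrite (leq_ltn_trans (leq_div _ _))// /W (leq_ltn_trans NP)// addnS ltnS leq_addl.
Qed.

Lemma sum_expr_le (R : realFieldType) (w : R) (m n : nat) : 0 <= w < 1 ->
  \sum_(m <= i < n) w ^+ i <= w ^+ m / (1 - w).
Proof.
move=> /andP[w0 w1]; have w1' : 0 < 1 - w by rewrite subr_gt0.
rewrite ler_pdivlMr//; have [mn|nm] := leqP m n; last first.
  by rewrite big_geq ?(ltnW nm)// mul0r exprn_ge0.
suff -> : (\sum_(m <= i < n) w ^+ i) * (1 - w) = w ^+ m - w ^+ n.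
  by rewrite gerBl exprn_ge0.
rewrite mulr_suml -[RHS]opprB -(telescope_sumr (fun i => w ^+ i) mn) -sumrN.
by apply: eq_bigr => i _; rewrite opprB exprS mulrBr mulr1 mulrC.
Qed.

Lemma sum_symmetric_le (R : numDomainType) (c : nat -> nat -> R) (P : nat) :
  (forall i j, c i j = c j i) ->
  `|\sum_(j < P) \sum_(j' < P) c j j'| <= 2 * \sum_(j < P) \sum_(j' < j.+1) `|c j j'|.
Proof.
move=> cC; elim: P => [|P IH]; first by rewrite !big_ord0 normr0 mulr0.
rewrite [in leRHS]big_ord_recr /= mulrDr big_ord_recr /=.
under eq_bigr do rewrite big_ord_recr /=.
rewrite big_split /= -addrA.
apply: (le_trans (ler_normD _ _)); apply: lerD => //.
rewrite mulr2n mulrDl mul1r; apply: (le_trans (ler_normD _ _)); apply: lerD.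
  rewrite [leRHS]big_ord_recr /= (le_trans (ler_norm_sum _ _ _))//.
  by under eq_bigr do rewrite cC; rewrite lerDl.
exact: ler_norm_sum.
Qed.

Lemma count_quotient_le (R : realFieldType) (B W c m : nat) : (0 < B)%N ->
  \sum_(x < W) (x %/ B + c == m)%N%:R <= B%:R :> R.
Proof.
move=> B0; apply: (@le_trans _ _ (\sum_((m - c) * B <= x < (m - c).+1 * B) 1)).
  apply: (@ler_sum_support R (fun x => (x %/ B + c == m)%N%:R)) => // x _.
  case: eqP => [e|_]; last by case: ifP.
  have -> : (m - c = x %/ B)%N by rewrite -e addnK.
  by rewrite leq_divM ltn_ceil.
by rewrite sumr_const_nat -mulnBl subSnn mul1n.
Qed.

(** * Bad terms with a fixed scale difference [s] *)

Section FixedScale.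
Context (R : realType) (u : nat -> R) (C w : R) (gap : nat -> nat)
  (osc : oscillating_kernel u C w gap).
Context (F : nat -> R) (P : nat).
Hypothesis F_supp : forall y, (2 ^ P <= y)%N -> F y = 0.
Hypothesis F_total : \sum_(y < 2 ^ P) `|F y| <= 2 ^+ P.
Context (s : nat).

Let V := (2 ^ P)%N.
Let sel := sel F P.
Let badpart := bpart F P.
Let mass l := \sum_(x < V) `|badpart l x|.

(* The summand at scale [j] that only sees the bad intervals of length [2 ^ (j - s)]. *)
Definition scale_term (j x : nat) : R :=
  if (s <= j)%N then blockop V u j (badpart (j - s)%N) x else 0.

(** As [y - x] lies between [2 ^ j] and [2 ^ j.+1], only selected intervals inside the first or
    second dyadic interval of length [2 ^ j] to the right of [x] can matter. Activity is thus a
    function of [x %/ 2 ^ j]. *)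
Definition active_index (j k : nat) : bool :=
  (s <= j)%N && [exists i : 'I_(2 ^ (P - (j - s))),
    sel (j - s) i && ((k + 1 == i %/ 2 ^ s)%N || (k + 2 == i %/ 2 ^ s)%N)].

Definition active (x j : nat) : bool := active_index j (x %/ 2 ^ j).

Let total : R := \sum_(x < V) `|F x|.

Lemma scale_term_inactive j x : (j < P)%N -> ~~ active x j -> scale_term j x = 0.
Proof.
move=> jP; rewrite /scale_term; case: ifP => // sj na.
rewrite /blockop big1// => y _; have yV := ltn_ord y.
rewrite /block; case: ifP => [/andP[y1 y2]|]; last by rewrite mul0r.
rewrite /badpart /bpart; case: eqP => [ly|_]; last by rewrite mulr0.
exfalso; move: na => /negP; apply; rewrite /active /active_index sj /=.
set l := (j - s)%N in ly *.
have iP : (y %/ 2 ^ l < 2 ^ (P - l))%N.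
  rewrite ltn_divLR ?expn_gt0// -expnD subnK//.
  by rewrite /l; clear - jP; lia.
apply/existsP; exists (Ordinal iP) => /=; rewrite /sel -lvl_sel// ly eqxx /=.
have -> : (y %/ 2 ^ l %/ 2 ^ s = y %/ 2 ^ j)%N by rewrite -divnMA -expnD subnK.
have B0 : (0 < 2 ^ j)%N by rewrite expn_gt0.
move: y1 y2; rewrite expnS; set B := (2 ^ j)%N in B0 *; move=> y1 y2.
have h1 : (x %/ B + 1 <= y %/ B)%N.
  rewrite leq_divRL// mulnDl mul1n (leq_trans (n := x + B)) ?leq_add2r ?leq_divM//.
  by clear - y1 B0; lia.
have h2 : (y %/ B < x %/ B + 3)%N.
  rewrite ltn_divLR// mulnDl; have := ltn_ceil x B0; rewrite mulSn.
  by clear - y2; lia.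
by move: h1 h2; clear; lia.
Qed.

(** A selected interval activates at most two intervals of length [2 ^ j], and its mass exceeds its
    length [2 ^ (j - s)]; the factor [2 ^+ s] is the ratio of lengths. *)
Lemma active_count j : (j < P)%N -> (s <= j)%N ->
  \sum_(x < V) (active x j)%:R <= 2 * 2 ^+ s * mass (j - s)%N.
Proof.
move=> jP sj; set l := (j - s)%N.
have lP : (l <= P)%N by rewrite /l; clear - jP; lia.
apply: (@le_trans _ _ (\sum_(x < V) \sum_(i < 2 ^ (P - l)) (sel l i)%:R *
    ((x %/ 2 ^ j + 1 == i %/ 2 ^ s)%N%:R + (x %/ 2 ^ j + 2 == i %/ 2 ^ s)%N%:R))).
  apply: ler_sum => x _; rewrite /active /active_index sj /= -/l.
  have t0 (i : 'I_(2 ^ (P - l))) : 0 <= (sel l i)%:R *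
    ((x %/ 2 ^ j + 1 == i %/ 2 ^ s)%N%:R + (x %/ 2 ^ j + 2 == i %/ 2 ^ s)%N%:R) :> R.
    by rewrite mulr_ge0// addr_ge0.
  case: existsP => [[i /andP[si /orP h]]|_]; last by rewrite sumr_ge0.
  rewrite (bigD1 i)//= si mul1r -[leLHS]addr0 lerD ?sumr_ge0//.
  by case: h => ->; rewrite ?lerDl ?lerDr.
rewrite exchange_big /=.
apply: (@le_trans _ _ (\sum_(i < 2 ^ (P - l)) (sel l i)%:R * (2 * 2 ^+ j))).
  apply: ler_sum => i _; rewrite -mulr_sumr ler_wpM2l// big_split /= mulr2n mulrDl mul1r.
  by rewrite -(natrX _ 2) lerD ?count_quotient_le ?expn_gt0.
have -> : 2 ^+ j = 2 ^+ s * 2 ^+ l :> R by rewrite -exprD subnKC.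
rewrite -mulr_suml; set S := \sum_(i < _) _.
rewrite (_ : S * _ = 2 * 2 ^+ s * (2 ^+ l * S)); last by ring.
rewrite ler_wpM2l ?mulr_ge0 ?exprn_ge0//.
exact: sel_count.
Qed.

Lemma sum_mass_shift_le : \sum_(s <= j < P) mass (j - s)%N <= total.
Proof.
apply: (@le_trans _ _ (\sum_(l < P) mass l)); last exact: sum_bpart_le.
have [sP|Ps] := leqP s P; last first.
  by rewrite big_geq ?(ltnW Ps)// sumr_ge0// => l _; rewrite sumr_ge0.
rewrite -{1}[s]add0n big_addn; under eq_bigr do rewrite addnK.
rewrite -(big_mkord xpredT mass) [leRHS](@big_cat_nat _ _ _ (P - s))//= ?leq_subr//.
by rewrite lerDl sumr_ge0// => l _; rewrite sumr_ge0.
Qed.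

Let rank x j := (\sum_(j <= i < P) active x i)%N.

(** Chebyshev's inequality. The activities sum to at most 2 * 2^s [total], so the threshold 4^s
    leaves a bound summable in [s], while its logarithm [2 * s] is harmless against [w ^+ s]. *)
Lemma many_active_count :
  \sum_(x < V) (2 ^ (2 * s) <= rank x 0)%N%:R <= 2 / 2 ^+ s * total.
Proof.
have p0 : 0 < 2 ^+ s :> R by rewrite exprn_gt0.
apply: (@le_trans _ _ (\sum_(x < V) (2 ^+ (2 * s))^-1 * (rank x 0)%:R)).
  apply: ler_sum => x _; case: leqP => h; last by rewrite mulr_ge0 ?invr_ge0 ?exprn_ge0.
  by rewrite mulrC ler_pdivlMr ?exprn_gt0// mul1r -natrX ler_nat.
rewrite -mulr_sumr; have -> : \sum_(x < V) (rank x 0)%:R =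
   \sum_(0 <= j < P) \sum_(x < V) (active x j)%:R :> R.
  by rewrite exchange_big; apply: eq_bigr => x _; rewrite natr_sum.
apply: (@le_trans _ _ ((2 ^+ (2 * s))^-1 * \sum_(s <= j < P) 2 * 2 ^+ s * mass (j - s)%N)).
  rewrite ler_wpM2l ?invr_ge0 ?exprn_ge0// big_mkord.
  apply: (@ler_sum_support R (fun j => \sum_(x < V) (active x j)%:R)
    (fun j => 2 * 2 ^+ s * mass (j - s)%N)) => j.
    by rewrite !mulr_ge0 ?exprn_ge0 ?sumr_ge0.
  move=> jP; rewrite jP andbT; case: leqP => [sj|js]; first exact: active_count.
  by rewrite big1// => x _; rewrite /active /active_index leqNgt js.
rewrite -mulr_sumr mulrA.
have -> : (2 ^+ (2 * s))^-1 * (2 * 2 ^+ s) = 2 / 2 ^+ s :> R.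
  by rewrite mulnC exprM expr2; field; rewrite lt0r_neq0.
by rewrite ler_wpM2l ?divr_ge0 ?(ltW p0)// sum_mass_shift_le.
Qed.

(** The majorant of [tail_sqr_le] with [K = 2 * s]; being independent of [J], it controls all tails
    at once. *)
Definition scale_square (x : nat) : R :=
  (2 * s).+1%:R * \sum_(l < (2 * s).+1) \sum_(j < P) \sum_(j' < P)
    (rank x j %/ 2 ^ l == rank x j' %/ 2 ^ l)%N%:R * (scale_term j x * scale_term j' x).

Lemma scale_square_ge x J : (rank x 0 < 2 ^ (2 * s))%N -> (J <= P)%N ->
  (\sum_(J <= j < P) scale_term j x) ^+ 2 <= scale_square x.
Proof.
move=> rk JP; rewrite /scale_square.
(* Inactive terms are known to vanish only below [P], whereas [tail_sqr_le] asks for this at every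
   index. *)
pose a j := if (j < P)%N then scale_term j x else 0.
have -> : \sum_(J <= j < P) scale_term j x = \sum_(J <= j < P) a j.
  by apply: eq_big_nat => j /andP[_ jP]; rewrite /a jP.
have a0 j : ~~ active x j -> a j = 0.
  by rewrite /a; case: ifP => // jP; exact: scale_term_inactive.
apply: (le_trans (@tail_sqr_le R a (active x) P (2 * s) J a0 rk JP)).
rewrite ler_wpM2l//; apply: ler_sum => l _; apply: ler_sum => j _; apply: ler_sum => j' _.
by rewrite /a !ltn_ord.
Qed.

(** The rank is constant on dyadic intervals of length [2 ^ j], as the weights in
    [correlation_bound] must be. *)
Lemma rank_quotient x j : rank x j = (\sum_(j <= i < P) active_index i (x %/ 2 ^ j %/ 2 ^ (i - j)))%N.
Proof.
by apply: eq_big_nat => i /andP[ji _]; rewrite /active (divn_pow2 _ ji).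
Qed.

Let D := 28 * C / (1 - w) + 8.

(** For [j' <= j] both ranks are functions of [x %/ 2 ^ j'], so their coincidence is an admissible
    weight [theta]. In [D], the first term is the geometric series of 28 C w^j' over [j' >= s], and
    the 8 comes from the masses 2^(j' - s) summed against 2^-j. *)
Lemma sum_level_le l :
  \sum_(x < V) \sum_(j < P) \sum_(j' < P)
    (rank x j %/ 2 ^ l == rank x j' %/ 2 ^ l)%N%:R * (scale_term j x * scale_term j' x)
  <= 2 * D * w ^+ s * total.
Proof.
have C1 := osc_const osc; have /andP[wl wu] := osc_ratio osc.
have w0 : 0 <= w by apply: le_trans wl; rewrite invr_ge0.
have w1 : 0 < 1 - w by rewrite subr_gt0.
pose c j j' := \sum_(x < V) (rank x j %/ 2 ^ l == rank x j' %/ 2 ^ l)%N%:R *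
  (scale_term j x * scale_term j' x).
have -> : \sum_(x < V) \sum_(j < P) \sum_(j' < P)
    (rank x j %/ 2 ^ l == rank x j' %/ 2 ^ l)%N%:R * (scale_term j x * scale_term j' x) =
    \sum_(j < P) \sum_(j' < P) c j j'.
  by rewrite exchange_big; apply: eq_bigr => j _ /=; rewrite exchange_big.
apply: (le_trans (ler_norm _)).
apply: (le_trans (sum_symmetric_le _ _)).
  by move=> i j; apply: eq_bigr => x _; rewrite eq_sym [X in _ * X]mulrC.
rewrite -!mulrA ler_pM2l//.
have cb j j' : (s <= j')%N -> (j' <= j)%N -> (j < P)%N ->
    `|c j j'| <= mass (j - s)%N * (28 * C * w ^+ j' + 4 * 2 ^+ (j' - s) / 2 ^+ j).
  move=> sj' jj jP; pose theta k : R :=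
    ((\sum_(j <= i < P) active_index i (k %/ 2 ^ (j - j') %/ 2 ^ (i - j))) %/ 2 ^ l ==
     (\sum_(j' <= i < P) active_index i (k %/ 2 ^ (i - j'))) %/ 2 ^ l)%N%:R.
  have -> : c j j' = \sum_(x < V) theta (x %/ 2 ^ j')%N *
     (blockop V u j (badpart (j - s)%N) x * blockop V u j' (badpart (j' - s)%N) x).
    apply: eq_bigr => x _; rewrite /scale_term sj' (leq_trans sj' jj).
    by rewrite /theta !rank_quotient (divn_pow2 _ jj).
  apply: (correlation_bound osc) => //.
  - by move=> k; rewrite /theta; case: eqP => _; rewrite ?normr1 ?normr0.
  - by rewrite exprn_ge0//= ler_weXn2l ?ler1n// (leq_trans (leq_subr _ _)).
  - by move=> m n mn; exact: bpart_mass.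
have inner j : (j < P)%N -> \sum_(j' < j.+1) `|c j j'| <=
    if (s <= j)%N then mass (j - s)%N * (D * w ^+ s) else 0.
  move=> jP; have [sj|js] := leqP s j; last first.
    rewrite big1// => j' _; rewrite /c big1 ?normr0// => x _.
    by rewrite /scale_term leqNgt js /= mul0r mulr0.
  have m0 : 0 <= mass (j - s)%N by rewrite sumr_ge0.
  apply: (@le_trans _ _ (\sum_(s <= j' < j.+1) mass (j - s)%N *
      (28 * C * w ^+ j' + 4 * 2 ^+ (j' - s) / 2 ^+ j))).
    apply: (@ler_sum_support R (fun j' => `|c j j'|)
      (fun j' => mass (j - s)%N * (28 * C * w ^+ j' + 4 * 2 ^+ (j' - s) / 2 ^+ j))) => j'.
      by rewrite mulr_ge0// addr_ge0 ?divr_ge0 ?mulr_ge0 ?exprn_ge0// (le_trans _ C1).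
    move=> j'j; rewrite j'j andbT; case: leqP => [sj'|js]; first exact: cb.
    by rewrite /c big1 ?normr0// => x _; rewrite /scale_term (leqNgt s j') js /= mulr0 mulr0.
  rewrite -mulr_sumr ler_wpM2l// big_split /= -mulr_sumr.
  have h1 : \sum_(s <= j' < j.+1) w ^+ j' <= w ^+ s / (1 - w) by apply: sum_expr_le; rewrite w0.
  have h2 : \sum_(s <= j' < j.+1) 4 * 2 ^+ (j' - s) / 2 ^+ j <= 8 * w ^+ s.
    have p0 : 0 < 2 ^+ j :> R by rewrite exprn_gt0.
    rewrite -mulr_suml -mulr_sumr ler_pdivrMr//.
    rewrite -{1}[s]add0n big_addn; under eq_bigr do rewrite addnK.
    rewrite subSn//; have -> : \sum_(0 <= i < (j - s).+1) 2 ^+ i = 2 ^+ (j - s).+1 - 1 :> R.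
      elim: (j - s)%N => [|n IHn]; first by rewrite big_nat1 expr0 expr1; ring.
      by rewrite big_nat_recr//= IHn (exprS _ n.+1); ring.
    rewrite -[X in _ <= _ * 2 ^+ X](subnKC sj) exprD.
    (* The lower bound 1/2 on [w] converts the gain 2^-s of the geometric sum into [w ^+ s]. *)
    have ws : 1 <= w ^+ s * 2 ^+ s.
      by rewrite -exprMn exprn_ege1// -ler_pdivrMr// mul1r.
    have q0 : 0 < 2 ^+ (j - s) :> R by rewrite exprn_gt0.
    rewrite exprS; move: ws q0; set X := w ^+ s * 2 ^+ s; set Y := 2 ^+ (j - s) => ws q0.
    rewrite (_ : 8 * w ^+ s * (2 ^+ s * Y) = 8 * X * Y); last by rewrite /X; ring.
    have -> : 4 * (2 * Y - 1) = 8 * Y - 4 by ring.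
    apply: (@le_trans _ _ (8 * Y)); first by rewrite gerBl.
    by rewrite ler_wpM2r ?(ltW q0)// ler_peMr.
  have h3 := ler_wpM2l (_ : 0 <= 28 * C) h1.
  apply: (le_trans (lerD (h3 _) h2)); first by rewrite mulr_ge0// (le_trans _ C1).
  by rewrite /D [leRHS]mulrDl lerD2r [leRHS]mulrAC mulrA.
apply: (@le_trans _ _ (\sum_(s <= j < P) mass (j - s)%N * (D * w ^+ s))).
  apply: (@ler_sum_support R (fun j => \sum_(j' < j.+1) `|c j j'|)
    (fun j => mass (j - s)%N * (D * w ^+ s))) => j.
    rewrite mulr_ge0 ?sumr_ge0// mulr_ge0 ?exprn_ge0// addr_ge0// divr_ge0 ?(ltW w1)//.
    by rewrite mulr_ge0// (le_trans _ C1).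
  by move=> jP; rewrite jP andbT; exact: inner.
rewrite -mulr_suml [leRHS]mulrA [leRHS]mulrC ler_wpM2r ?sum_mass_shift_le//.
rewrite mulr_ge0 ?exprn_ge0// addr_ge0// divr_ge0 ?(ltW w1)//.
by rewrite mulr_ge0// (le_trans _ C1).
Qed.

Lemma scale_square_ge0 x : 0 <= scale_square x.
Proof.
rewrite /scale_square mulr_ge0// sumr_ge0// => l _.
rewrite (@class_square_sum R (fun j => rank x j %/ 2 ^ l)%N (fun j => scale_term j x) P
  (\max_(j < P) (rank x j %/ 2 ^ l)).+1).
  by rewrite sumr_ge0// => i _; rewrite sqr_ge0.
move=> j jP; rewrite ltnS.
exact: (@leq_bigmax _ (fun j : 'I_P => rank x j %/ 2 ^ l)%N (Ordinal jP)).
Qed.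

Lemma sum_scale_square_le :
  \sum_(x < V) scale_square x <= (2 * s).+1%:R ^+ 2 * (2 * D * w ^+ s * total).
Proof.
rewrite /scale_square -mulr_sumr expr2 -mulrA ler_wpM2l// exchange_big /=.
apply: (@le_trans _ _ (\sum_(l < (2 * s).+1) 2 * D * w ^+ s * total)).
  by apply: ler_sum => l _; exact: sum_level_le.
by rewrite sumr_const card_ord -[leLHS]mulr_natl.
Qed.
End FixedScale.

(** With w = r^8, two factors r^s pay for the square of 2 s + 1 by Bernoulli's inequality; the power
    r^(4 s) kept is the one [weighted_square_sum] consumes. *)
Lemma geometric_weight (R : realType) (w : R) : 0 < w < 1 ->
  exists r K : R, [/\ 0 < r < 1, 1 <= K &
    forall s : nat, (2 * s).+1%:R ^+ 2 * w ^+ s <= K * r ^+ (4 * s)].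
Proof.
move=> /andP[w0 w1].
have [r [r0 r1 wr]] : exists r : R, [/\ 0 < r, r < 1 & w = r ^+ 8].
  pose sq (t : R) : R := Num.sqrt t.
  have sq01 (t : R) : 0 < t < 1 -> 0 < sq t < 1.
    move=> /andP[t0 t1]; rewrite /sq sqrtr_gt0 t0 /=.
    by rewrite -[ltRHS]sqrtr1 ltr_sqrt.
  have sqE (t : R) : 0 < t -> t = sq t ^+ 2 by move=> t0; rewrite /sq sqr_sqrtr// ltW.
  have /andP[a0 a1] := sq01 _ (introT andP (conj w0 w1)).
  have /andP[b0 b1] := sq01 _ (introT andP (conj a0 a1)).
  have /andP[r0 r1] := sq01 _ (introT andP (conj b0 b1)).
  by exists (sq (sq (sq w))); split; rewrite // (exprM _ 4 2) (exprM _ 2 2) -!sqE.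
pose e : R := r^-1 - 1.
have e0 : 0 < e by rewrite subr_gt0 invf_gt1.
pose K : R := 1 + 2 / e.
have K1 : 1 <= K by rewrite lerDl divr_ge0// ltW.
have bern s : 1 + s%:R * e <= (r ^+ s)^-1.
  elim: s => [|s IH]; first by rewrite mul0r addr0 expr0 invr1.
  rewrite exprS invfM (_ : r^-1 = 1 + e); last by rewrite /e; ring.
  apply: (@le_trans _ _ ((1 + e) * (1 + s%:R * e))); last first.
    by rewrite ler_wpM2l// addr_ge0// ltW.
  rewrite -natr1; have : 0 <= s%:R * (e * e) by rewrite !mulr_ge0// ltW.
  by clear; lra.
have main s : (2 * s).+1%:R * r ^+ s <= K.
  have rs : 0 < r ^+ s by rewrite exprn_gt0.
  rewrite -ler_pdivlMr//; apply: (@le_trans _ _ (K * (1 + s%:R * e))); last first.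
    by rewrite ler_wpM2l ?bern// (le_trans _ K1).
  rewrite (_ : K * (1 + s%:R * e) = 1 + 2 * s%:R + (2 / e + s%:R * e)); last first.
    by rewrite /K; field; rewrite lt0r_neq0.
  rewrite -natr1 natrM [leLHS]addrC lerDl.
  by apply: addr_ge0; [apply: divr_ge0 => //|apply: mulr_ge0 => //]; exact: ltW.
exists r, (K ^+ 2); split; rewrite ?r0 ?exprn_ege1// => s.
have -> : (2 * s).+1%:R ^+ 2 * w ^+ s = ((2 * s).+1%:R * r ^+ s) ^+ 2 * r ^+ (2 * s) * r ^+ (4 * s).
  rewrite wr -exprM (_ : (8 * s = s + s + 2 * s + 4 * s)%N); last by clear; lia.
  by rewrite !exprD; set a := r ^+ s; set b := r ^+ (2 * s); set c := r ^+ (4 * s); ring.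
have X0 : 0 <= (2 * s).+1%:R * r ^+ s by rewrite mulr_ge0// exprn_ge0// ltW.
apply: ler_pM => //; rewrite ?mulr_ge0 ?sqr_ge0 ?exprn_ge0 ?(ltW r0)//.
rewrite -[leRHS]mulr1; apply: ler_pM; rewrite ?sqr_ge0 ?exprn_ge0 ?exprn_ile1 ?(ltW r0) ?(ltW r1)//.
by rewrite lerXn2r ?nnegrE ?main// (le_trans X0).
Qed.

(** Cauchy-Schwarz with weights [r ^+ s]: dividing by r^(2 s) still leaves a convergent series of
    ratio r^2, and the weights themselves sum to the other factor. *)
Lemma weighted_square_sum (R : realFieldType) (r A : R) (a : nat -> nat -> R) (n V : nat) :
  0 < r < 1 -> 0 <= A ->
  (forall s, (s < n)%N -> \sum_(x < V) a s x ^+ 2 <= A * r ^+ (4 * s)) ->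
  \sum_(x < V) (\sum_(s < n) a s x) ^+ 2 <= A / (1 - r ^+ 2) ^+ 2.
Proof.
move=> /andP[r0 r1] A0 ha.
have r20 : 0 <= r ^+ 2 < 1 by rewrite exprn_ge0 ?ltW// exprn_ilt1// ltW.
have q0 : 0 < 1 - r ^+ 2 by case/andP: r20 => _; rewrite subr_gt0.
have geo : \sum_(s < n) (r ^+ s) ^+ 2 <= (1 - r ^+ 2)^-1.
  under eq_bigr do rewrite exprAC.
  rewrite -(big_mkord xpredT (fun s => (r ^+ 2) ^+ s)).
  by apply: (le_trans (sum_expr_le 0 n r20)); rewrite expr0 mul1r.
have rne s : r ^+ s != 0 by rewrite expf_neq0// lt0r_neq0.
apply: (@le_trans _ _ (\sum_(x < V) (1 - r ^+ 2)^-1 * \sum_(s < n) (a s x / r ^+ s) ^+ 2)).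
  apply: ler_sum => x _.
  have -> : \sum_(s < n) a s x = \sum_(s < n) r ^+ s * (a s x / r ^+ s).
    by apply: eq_bigr => s _; rewrite mulrCA divff// mulr1.
  apply: (le_trans (cauchy_schwarz_sum _ _ _ _)).
  by rewrite ler_wpM2r ?geo// sumr_ge0// => s _; rewrite sqr_ge0.
rewrite -mulr_sumr exchange_big /= mulrC expr2 invfM mulrA ler_pM2r ?invr_gt0//.
apply: (@le_trans _ _ (\sum_(s < n) A * (r ^+ s) ^+ 2)).
  apply: ler_sum => s _.
  have -> : \sum_(i < V) (a s i / r ^+ s) ^+ 2 = (\sum_(i < V) a s i ^+ 2) / (r ^+ s) ^+ 2.
    by rewrite mulr_suml; apply: eq_bigr => i _; rewrite expr_div_n.
  rewrite ler_pdivrMr ?exprn_gt0// -mulrA -exprD -exprM mulnC.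
  exact: ha.
by rewrite -mulr_sumr ler_wpM2l.
Qed.

Lemma blockopE (R : realType) (u b : nat -> R) (V j x : nat) :
  (forall y, (V <= y)%N -> b y = 0) ->
  blockop V u j b x = \sum_(2 ^ j <= n < 2 ^ j.+1) u n * b (x + n)%N.
Proof.
move=> bV; pose G n := block u j n * b (x + n)%N; pose W := (V + 2 ^ j.+1)%N.
have jj : (2 ^ j <= 2 ^ j.+1)%N by rewrite leq_exp2l.
have -> : \sum_(2 ^ j <= n < 2 ^ j.+1) u n * b (x + n)%N = \sum_(0 <= n < W) G n.
  rewrite (@sum_nat_support _ G 0 W (2 ^ j) (2 ^ j.+1)); last first.
    by move=> n /negbTE h; rewrite /G /block h mul0r.
  have -> : \sum_(2 ^ j <= n < 2 ^ j.+1) u n * b (x + n)%N =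
      \sum_(2 ^ j <= n < 2 ^ j.+1) G n.
    by apply: eq_big_nat => n h; rewrite /G /block h.
  rewrite (@sum_nat_support _ G _ _ (2 ^ j) (2 ^ j.+1)); last first.
    by move=> n /negbTE h; rewrite /G /block h mul0r.
  by rewrite minnn maxnn max0n (minn_idPr _)// leq_addl.
rewrite (@sum_nat_support _ G 0 W 0 (V - x)); last first.
  move=> n; rewrite leq0n -leqNgt /= => h; rewrite /G bV ?mulr0//.
  by rewrite -leq_subLR.
rewrite /blockop -(big_mkord xpredT (fun y => block u j (y - x)%N * b y)).
rewrite (@sum_nat_support _ _ 0 V x V); last first.
  move=> n; rewrite negb_and -ltnNge -leqNgt => /orP[nx|/bV ->]; last by rewrite mulr0.
  by rewrite (_ : (n - x = 0)%N) ?block0 ?mul0r//; apply/eqP; rewrite subn_eq0 ltnW.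
rewrite minnn !max0n subn0 (minn_idPr _); last by rewrite /W; clear; lia.
by apply: eq_bigr => n _; rewrite addKn.
Qed.

(** * The exceptional set at height 1 *)

Section WeakTypeUnit.
Context (R : realType) (u : nat -> R) (C w : R) (gap : nat -> nat)
  (osc : oscillating_kernel u C w gap).
Context (F : nat -> R) (P : nat).
Hypothesis F_supp : forall y, (2 ^ P <= y)%N -> F y = 0.
Hypothesis F_total : \sum_(y < 2 ^ P) `|F y| <= 2 ^+ P.

Let V := (2 ^ P)%N.
Let sel := sel F P.
Let total : R := \sum_(x < V) `|F x|.
Let g := gpart F P.

(** Only intervals to the right count, since the sums look at [x + n]. The offsets 0 and 1 eliminate
    scales larger than the block; the offset 2 is for the incomplete last block. *)
Definition near_bad (x : nat) : bool :=
  [exists l : 'I_P, exists c : 'I_3, sel l (x %/ 2 ^ l + c)].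

Lemma near_bad_count : \sum_(x < V) (near_bad x)%:R <= 3 * total.
Proof.
apply: (@le_trans _ _ (\sum_(x < V) \sum_(l < P) \sum_(c < 3) (sel l (x %/ 2 ^ l + c))%:R)).
  apply: ler_sum => x _; rewrite /near_bad; case: existsP => [[l /existsP[c lc]]|_]; last first.
    by rewrite sumr_ge0// => l _; rewrite sumr_ge0.
  rewrite (bigD1 l)//= (bigD1 c)//= lc -addrA lerDl addr_ge0 ?sumr_ge0// => i _.
  by rewrite sumr_ge0.
rewrite exchange_big /=.
apply: (@le_trans _ _ (\sum_(l < P) 3 * \sum_(x < V) `|bpart F P l x|)).
  apply: ler_sum => l _; rewrite exchange_big /=.
  apply: (@le_trans _ _ (\sum_(c < 3) \sum_(x < V) `|bpart F P l x|)).
    by apply: ler_sum => c _; apply: sum_sel_shift => //; exact: ltnW.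
  by rewrite sumr_const card_ord -[leLHS]mulr_natl.
by rewrite -mulr_sumr ler_pM2l// sum_bpart_le.
Qed.

Lemma far_scale_vanish x i l : ~~ near_bad x -> (l < P)%N -> (i < l)%N ->
  blockop V u i (bpart F P l) x = 0.
Proof.
move=> nb lP il; rewrite /blockop big1// => y _.
rewrite /block; case: ifP => [/andP[y1 y2]|]; last by rewrite mul0r.
rewrite /bpart; case: eqP => [ly|_]; last by rewrite mulr0.
exfalso; move: nb => /negP; apply.
have B0 : (0 < 2 ^ l)%N by rewrite expn_gt0.
have y3 : (y - x < 2 ^ l)%N by rewrite (leq_trans y2)// leq_exp2l.
have y4 : (0 < 2 ^ i)%N by rewrite expn_gt0.
have xy : (x <= y)%N by move: y1 y4; clear; lia.
have h1 : (x %/ 2 ^ l <= y %/ 2 ^ l)%N by rewrite leq_div2r.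
have h2 : (y %/ 2 ^ l < x %/ 2 ^ l + 2)%N.
  by rewrite ltn_divLR// mulnDl; have := ltn_ceil x B0; rewrite mulSn; move: y3; clear; lia.
have cc : (y %/ 2 ^ l - x %/ 2 ^ l < 3)%N by move: h2; clear; lia.
apply/existsP; exists (Ordinal lP); apply/existsP; exists (Ordinal cc) => /=.
by rewrite subnKC// /sel -lvl_sel// ly.
Qed.

(** A bad interval lies in a selected one of scale [l >= j], and passing to the coarser scale does
    not increase the offset [c] from [x]; so [x] would be near a selected interval. *)
Lemma good_average x j c : ~~ near_bad x -> (c < 3)%N ->
  dmass F j (x %/ 2 ^ j + c) <= 2 ^+ j.
Proof.
move=> nb c3; rewrite leNgt; apply/negP => bj; move: nb => /negP; apply.
pose y := ((x %/ 2 ^ j + c) * 2 ^ j)%N.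
have yj : (y %/ 2 ^ j = x %/ 2 ^ j + c)%N by rewrite mulnK// expn_gt0.
have := @bad_lvl R F P F_supp F_total j y; rewrite yj => /(_ bj).
case ly : (lvl F P y) => [//|l]; rewrite ltnS => jl.
have lP : (l < P)%N by have [b _] := lvlS F_supp F_total ly; exact: (bad_lt F_supp F_total b).
have yl : (y %/ 2 ^ l = (x %/ 2 ^ j + c) %/ 2 ^ (l - j))%N by rewrite (divn_pow2 _ jl) yj.
have xl : (x %/ 2 ^ l = x %/ 2 ^ j %/ 2 ^ (l - j))%N by rewrite (divn_pow2 _ jl).
have q0 : (0 < 2 ^ (l - j))%N by rewrite expn_gt0.
have h1 : (x %/ 2 ^ l <= y %/ 2 ^ l)%N by rewrite yl xl leq_div2r// leq_addr.
have h2 : (y %/ 2 ^ l <= x %/ 2 ^ l + c)%N.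
  rewrite yl xl -ltnS ltn_divLR//; set k := (x %/ 2 ^ j)%N.
  have := ltn_ceil k q0; set q := (2 ^ (l - j))%N in q0 *; set t := (k %/ q)%N => h.
  rewrite -(addSn t c) mulnDl; apply: (@leq_trans (t.+1 * q + c)); first by rewrite ltn_add2r.
  by rewrite leq_add2l leq_pmulr.
have cc : (y %/ 2 ^ l - x %/ 2 ^ l < 3)%N by move: h2 c3; clear; lia.
apply/existsP; exists (Ordinal lP); apply/existsP; exists (Ordinal cc) => /=.
by rewrite subnKC// /sel -lvl_sel// ly.
Qed.

(** The incomplete block needs no oscillation: [u] is at most 2^-j there, and [x + n] stays in two
    dyadic intervals of average at most 1. *)
Lemma truncated_block_le x j N : ~~ near_bad x -> (2 ^ j <= N <= 2 ^ j.+1)%N ->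
  `|\sum_(2 ^ j <= n < N) u n * F (x + n)%N| <= 2.
Proof.
move=> nb /andP[jN Nj]; set B := (2 ^ j)%N in jN *.
have B0 : (0 < B)%N by rewrite expn_gt0.
have p0 : 0 < 2 ^+ j :> R by rewrite exprn_gt0.
apply: (le_trans (ler_norm_sum _ _ _)).
apply: (@le_trans _ _ (\sum_(B <= n < N) (2 ^+ j)^-1 * `|F (x + n)%N|)).
  rewrite big_nat [leRHS]big_nat; apply: ler_sum => n /andP[Bn _].
  rewrite normrM ler_wpM2r//; apply: (le_trans (osc_bound osc n)).
  by rewrite lef_pV2 ?posrE ?ltr0n ?(leq_trans B0)// -natrX ler_nat.
rewrite -mulr_sumr mulrC ler_pdivrMr// mulr2n mulrDl mul1r.
set k := (x %/ B)%N.
have h1 := @good_average x j 1 nb isT; have h2 := @good_average x j 2 nb isT.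
apply: le_trans (lerD h1 h2).
have -> : \sum_(B <= n < N) `|F (x + n)%N| = \sum_(B + x <= y < N + x) `|F y|.
  by rewrite big_addn addnK; apply: eq_big_nat => n _; rewrite addnC.
rewrite /dmass -/B -/k addn1 addn2 -big_cat_nat /=; last 2 first.
- by rewrite leq_mul2r leqnSn orbT.
- by rewrite leq_mul2r leqnSn orbT.
have kx : (k * B <= x)%N by rewrite leq_divM.
have xk : (x < k.+1 * B)%N by rewrite ltn_ceil.
have a1 : (k.+1 * B <= B + x)%N by rewrite mulSn leq_add2l.
have a2 : (N + x <= k.+3 * B)%N.
  by move: Nj xk; rewrite expnS -/B !mulSn; clear; lia.
rewrite [leRHS](big_cat_nat a1) /=; last by apply: leq_trans a2; rewrite leq_add2r.
rewrite [X in _ <= _ + X](big_cat_nat _ a2) /=; last by rewrite leq_add2r.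
by rewrite addrCA lerDl addr_ge0// sumr_ge0.
Qed.

Let tail s J x := \sum_(J <= j < P) scale_term u F P s j x.

(** The change of index [l = i - s] is possible because scales [l > i] vanish off [near_bad].
    Initial sums are written as differences of tails, the form that [tail_sqr_le] bounds. *)
Lemma partial_sum_decomposition x j : ~~ near_bad x -> (j <= P)%N ->
  \sum_(i < j) blockop V u i F x =
  \sum_(i < j) blockop V u i g x + \sum_(s < P) (tail s 0 x - tail s j x).
Proof.
move=> nb jP.
have -> : \sum_(s < P) (tail s 0 x - tail s j x) =
    \sum_(i < j) \sum_(s < P) scale_term u F P s i x.
  rewrite exchange_big; apply: eq_bigr => s _ /=.
  by rewrite /tail (big_cat_nat (leq0n j) jP) /= addrK big_mkord.
rewrite -big_split; apply: eq_bigr => i _ /=.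
have iP : (i < P)%N by apply: leq_trans jP.
have -> : blockop V u i F x = blockop V u i g x + \sum_(l < P) blockop V u i (bpart F P l) x.
  rewrite /blockop exchange_big -big_split; apply: eq_bigr => y _ /=.
  by rewrite -mulr_sumr -mulrDr -CZ_decomposition.
congr (_ + _).
rewrite -(big_mkord xpredT (fun l => blockop V u i (bpart F P l) x)).
rewrite -(big_mkord xpredT (fun s => scale_term u F P s i x)).
rewrite (@big_cat_nat _ _ _ i.+1)//= [X in _ + X]big_nat [X in _ + X]big1 ?addr0; last first.
  by move=> l /andP[il lP]; exact: far_scale_vanish.
rewrite [RHS](@big_cat_nat _ _ _ i.+1)//= [X in _ = _ + X]big_nat [X in _ = _ + X]big1 ?addr0; last first.
  by move=> s /andP[si _]; rewrite /scale_term leqNgt si.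
rewrite !big_mkord (reindex_inj rev_ord_inj) /=; apply: eq_bigr => s _.
by rewrite /scale_term -ltnS ltn_ord subSS.
Qed.

Lemma blockop_large i x : (P <= i)%N -> blockop V u i F x = 0.
Proof.
move=> Pi; rewrite /blockop big1// => y _; rewrite /block leqNgt.
rewrite (_ : (y - x < 2 ^ i)%N) ?mul0r//.
by rewrite (leq_ltn_trans (leq_subr _ _))// (leq_trans (ltn_ord y))// leq_exp2l.
Qed.

Lemma good_part_square i : \sum_(x < V) (blockop V u i g x) ^+ 2 <= 28 * C * w ^+ i * total.
Proof.
have gt : \sum_(y < V) `|g y| <= total.
  by apply: ler_sum => y _; rewrite /g /gpart; case: ifP; rewrite ?normr0.
have C1 := osc_const osc; have /andP[wl wu] := osc_ratio osc.
have w0 : 0 <= w by apply: le_trans wl; rewrite invr_ge0.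
have := @correlation_bound R u C w gap osc V (fun=> 1) i i g g 0 (leqnn _).
rewrite normr1 lexx lexx exprn_ge0// => /(_ (fun=> isT) isT) cb.
apply: le_trans (_ : (\sum_(y < V) `|g y|) * (28 * C * w ^+ i) <= _); last first.
  by rewrite mulrC ler_wpM2l// !mulr_ge0 ?exprn_ge0// (le_trans _ C1).
have {}cb := cb _; rewrite mulr0 mul0r addr0 in cb.
apply: le_trans (cb _).
  by apply: (le_trans _ (ler_norm _)); apply: ler_sum => x _; rewrite mul1r expr2.
move=> m n mn; rewrite addr0; apply: (@le_trans _ _ (\sum_(m <= y < n) 1)).
  by apply: ler_sum => y _; exact: gpart_le1.
by rewrite sumr_const_nat ler_peMl// ler1n.
Qed.

Let M s x := Num.sqrt (scale_square u F P s x).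

(** The thresholds are chosen for the total 4: 1 from the good part, twice 1/2 from two tails of the
    bad part, and 2 from the last block. *)
Definition exceptional (x : nat) : bool :=
  [|| near_bad x,
      [exists s : 'I_P, (2 ^ (2 * s) <= \sum_(0 <= i < P) active F P s x i)%N],
      1 < \sum_(i < P) `|blockop V u i g x| | 2^-1 < \sum_(s < P) M s x].

Lemma not_exceptional_bound x N : (x < V)%N -> ~~ exceptional x ->
  `|\sum_(n < N) u n * F (x + n)%N| <= 4.
Proof.
move=> xV; rewrite /exceptional !negb_or -!leNgt => /and4P[nb rk gs bs].
have [->|N0] := posnP N; first by rewrite big_ord0 normr0.
set j := trunc_log 2 N.
have /andP[jN Nj] : (2 ^ j <= N < 2 ^ j.+1)%N.
  by rewrite trunc_logP//= trunc_log_ltn.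
have sumE i : (2 ^ i <= N)%N -> \sum_(0 <= n < 2 ^ i) u n * F (x + n)%N = \sum_(k < i) blockop V u k F x.
  elim: i => [|i IH] iN.
    (* At [n = 0] the size bound reads [|u 0| <= 0^-1 = 0], so the term that belongs to no block
       vanishes. *)
    rewrite expn0 big_nat1 big_ord0; have := osc_bound osc 0.
    by rewrite invr0 normr_le0 => /eqP ->; rewrite mul0r.
  have i1 : (2 ^ i <= 2 ^ i.+1)%N by rewrite leq_exp2l.
  rewrite (big_cat_nat (leq0n _) i1) /= IH; last exact: leq_trans iN.
  by rewrite big_ord_recr /= blockopE.
rewrite -(big_mkord xpredT (fun n => u n * F (x + n)%N)).
rewrite (big_cat_nat (leq0n _) jN) /= sumE//.
have trunc := @truncated_block_le x j N nb; rewrite jN (ltnW Nj) in trunc.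
apply: (le_trans (ler_normD _ _)).
rewrite (_ : 4 = 2 + 2); last by ring.
apply: lerD; last exact: trunc.
pose j' := minn j P.
have -> : \sum_(k < j) blockop V u k F x = \sum_(k < j') blockop V u k F x.
  rewrite -!(big_mkord xpredT (fun k => blockop V u k F x)) (@big_cat_nat _ _ _ j')//= ?geq_minl//.
  rewrite [X in _ + X]big_nat [X in _ + X]big1 ?addr0// => k /andP[jk kj].
  by apply: blockop_large; move: jk kj; rewrite /j'; clear; lia.
have j'P : (j' <= P)%N by rewrite geq_minr.
rewrite partial_sum_decomposition//.
apply: (le_trans (ler_normD _ _)); rewrite (_ : 2 = 1 + 1); last by ring.
apply: lerD.
  apply: le_trans gs; apply: (le_trans (ler_norm_sum _ _ _)).
  rewrite -!(big_mkord xpredT (fun i => `|blockop V u i g x|)).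
  by rewrite [leRHS](@big_cat_nat _ _ _ j')//= lerDl sumr_ge0.
apply: (@le_trans _ _ (2 * \sum_(s < P) M s x)); last first.
  by rewrite -ler_pdivlMl// mulr1.
rewrite mulr_sumr; apply: (le_trans (ler_norm_sum _ _ _)); apply: ler_sum => s _.
have tb J : (J <= P)%N -> `|tail s J x| <= M s x.
  move=> JP; rewrite -(sqrtr_sqr (tail s J x)) ler_wsqrtr//.
  apply: scale_square_ge => //; move: rk; rewrite negb_exists => /forallP/(_ s).
  by rewrite -ltnNge.
apply: (le_trans (ler_normB _ _)).
by rewrite mulr2n mulrDl mul1r lerD// tb.
Qed.

Lemma exceptional_count r K : 0 < r < 1 -> 1 <= K ->
  (forall s : nat, (2 * s).+1%:R ^+ 2 * w ^+ s <= K * r ^+ (4 * s)) ->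
  \sum_(x < V) (exceptional x)%:R <=
  (7 + 28 * C * K / (1 - r ^+ 2) ^+ 2
     + 4 * (2 * (28 * C / (1 - w) + 8) * K / (1 - r ^+ 2) ^+ 2)) * total.
Proof.
move=> r01 K1 rK; have /andP[r0 r1] := r01.
have C1 := osc_const osc; have /andP[wl wu] := osc_ratio osc.
have w0 : 0 <= w by apply: le_trans wl; rewrite invr_ge0.
have w1 : 0 < 1 - w by rewrite subr_gt0.
have t0 : 0 <= total by rewrite sumr_ge0.
set D := 28 * C / (1 - w) + 8.
have D0 : 0 <= D.
  by rewrite addr_ge0// divr_ge0 ?(ltW w1)// mulr_ge0// (le_trans _ C1).
have wK s : w ^+ s <= K * r ^+ (4 * s).
  apply: le_trans (rK s); rewrite ler_peMl ?exprn_ge0// exprn_ege1//.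
  by rewrite ler1n.
have g1 : \sum_(x < V) (1 < \sum_(i < P) `|blockop V u i g x|)%R%:R <=
    28 * C * K * total / (1 - r ^+ 2) ^+ 2.
  apply: (@le_trans _ _ (\sum_(x < V) (\sum_(i < P) `|blockop V u i g x|) ^+ 2)).
    apply: ler_sum => x _; case: ltP => h; last by rewrite sqr_ge0.
    by rewrite exprn_ege1// ltW.
  apply: (@weighted_square_sum _ _ _ (fun s x => `|blockop V u s g x|)) => //.
    by rewrite !mulr_ge0// (le_trans _ C1, le_trans _ K1).
  move=> s _; under eq_bigr do rewrite real_normK ?num_real//.
  apply: (le_trans (good_part_square s)).
  rewrite (_ : 28 * C * K * total * r ^+ (4 * s) = 28 * C * (K * r ^+ (4 * s)) * total); last by ring.
  by rewrite ler_wpM2r// ler_wpM2l// mulr_ge0// (le_trans _ C1).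
have g2 : \sum_(x < V) (2^-1 < \sum_(s < P) M s x)%R%:R <=
    4 * (2 * D * K * total / (1 - r ^+ 2) ^+ 2).
  apply: (@le_trans _ _ (4 * \sum_(x < V) (\sum_(s < P) M s x) ^+ 2)).
    rewrite mulr_sumr; apply: ler_sum => x _; case: ltP => h; last by rewrite mulr_ge0 ?sqr_ge0.
    have : 2^-1 ^+ 2 <= (\sum_(s < P) M s x) ^+ 2.
      by rewrite lerXn2r ?nnegrE ?(ltW h)// (le_trans _ (ltW h)).
    have -> : true%:R = 4 * 2^-1 ^+ 2 :> R by rewrite /=; field.
    by move=> h2; rewrite ler_pM2l.
  rewrite ler_pM2l//.
  apply: (@weighted_square_sum _ _ _ M) => //.
    by rewrite !mulr_ge0// (le_trans _ K1).
  move=> s _; under eq_bigr do rewrite sqr_sqrtr ?scale_square_ge0//.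
  apply: (le_trans (sum_scale_square_le osc F_supp F_total s)).
  rewrite -/D -/V -/total.
  rewrite (_ : _ * _ = 2 * D * ((2 * s).+1%:R ^+ 2 * w ^+ s) * total); last by ring.
  rewrite (_ : 2 * D * K * total * r ^+ (4 * s) = 2 * D * (K * r ^+ (4 * s)) * total); last by ring.
  by rewrite ler_wpM2r// ler_wpM2l// mulr_ge0.
have g3 : \sum_(x < V) \sum_(s < P) (2 ^ (2 * s) <= \sum_(0 <= i < P) active F P s x i)%N%:R
    <= 4 * total.
  rewrite exchange_big /=; apply: (@le_trans _ _ (\sum_(s < P) 2 / 2 ^+ s * total)).
    by apply: ler_sum => s _; exact: many_active_count.
  rewrite -mulr_suml ler_wpM2r// -mulr_sumr (_ : 4 = 2 * 2); last by ring.
  rewrite ler_pM2l//; under eq_bigr do rewrite -exprVn.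
  rewrite -(big_mkord xpredT (fun s => 2^-1 ^+ s)).
  apply: (le_trans (@sum_expr_le R 2^-1 0 P _)).
    by rewrite invr_ge0 ler0n invf_lt1 ?ltr1n.
  by rewrite expr0 (_ : 1 - 2^-1 = 2^-1 :> R) ?mul1r ?invrK//; field.
(* Union bound over the four conditions; 7 = 3 + 4 collects the neighbourhoods of bad intervals and
   the points with many active terms. *)
apply: (@le_trans _ _ (\sum_(x < V) ((near_bad x)%:R +
   \sum_(s < P) (2 ^ (2 * s) <= \sum_(0 <= i < P) active F P s x i)%N%:R +
   (1 < \sum_(i < P) `|blockop V u i g x|)%R%:R + (2^-1 < \sum_(s < P) M s x)%R%:R))).
  apply: ler_sum => x _; rewrite /exceptional.
  have s0 : 0 <= \sum_(s < P) (2 ^ (2 * s) <= \sum_(0 <= i < P) active F P s x i)%N%:R :> R.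
    by rewrite sumr_ge0.
  have s1 : [exists s : 'I_P, (2 ^ (2 * s) <= \sum_(0 <= i < P) active F P s x i)%N]%:R <=
      \sum_(s < P) (2 ^ (2 * s) <= \sum_(0 <= i < P) active F P s x i)%N%:R :> R.
    case: existsP => [[s hs]|_]; last by rewrite sumr_ge0.
    by rewrite (bigD1 s)//= hs lerDl sumr_ge0.
  case: (near_bad x) => /=; first by rewrite -!addrA lerDl !addr_ge0.
  rewrite add0r; move: s1; case: existsP => /= _ s1; first by rewrite (le_trans s1)// -addrA lerDl addr_ge0.
  case: (1 < _)%R => /=; first by rewrite addrAC lerDr addr_ge0.
  by rewrite addr0 lerDr.
rewrite !big_split /=.
apply: (le_trans (lerD (lerD (lerD near_bad_count g3) g1) g2)).
rewrite le_eqVlt; apply/orP; left; apply/eqP.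
by set z := (1 - r ^+ 2) ^+ 2; ring.
Qed.
End WeakTypeUnit.

Lemma weak_type_bound (R : realType) (u : nat -> R) (C w : R) (gap : nat -> nat) :
  oscillating_kernel u C w gap ->
  exists2 A : R, 0 <= A & forall (F : nat -> R) (V0 : nat) (lam : R), 0 < lam ->
    (forall y, (V0 <= y)%N -> F y = 0) ->
    exists2 E : pred nat,
      \sum_(x < V0) (E x)%:R <= A / lam * \sum_(y < V0) `|F y| &
      forall x N, (x < V0)%N -> ~~ E x -> `|\sum_(n < N) u n * F (x + n)%N| <= 4 * lam.
Proof.
move=> osc; have C1 := osc_const osc; have /andP[wl wu] := osc_ratio osc.
have w0 : 0 < w by apply: lt_le_trans wl; rewrite invr_gt0.
have w1 : 0 < 1 - w by rewrite subr_gt0.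
have [r [K [r01 K1 rK]]] := @geometric_weight R w (introT andP (conj w0 wu)).
set A := 7 + 28 * C * K / (1 - r ^+ 2) ^+ 2
     + 4 * (2 * (28 * C / (1 - w) + 8) * K / (1 - r ^+ 2) ^+ 2).
have A0 : 0 <= A.
  have C0 : 0 <= C by exact: le_trans C1.
  have K0 : 0 <= K by exact: le_trans K1.
  rewrite /A; repeat first [done | exact: sqr_ge0 | exact: ltW | apply: addr_ge0 |
    apply: divr_ge0 | apply: mulr_ge0].
exists A => // F V0 lam lam0 FV.
pose F1 y := F y / lam.
pose tot := \sum_(y < V0) `|F1 y|.
(* Large enough for [2 ^ P] to exceed both the support and the total mass; [P] does not enter the
   constant. *)
pose P := (V0 + (Num.truncn tot).+1)%N.
have P2 n : (n <= 2 ^ n)%N by rewrite ltnW// ltn_expl.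
have V0P : (V0 <= 2 ^ P)%N by rewrite (leq_trans _ (P2 P))// leq_addr.
have F1V y : (V0 <= y)%N -> F1 y = 0 by move=> /FV; rewrite /F1 => ->; rewrite mul0r.
have F1P y : (2 ^ P <= y)%N -> F1 y = 0 by move=> Py; apply: F1V; exact: leq_trans Py.
have totE : \sum_(y < 2 ^ P) `|F1 y| = tot.
  rewrite /tot -!(big_mkord xpredT (fun y => `|F1 y|)) (@big_cat_nat _ _ _ V0)//=.
  by rewrite [X in _ + X]big_nat [X in _ + X]big1 ?addr0// => y /andP[/F1V -> _]; rewrite normr0.
have totP : \sum_(y < 2 ^ P) `|F1 y| <= 2 ^+ P.
  rewrite totE; apply: (@le_trans _ _ (Num.truncn tot).+1%:R); first by apply/ltW/truncnS_gt.
  by rewrite -natrX ler_nat (leq_trans _ (P2 P))// leq_addl.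
exists (exceptional u F1 P).
  apply: (@le_trans _ _ (\sum_(x < 2 ^ P) (exceptional u F1 P x)%:R)).
    rewrite -!(big_mkord xpredT (fun x => (exceptional u F1 P x)%:R)).
    by rewrite [leRHS](@big_cat_nat _ _ _ V0)//= lerDl sumr_ge0.
  apply: (le_trans (exceptional_count osc F1P totP r01 K1 rK)).
  rewrite -/A totE /tot -mulrA ler_wpM2l// mulr_sumr ler_sum// => y _.
  by rewrite normrM normfV (gtr0_norm lam0) mulrC.
move=> x N xV nE.
have := not_exceptional_bound osc F1P totP N (leq_trans xV V0P) nE.
have -> : \sum_(n < N) u n * F1 (x + n)%N = (\sum_(n < N) u n * F (x + n)%N) / lam.
  by rewrite mulr_suml; apply: eq_bigr => n _; rewrite mulrA.
by rewrite normrM normfV (gtr0_norm lam0) ler_pdivrMr.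
Qed.

(** * Transference and almost everywhere convergence *)

(** Truncation restricts a correlation to [n + d < a], that is, to a shorter range of summation.
    This gives access to partial blocks. *)
Lemma truncated_kernel (R : realType) (u : nat -> R) (C w : R) (gap : nat -> nat) (a : nat) :
  oscillating_kernel u C w gap ->
  oscillating_kernel (fun n => if (n < a)%N then u n else 0) C w gap.
Proof.
move=> [C1 w1 ub gapb corr]; split => //.
  by move=> n; case: ifP => // _; rewrite normr0 invr_ge0.
move=> j j' d m b jj gd; pose v n := if (n < a)%N then u n else 0; rewrite -/v.
have vE n : block v j (n + d)%N * block v j' n =
    if (n < a - d)%N then block u j (n + d)%N * block u j' n else 0.
  rewrite ltn_subRL (addnC d n) /block /v; case: (ltnP (n + d) a) => h.
    by rewrite (leq_ltn_trans (leq_addr d n) h).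
  by rewrite if_same mul0r.
under eq_bigr do rewrite vE.
rewrite (_ : \sum_(m <= n < b) _ = \sum_(m <= n < minn b (a - d)) block u j (n + d)%N * block u j' n).
  exact: corr.
rewrite -big_mkcond /= [RHS](big_nat_widen _ _ b) ?geq_minl//.
by rewrite big_nat_cond [RHS]big_nat_cond; apply: eq_bigl => n /=; clear; lia.
Qed.

Section Transference.
Context d (X : measurableType d) (R : realType) (mu : {measure set X -> \bar R}) (T : X -> X).
Hypothesis mT : measurable_fun setT T.
Hypothesis T_preserving : forall A, measurable A -> mu (T @^-1` A) = mu A.

Lemma measurable_iter n : measurable_fun setT (iter n T).
Proof. by elim: n => [|n IH] /=; [exact: measurable_id|exact: measurableT_comp]. Qed.

Lemma iter_preserving n A : measurable A -> mu (iter n T @^-1` A) = mu A.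
Proof.
elim: n A => [//|n IH] A mA.
rewrite (_ : iter n.+1 T @^-1` A = iter n T @^-1` (T @^-1` A))// IH ?T_preserving//.
by rewrite -[X in measurable X]setTI; exact: mT.
Qed.

Lemma integral_iter n (g : X -> R) : measurable_fun setT g -> (forall x, 0 <= g x) ->
  (\int[mu]_x (g (iter n T x))%:E = \int[mu]_x (g x)%:E)%E.
Proof.
move=> mg g0.
have := @ge0_integral_pushforward _ _ _ _ R _ (measurable_iter n) mu setT (EFin \o g) measurableT.
rewrite preimage_setT => <-.
- apply: (eq_measure_integral mu); first exact: measurable_iter.
  by move=> mI A mA _; rewrite -[RHS](iter_preserving n mA).
- exact/measurable_EFinP.
- by move=> x _; rewrite /= lee_fin.
Qed.

(** Integrate the inequality along orbits: both sides are sums of equal integrals, and the factor 2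
    is the ratio of the lengths. The doubled length leaves room for the forward shifts inside
    [g]. *)
Lemma transference (g h : X -> R) (L : nat) : (0 < L)%N ->
  measurable_fun setT g -> measurable_fun setT h ->
  (forall x, 0 <= g x) -> (forall x, 0 <= h x) ->
  (forall x, \sum_(l < L) g (iter l T x) <= \sum_(y < 2 * L) h (iter y T x)) ->
  (\int[mu]_x (g x)%:E <= 2%:E * \int[mu]_x (h x)%:E)%E.
Proof.
move=> L0 mg mh g0 h0 gh.
have sumI (f : X -> R) n : measurable_fun setT f -> (forall x, 0 <= f x) ->
    (\int[mu]_x (\sum_(l < n) f (iter l T x))%:E = n%:R%:E * \int[mu]_x (f x)%:E)%E.
  move=> mf f0; under eq_integral do rewrite -sumEFin.
  rewrite ge0_integral_sum//.
  - rewrite (eq_bigr (fun=> \int[mu]_x (f x)%:E)%E); last by move=> l _; exact: integral_iter.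
    elim: n => [|n IH]; first by rewrite big_ord0 mul0e.
    rewrite big_ord_recr /= IH -natr1 EFinD ge0_muleDl ?mul1e ?lee_fin//.
  - move=> l; apply/measurable_EFinP; apply: measurableT_comp => //; exact: measurable_iter.
  - by move=> l x _; rewrite lee_fin.
have msum (f : X -> R) n : measurable_fun setT f ->
    measurable_fun setT (fun x => (\sum_(l < n) f (iter l T x))%:E).
  move=> mf; apply/measurable_EFinP; apply: measurable_sum => l.
  by apply: measurableT_comp => //; exact: measurable_iter.
have L0' : 0 < L%:R :> R by rewrite ltr0n.
rewrite -(@lee_pmul2l _ L%:R%:E)//.
rewrite -(sumI g L)// muleA -EFinM -natrM mulnC -(sumI h)//.
apply: ge0_le_integral => //.
- by move=> x _; rewrite lee_fin sumr_ge0.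
- exact: msum.
- exact: msum.
- by move=> x _; rewrite lee_fin.
Qed.

Definition ergodic_sum (u : nat -> R) (f : X -> R) (m n : nat) (x : X) : R :=
  \sum_(m <= k < n) u k * f (iter k T x).

Lemma measurable_ergodic_sum u f m n : measurable_fun setT f ->
  measurable_fun setT (ergodic_sum u f m n).
Proof.
move=> mf; apply: measurable_sum => k.
by apply: measurable_funM => //; apply: measurableT_comp => //; exact: measurable_iter.
Qed.

Context (u : nat -> R) (C w : R) (gap : nat -> nat) (osc : oscillating_kernel u C w gap).

Lemma block_square_integral (f : X -> R) (j a : nat) :
  measurable_fun setT f -> (forall x, `|f x| <= 1) -> (2 ^ j <= a <= 2 ^ j.+1)%N ->
  (\int[mu]_x ((ergodic_sum u f (2 ^ j) a x) ^+ 2)%:E <=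
   2%:E * \int[mu]_x (28 * C * w ^+ j * `|f x|)%:E)%E.
Proof.
move=> mf f1 /andP[ja aj].
have /andP[wl _] := osc_ratio osc.
have c0 : 0 <= 28 * C * w ^+ j.
  rewrite !mulr_ge0 ?exprn_ge0// ?(le_trans _ (osc_const osc))//.
  by apply: le_trans wl; rewrite invr_ge0.
apply: (@transference _ _ (2 ^ j.+1)) => //.
- by rewrite expn_gt0.
- by apply: measurable_funX; exact: measurable_ergodic_sum.
- by apply: measurable_funM => //; exact: measurableT_comp.
- by move=> x; rewrite sqr_ge0.
- by move=> x; rewrite mulr_ge0.
move=> x; set V := (2 * 2 ^ j.+1)%N.
pose F y := if (y < V)%N then f (iter y T x) else 0.
pose v n := if (n < a)%N then u n else 0.
have FV y : (V <= y)%N -> F y = 0 by move=> Vy; rewrite /F ltnNge Vy.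
have LV : (2 ^ j.+1 <= V)%N by rewrite leq_pmull.
have ergE (l : nat) : (l < 2 ^ j.+1)%N ->
    ergodic_sum u f (2 ^ j) a (iter l T x) = blockop V v j F l.
  move=> lL; rewrite blockopE// (big_cat_nat ja aj) /= [X in _ + X]big_nat [X in _ + X]big1 ?addr0; last first.
    by move=> n /andP[an _]; rewrite /v ltnNge an mul0r.
  apply: eq_big_nat => n /andP[_ na]; rewrite /v na /F (_ : (l + n < V)%N).
    by rewrite addnC iterD.
  by rewrite /V; move: lL na aj; clear; lia.
have cb := @correlation_bound R v C w gap (truncated_kernel a osc) V (fun=> 1) j j F F 0
  (leqnn _).
apply: (@le_trans _ _ (\sum_(l < V) blockop V v j F l ^+ 2)).
  apply: (@le_trans _ _ (\sum_(l < 2 ^ j.+1) blockop V v j F l ^+ 2)).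
    by apply: ler_sum => l _; rewrite ergE.
  rewrite -!(big_mkord xpredT (fun l => blockop V v j F l ^+ 2)).
  by rewrite [leRHS](@big_cat_nat _ _ _ (2 ^ j.+1))//= lerDl sumr_ge0// => l _; rewrite sqr_ge0.
rewrite -mulr_sumr mulrC.
have -> : \sum_(y < V) `|f (iter y T x)| = \sum_(y < V) `|F y|.
  by apply: eq_bigr => y _; rewrite /F ltn_ord.
rewrite normr1 lexx lexx exprn_ge0// in cb.
have {}cb := cb (fun=> isT) isT _; rewrite mulr0 mul0r addr0 in cb.
apply: le_trans (cb _).
  by apply: (le_trans _ (ler_norm _)); apply: ler_sum => l _; rewrite mul1r expr2.
move=> m n mn; rewrite addr0; apply: (@le_trans _ _ (\sum_(m <= y < n) 1)).
  by apply: ler_sum => y _; rewrite /F; case: ifP; rewrite ?normr0.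
by rewrite sumr_const_nat ler_peMl// ler1n.
Qed.

Lemma weak_type_measure : exists2 A : R, 0 <= A &
  forall (f : X -> R) (lam : R), measurable_fun setT f -> 0 < lam ->
  let W := [set x | exists N, 4 * lam < `|ergodic_sum u f 0 N x|] in
  measurable W /\ (mu W <= 2%:E * \int[mu]_x (A / lam * `|f x|)%:E)%E.
Proof.
have [A A0 weak] := weak_type_bound osc.
exists A => // f lam mf lam0 W.
pose Z N := [set x | 4 * lam < `|ergodic_sum u f 0 N x|].
have mZ N : measurable (Z N).
  rewrite -[Z N]setTI.
  apply: (@measurable_fun_ltr _ _ _ setT (cst (4 * lam)) (fun x => `|ergodic_sum u f 0 N x|)) => //.
  by apply: measurableT_comp => //; exact: measurable_ergodic_sum.
(* Sums of length at most [M] see finitely many points of the orbit, so transference applies to each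
   [WM M] with the same constant; continuity from below then gives all lengths. *)
pose WM M := \big[setU/set0]_(N < M.+1) Z N.
have mW M : measurable (WM M) by apply: bigsetU_measurable.
have WE : W = \bigcup_M WM M.
  apply/seteqP; split=> x.
    by move=> [N ZN]; exists N => //; rewrite /WM -bigcup_mkord; exists N => /=.
  by move=> [M _]; rewrite /WM -bigcup_mkord => -[N _ ZN]; exists N.
have mWW : measurable W by rewrite WE; exact: bigcup_measurable.
split=> //.
have WMb M : (mu (WM M) <= 2%:E * \int[mu]_x (A / lam * `|f x|)%:E)%E.
  rewrite -[X in mu X]setIT -integral_indic//.
  have AL0 : 0 <= A / lam by rewrite divr_ge0// ltW.
  apply: (@transference (\1_(WM M)) _ M.+1) => //.
  - by apply: measurable_funM => //; exact: measurableT_comp.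
  - by move=> x; rewrite mulr_ge0.
  move=> x; set V := (2 * M.+1)%N.
  pose F y := if (y < V)%N then f (iter y T x) else 0.
  have FV y : (V <= y)%N -> F y = 0 by move=> Vy; rewrite /F ltnNge Vy.
  have [E Ec Eb] := weak F V lam lam0 FV.
  rewrite -mulr_sumr; have -> : \sum_(y < V) `|f (iter y T x)| = \sum_(y < V) `|F y|.
    by apply: eq_bigr => y _; rewrite /F ltn_ord.
  apply: le_trans Ec.
  have LV : (M.+1 <= V)%N by rewrite leq_pmull.
  apply: (@le_trans _ _ (\sum_(l < M.+1) (E l)%:R)); last first.
    rewrite -!(big_mkord xpredT (fun l => (E l)%:R)).
    by rewrite [leRHS](@big_cat_nat _ _ _ M.+1)//= lerDl sumr_ge0.
  apply: ler_sum => l _; have [El|nE] := boolP (E l).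
    by rewrite indicE; case: (_ \in _).
  rewrite indicE memNset// /WM -bigcup_mkord => -[N /= NM].
  rewrite /Z /= ltNge => /negP; apply.
  have lV : (l < V)%N by apply: leq_trans LV.
  have := Eb l N lV nE; rewrite /ergodic_sum big_mkord.
  under eq_bigr => n _.
    rewrite /F (_ : (l + n < V)%N); last first.
      by have := ltn_ord l; have := ltn_ord n; move: NM; rewrite /V; clear; lia.
    rewrite addnC iterD; over.
  by [].
have Wnd : {homo WM : n m / (n <= m)%N >-> (n <= m)%O}.
  move=> n m nm; rewrite /WM; apply/subsetPset => x.
  rewrite -!bigcup_mkord => -[N /= Nn ZN]; exists N => //=.
  by rewrite (leq_trans Nn).
have cvgW := @nondecreasing_cvg_mu _ _ _ mu WM mW (bigcup_measurable (fun k _ => mW k)) Wnd.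
rewrite WE -(cvg_lim _ cvgW)//; apply: lime_le.
  by apply/cvg_ex; exists (mu (\bigcup_n WM n)).
by apply: nearW => M; exact: WMb.
Qed.
End Transference.

Lemma unit_root (R : realType) (z : R) (q : nat) : 0 < z < 1 -> (0 < q)%N ->
  exists2 k : R, 0 < k < 1 & k ^+ q = z.
Proof.
move=> /andP[z0 z1] q0; have q0' : 0 < q%:R :> R by rewrite ltr0n.
have kq : (z `^ q%:R^-1) ^+ q = z.
  by rewrite -powR_mulrn ?powR_ge0// -powRrM mulVf ?lt0r_neq0// powRr1// ltW.
exists (z `^ q%:R^-1) => //; rewrite powR_gt0//=.
by rewrite ltNge; apply/negP => /(exprn_ege1 q); rewrite kq leNgt z1.
Qed.

Section AlmostEverywhere.
Context d (X : measurableType d) (R : realType) (mu : {measure set X -> \bar R}).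

Lemma borel_cantelli_geometric (B : nat -> set X) (K t : R) :
  0 <= K -> 0 <= t < 1 -> (forall k, measurable (B k)) ->
  (forall k, (mu (B k) <= (K * t ^+ k)%:E)%E) ->
  {ae mu, forall x, exists k0, forall k, (k0 <= k)%N -> ~ B k x}.
Proof.
move=> K0 t01 mB Bk.
have ls0 : mu (lim_sup_set B) = 0%E.
  apply: lim_sup_set_cvg0 => //; apply: (@le_lt_trans _ _ (K / (1 - t))%:E); last exact: ltry.
  apply: lime_le; first exact: is_cvg_nneseries.
  apply: nearW => n; apply: (@le_trans _ _ (\sum_(0 <= i < n) (K * t ^+ i)%:E)%E).
    by apply: lee_sum => i _; exact: Bk.
  rewrite sumEFin lee_fin -mulr_sumr ler_wpM2l//.
  by apply: (le_trans (sum_expr_le 0 n t01)); rewrite expr0 mul1r.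
have mls : measurable (lim_sup_set B).
  by apply: bigcapT_measurable => n; apply: bigcup_measurable.
have : mu.-negligible (lim_sup_set B) by apply/negligibleP.
apply: negligibleS => x /= nx n _; apply: contrapT => nB; apply: nx.
by exists n => k nk Bx; apply: nB; exists k.
Qed.

Lemma markov_le (g : X -> R) (c : R) : 0 < c -> measurable_fun setT g ->
  (forall x, 0 <= g x) ->
  let B := [set x | c < g x] in
  measurable B /\ (mu B <= (c^-1)%:E * \int[mu]_x (g x)%:E)%E.
Proof.
move=> c0 mg g0 B.
have mB : measurable [set x | c < g x].
  rewrite -[X in measurable X]setTI; exact: (@measurable_fun_ltr _ _ _ setT (cst c) g).
split=> //; rewrite -[X in mu X]setIT -integral_indic// -ge0_integralZl_EFin//; last 3 first.
- by move=> x _; rewrite lee_fin.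
- exact/measurable_EFinP.
- by rewrite invr_ge0 ltW.
apply: ge0_le_integral => //.
- by apply/measurable_EFinP; exact: measurable_indic.
- by apply/measurable_EFinP; exact: measurable_funM.
move=> x _; rewrite -EFinM lee_fin indicE; case: (boolP (x \in B)) => [xB|_].
  by have cx : c < g x := set_mem xB; rewrite ler_pdivlMl// mulr1 ltW.
by rewrite mulr_ge0// invr_ge0 ltW.
Qed.

Lemma measure_bigsetU_le (F : nat -> set X) (c : R) (n : nat) :
  (forall i, measurable (F i)) -> (forall i, (mu (F i) <= c%:E)%E) ->
  (mu (\big[setU/set0]_(i < n) F i) <= (n%:R * c)%:E)%E.
Proof.
move=> mF Fc; elim: n => [|n IH]; first by rewrite big_ord0 measure0 mul0r.
rewrite big_ord_recr /=; apply: (le_trans (measureU2 _ _ _)) => //.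
  exact: bigsetU_measurable.
by rewrite -natr1 mulrDl mul1r EFinD leeD ?Fc.
Qed.
End AlmostEverywhere.

Lemma cauchy_ball_cvg (R : realType) (S : nat -> R) :
  (forall e, 0 < e -> exists l, exists N0, forall N, (N0 <= N)%N -> `|l - S N| < e) ->
  cvgn S.
Proof.
move=> hS; apply: cauchy_cvg; apply: cauchy_exP => e e0.
have [l [N0 h]] := hS e e0; exists l; by exists N0 => //= N /h.
Qed.

Lemma dyadic_cvg (R : realType) (S : nat -> R) (K t : R) (j0 : nat) : 0 <= K -> 0 < t < 1 ->
  (forall j N, (j0 <= j)%N -> (2 ^ j <= N <= 2 ^ j.+1)%N -> `|S N - S (2 ^ j)%N| <= K * t ^+ j) ->
  cvgn S.
Proof.
move=> K0 /andP[t0 t1] hS; have q0 : 0 < 1 - t by rewrite subr_gt0.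
have main i j N : (j0 <= j)%N -> (2 ^ j <= N <= 2 ^ (j + i))%N ->
    `|S N - S (2 ^ j)%N| <= K * t ^+ j / (1 - t).
  elim: i j => [|i IH] j jj /andP[jN Ni].
    have -> : N = (2 ^ j)%N by apply/eqP; rewrite eqn_leq jN andbT -(addn0 j).
    by rewrite subrr normr0 divr_ge0 ?mulr_ge0 ?exprn_ge0// ltW.
  have -> : K * t ^+ j / (1 - t) = K * t ^+ j + K * t ^+ j.+1 / (1 - t).
    by rewrite exprS; field; rewrite lt0r_neq0.
  have [Nj|jN'] := leqP N (2 ^ j.+1)%N.
    apply: (@le_trans _ _ (K * t ^+ j)); first by apply: hS => //; rewrite jN.
    by rewrite lerDl divr_ge0 ?mulr_ge0 ?exprn_ge0// ltW.
  have -> : S N - S (2 ^ j)%N = (S (2 ^ j.+1)%N - S (2 ^ j)%N) + (S N - S (2 ^ j.+1)%N) by ring.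
  apply: (le_trans (ler_normD _ _)); apply: lerD.
    by apply: hS => //; rewrite leqnn andbT leq_exp2l.
  by apply: IH; [exact: leqW|rewrite (ltnW jN') addSnnS].
apply: cauchy_ball_cvg => e e0.
have [j jj je] : exists2 j, (j0 <= j)%N & K * t ^+ j / (1 - t) < e.
  have tc : (K / (1 - t)) * t ^+ n @[n --> \oo] --> (0 : R).
    rewrite -[X in _ --> X](mulr0 (K / (1 - t))); apply: cvgMr.
    by apply: cvg_expr; rewrite ger0_norm// ltW.
  have /cvgrPdist_lt/(_ e e0)[n _ hn] := tc.
  exists (maxn j0 n); first exact: leq_maxl.
  have := hn (maxn j0 n) (leq_maxr _ _); rewrite /= sub0r normrN mulrAC.
  exact: le_lt_trans (ler_norm _).
exists (S (2 ^ j)%N), (2 ^ j)%N => N jN; rewrite distrC.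
apply: le_lt_trans je; apply: (main N) => //; rewrite jN/=.
by rewrite (leq_trans (ltnW (ltn_expl N (isT : (1 < 2)%N))))// leq_exp2l// leq_addl.
Qed.

Section BoundedConvergence.
Context d (X : measurableType d) (R : realType) (mu : {measure set X -> \bar R}) (T : X -> X).
Hypothesis mT : measurable_fun setT T.
Hypothesis T_preserving : forall A, measurable A -> mu (T @^-1` A) = mu A.
Context (u : nat -> R) (C w : R) (gap : nat -> nat) (osc : oscillating_kernel u C w gap).

Let esum := ergodic_sum T u.

Lemma ergodic_sum_norm_le (f : X -> R) (c : R) (j m n : nat) x :
  (forall x, `|f x| <= c) -> (2 ^ j <= m)%N ->
  `|esum f m n x| <= (n - m)%:R * (c / 2 ^+ j).
Proof.
move=> fc jm; apply: (le_trans (ler_norm_sum _ _ _)).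
apply: (@le_trans _ _ (\sum_(m <= k < n) c / 2 ^+ j)); last first.
  by rewrite sumr_const_nat -[leLHS]mulr_natl.
rewrite big_nat [leRHS]big_nat; apply: ler_sum => k /andP[mk _].
rewrite normrM mulrC ler_pM// (le_trans (osc_bound osc k))//.
rewrite lef_pV2 ?posrE ?exprn_gt0// ?ltr0n.
  by rewrite -natrX ler_nat (leq_trans jm).
by rewrite (leq_trans _ mk)// (leq_trans _ jm)// expn_gt0.
Qed.

(** [2 ^ i] is the largest power of two below z^-j, and [2^-1 <= z] keeps it within the block
    length, so that the block splits into [2 ^ i] equal pieces. *)
Lemma cut_points_count (z : R) (j : nat) : 2^-1 <= z < 1 ->
  exists i, [/\ (i <= j)%N, 2 ^+ i <= (z ^+ j)^-1 & (2 ^+ i)^-1 <= 2 * z ^+ j].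
Proof.
move=> /andP[z2 z1]; have z0 : 0 < z by apply: lt_le_trans z2; rewrite invr_gt0.
have zj0 : 0 < z ^+ j by rewrite exprn_gt0.
have zj1 : 1 <= (z ^+ j)^-1 by rewrite invf_ge1// exprn_ile1 ?ltW.
have zj2 : (z ^+ j)^-1 <= 2 ^+ j.
  rewrite -exprVn lerXn2r ?nnegrE ?invr_ge0 ?(ltW z0)// -[leRHS]invrK lef_pV2 ?posrE ?invr_gt0//.
pose n := Num.truncn (z ^+ j)^-1.
have /andP[n1 n2] : n%:R <= (z ^+ j)^-1 < n.+1%:R by rewrite truncn_itv// (le_trans _ zj1).
have n0 : (0 < n)%N by rewrite -ltnS -(ltr_nat R); apply: le_lt_trans n2.
pose i := trunc_log 2 n.
have /andP[i1 i2] : (2 ^ i <= n < 2 ^ i.+1)%N by rewrite trunc_logP//= trunc_log_ltn.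
have i3 : 2 ^+ i <= (z ^+ j)^-1 by apply: le_trans n1; rewrite -natrX ler_nat.
exists i; split=> //.
  have := le_trans i3 zj2; rewrite -!natrX ler_nat leq_exp2l//.
rewrite -[leRHS]invrK lef_pV2 ?posrE ?invr_gt0 ?mulr_gt0 ?exprn_gt0//.
rewrite invfM ler_pdivrMl// -exprS -natrX; apply: (le_trans (ltW n2)).
by rewrite ler_nat.
Qed.

Lemma bounded_convergence (f : X -> R) (q : nat) : (0 < q)%N ->
  measurable_fun setT f -> (forall x, `|f x| <= 1) ->
  (\int[mu]_x (`|f x| ^+ q)%:E < +oo)%E ->
  {ae mu, forall x, cvgn (fun N => esum f 0 N x)}.
Proof.
move=> q0 mf f1 fI.
have C1 := osc_const osc; have /andP[wl wu] := osc_ratio osc.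
have w0 : 0 < w by apply: lt_le_trans wl; rewrite invr_gt0.
(* The gain [w ^+ j] is z^(8 j): four powers of z^j will be spent and z^(4 j) remains summable. The
   cutoff is k^j with k^q = z, so that the [q]-th moment costs one power of z^-j. *)
have [z /andP[z0 z1] zw] := unit_root (introT andP (conj w0 wu)) (isT : (0 < 8)%N).
have z2 : 2^-1 <= z.
  apply: (le_trans wl); rewrite -zw -[leRHS]expr1 ler_wiXn2l ?ltW//.
have [k /andP[k0 k1] kz] := unit_root (introT andP (conj z0 z1)) q0.
pose I := fine (\int[mu]_x (`|f x| ^+ q)%:E).
have IE : (\int[mu]_x (`|f x| ^+ q)%:E = I%:E)%E.
  rewrite fineK// ge0_fin_numE//; apply: integral_ge0 => x _.
  by rewrite lee_fin exprn_ge0.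
have I0 : 0 <= I by apply: fine_ge0; apply: integral_ge0 => x _; rewrite lee_fin exprn_ge0.
pose fj j x := if k ^+ j < `|f x| then f x else 0.
have mfj j : measurable_fun setT (fj j).
  apply: measurable_fun_ifT => //.
  apply: (@measurable_fun_ltr _ _ _ setT (cst (k ^+ j)) (fun x => `|f x|)) => //.
  exact: measurableT_comp.
have fj1 j x : `|fj j x| <= 1 by rewrite /fj; case: ifP; rewrite ?normr0.
have fjI j : (\int[mu]_x (`|fj j x|)%:E <= ((z ^+ j)^-1 * I)%:E)%E.
  have h1 x : [set: X] x -> (0 <= (`|f x| ^+ q)%:E)%E by rewrite lee_fin exprn_ge0.
  have h2 : measurable_fun setT (fun x => (`|f x| ^+ q)%:E).
    by apply/measurable_EFinP; apply: measurable_funX; exact: measurableT_comp.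
  have h3 : 0 <= (z ^+ j)^-1 by rewrite invr_ge0 exprn_ge0// ltW.
  rewrite EFinM -IE -(ge0_integralZl_EFin mu measurableT h1 h2 h3).
  apply: ge0_le_integral => //.
  - by apply/measurable_EFinP; exact: measurableT_comp.
  - apply/measurable_EFinP; apply: measurable_funM => //.
    by apply: measurable_funX; exact: measurableT_comp.
  move=> x _; rewrite -EFinM lee_fin /fj; case: ifP => [kf|_]; last first.
    by rewrite normr0 mulr_ge0 ?invr_ge0 ?exprn_ge0// ltW.
  apply: (le_trans (f1 x)); rewrite ler_pdivlMl ?exprn_gt0// mulr1 -kz exprAC.
  by rewrite lerXn2r ?nnegrE ?exprn_ge0 ?(ltW k0)// ltW.
have /choice[i hi] : forall j, exists i,
    [/\ (i <= j)%N, 2 ^+ i <= (z ^+ j)^-1 & (2 ^+ i)^-1 <= 2 * z ^+ j].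
  by move=> j; apply: cut_points_count; rewrite z2.
(* The minimum keeps the cut point in the block for every natural number [t]. *)
pose cutp j t := minn (2 ^ j + t * 2 ^ (j - i j)) (2 ^ j.+1).
have cut_in j t : (2 ^ j <= cutp j t <= 2 ^ j.+1)%N.
  have h : (2 ^ j <= 2 ^ j.+1)%N by rewrite leq_exp2l.
  rewrite /cutp; move: (2 ^ j.+1)%N (t * _)%N h => a b; clear; lia.
pose Bt j t := [set x | (z ^+ j) ^+ 2 < (esum (fj j) (2 ^ j) (cutp j t) x) ^+ 2].
pose B j := \big[setU/set0]_(t < (2 ^ i j).+1) Bt j t.
pose c j := ((z ^+ j) ^+ 2)^-1 * (2 * (28 * C * w ^+ j * ((z ^+ j)^-1 * I))).
have BtP j t : measurable (Bt j t) /\ (mu (Bt j t) <= (c j)%:E)%E.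
  have [|||mB B1] := @markov_le _ X R mu
    (fun x => (esum (fj j) (2 ^ j) (cutp j t) x) ^+ 2) ((z ^+ j) ^+ 2) _ _ _.
  - by rewrite !exprn_gt0.
  - by apply: measurable_funX; exact: measurable_ergodic_sum.
  - by move=> x; rewrite sqr_ge0.
  split=> //; apply: (le_trans B1); rewrite /c EFinM.
  rewrite lee_pmul2l ?lte_fin ?invr_gt0 ?exprn_gt0//.
  apply: (le_trans (block_square_integral mT T_preserving osc (mfj j) (fj1 j) (cut_in j t))).
  rewrite EFinM lee_pmul2l//.
  have c0 : 0 <= 28 * C * w ^+ j by rewrite !mulr_ge0 ?exprn_ge0 ?(ltW w0)// (le_trans _ C1).
  under eq_integral do rewrite EFinM.
  rewrite ge0_integralZl_EFin//; last by apply/measurable_EFinP; exact: measurableT_comp.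
  by rewrite [leRHS]EFinM lee_wpmul2l// lee_fin.
have mB j : measurable (B j) by apply: bigsetU_measurable => t _; have [] := BtP j t.
(* Starting from z^(8 j), the Chebyshev threshold costs z^(-2 j), the integral of [|fj j|] z^-j, and
   the number of cut points, at most 2 z^-j, one more; the constant is 2 * 28 * 2. *)
have Bj j : (mu (B j) <= (112 * C * I * (z ^+ 4) ^+ j)%:E)%E.
  apply: (le_trans (@measure_bigsetU_le _ X R mu (Bt j) (c j) _ _ _)).
  - by move=> t; have [] := BtP j t.
  - by move=> t; have [] := BtP j t.
  have [_ i1 _] := hi j.
  have c0 : 0 <= c j.
    rewrite /c !mulr_ge0 ?invr_ge0 ?sqr_ge0 ?exprn_ge0 ?(ltW z0) ?(ltW w0)//.
    exact: le_trans C1.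
  rewrite lee_fin; apply: (@le_trans _ _ (2 * (z ^+ j)^-1 * c j)).
    rewrite ler_wpM2r// -natr1 mulrDl mul1r natrX lerD//.
    by apply: le_trans i1; rewrite exprn_ege1// ler1n.
  rewrite /c -zw -!exprM (mulnC 8) (mulnC 4) !exprM.
  rewrite le_eqVlt; apply/orP; left; apply/eqP; field.
  by rewrite lt0r_neq0// exprn_gt0.
have z41 : 0 <= z ^+ 4 < 1 by rewrite exprn_ge0 ?exprn_ilt1 ?ltW.
have K0 : 0 <= 112 * C * I by rewrite !mulr_ge0// (le_trans _ C1).
apply: filterS (borel_cantelli_geometric K0 z41 mB Bj) => x [j0 hx].
pose rho := Num.max z k.
have rho0 : 0 < rho by rewrite lt_max z0.
have rho1 : rho < 1 by rewrite gt_max z1.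
apply: (@dyadic_cvg R _ 4 rho j0) => //; first by rewrite rho0.
move=> j N jj /andP[jN Nj].
have [ij i1 i2] := hi j.
have -> : esum f 0 N x - esum f 0 (2 ^ j)%N x = esum f (2 ^ j) N x.
  by rewrite /esum /ergodic_sum (big_cat_nat (leq0n _) jN) /= addrAC subrr add0r.
set gp := (2 ^ (j - i j))%N.
have gp0 : (0 < gp)%N by rewrite expn_gt0.
pose t := ((N - 2 ^ j) %/ gp)%N.
pose a := cutp j t.
have tN : (t * gp <= N - 2 ^ j)%N by rewrite leq_divM.
have aE : a = (2 ^ j + t * gp)%N.
  by rewrite /a /cutp -/gp (minn_idPl _)//; move: tN jN Nj; clear; lia.
have aN : (a <= N)%N by rewrite aE; move: tN jN; clear; lia.
have Na : (N - a <= gp)%N.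
  have := ltn_ceil (N - 2 ^ j) gp0; rewrite -/t mulSn aE; move: jN; clear; lia.
have ja : (2 ^ j <= a)%N by rewrite aE leq_addr.
have ti : (t < (2 ^ i j).+1)%N.
  rewrite ltnS /t -(leq_pmul2r gp0) (leq_trans tN)// /gp -expnD subnKC//.
  by move: Nj; rewrite expnS; clear; lia.
have p0 : 0 < 2 ^+ j :> R by rewrite exprn_gt0.
have e1 : `|esum (fj j) (2 ^ j) a x| <= z ^+ j.
  rewrite leNgt; apply/negP => h; apply: (hx j jj).
  rewrite /B -bigcup_mkord; exists t => //=; rewrite /Bt /=.
  by rewrite -[ltRHS]real_normK ?num_real// ltrXn2r ?nnegrE ?exprn_ge0// ltW.
(* The values below the cutoff are handled pointwise: at most [2 ^ j] terms, each bounded by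
   [k ^+ j / 2 ^+ j]. *)
have e2 : `|esum (fun x => f x - fj j x) (2 ^ j) a x| <= k ^+ j.
  apply: (le_trans (@ergodic_sum_norm_le _ (k ^+ j) j _ _ x _ (leqnn _))).
    move=> y; rewrite /fj; case: ltP => h; last by rewrite subr0.
    by rewrite subrr normr0 exprn_ge0// ltW.
  rewrite mulrCA ler_piMr ?exprn_ge0 ?(ltW k0)// ler_pdivrMr// mul1r -natrX ler_nat.
  by move: aN Nj; rewrite expnS; clear; lia.
have e3 : `|esum f a N x| <= 2 * z ^+ j.
  apply: (le_trans (@ergodic_sum_norm_le f 1 j _ _ x f1 ja)).
  apply: le_trans i2; rewrite mul1r ler_pdivrMr//.
  rewrite (_ : (2 ^+ i j)^-1 * 2 ^+ j = gp%:R); first by rewrite ler_nat.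
  have -> : 2 ^+ j = 2 ^+ i j * 2 ^+ (j - i j) :> R by rewrite -exprD subnKC.
  by rewrite /gp natrX mulrA mulVf ?mul1r// expf_neq0.
have -> : esum f (2 ^ j) N x = esum (fj j) (2 ^ j) a x +
    esum (fun x => f x - fj j x) (2 ^ j) a x + esum f a N x.
  rewrite /esum /ergodic_sum (big_cat_nat ja aN) /= -big_split /=; congr (_ + _).
  by apply: eq_bigr => n _; rewrite -mulrDr addrC subrK.
have zr : z ^+ j <= rho ^+ j by rewrite lerXn2r ?nnegrE ?(ltW z0) ?(ltW rho0)// le_max lexx.
have kr : k ^+ j <= rho ^+ j by rewrite lerXn2r ?nnegrE ?(ltW k0) ?(ltW rho0)// le_max lexx orbT.
apply: (le_trans (ler_normD _ _)); apply: (le_trans (lerD (ler_normD _ _) (lexx _))).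
by move: e1 e2 e3 zr kr; clear; lra.
Qed.
End BoundedConvergence.

Section LebesgueConvergence.
Context d (X : measurableType d) (R : realType) (mu : {measure set X -> \bar R}) (T : X -> X).
Hypothesis mT : measurable_fun setT T.
Hypothesis T_preserving : forall A, measurable A -> mu (T @^-1` A) = mu A.
Context (u : nat -> R) (C w : R) (gap : nat -> nat) (osc : oscillating_kernel u C w gap).

Let esum := ergodic_sum T u.

Lemma integral_tail_small (f : X -> R) (e : R) : 0 < e -> measurable_fun setT f ->
  (\int[mu]_x (`|f x|)%:E < +oo)%E ->
  exists2 c : R, 0 < c &
    (\int[mu]_x (`|if (`|f x| <= c)%R then 0 else f x|)%:E <= e%:E)%E.
Proof.
move=> e0 mf fI; pose g n x := `|if `|f x| <= n.+1%:R then 0 else f x|.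
have mg n : measurable_fun setT (g n).
  apply: measurableT_comp => //; apply: measurable_fun_ifT => //.
  by apply: (@measurable_fun_ler _ _ _ setT (fun x => `|f x|) (cst n.+1%:R)) => //;
    exact: measurableT_comp.
have [] := @dominated_convergence _ X R mu setT measurableT
  (fun n x => (g n x)%:E) (cst 0%E) (fun x => (`|f x|)%:E).
- by move=> n; exact/measurable_EFinP.
- exact: measurable_cst.
- apply: aeW => x _; apply: cvg_near_cst.
  exists (Num.truncn `|f x|) => //= n tn; rewrite /g.
  by rewrite ltW ?normr0// (lt_le_trans (truncnS_gt _))// ler_nat ltnS.
- apply/integrableP; split; first by apply/measurable_EFinP; exact: measurableT_comp.
  by under eq_integral do rewrite abse_EFin normr_id.
- apply: aeW => x n _; rewrite abse_EFin lee_fin /g normr_id.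
  by case: ifP => // _; rewrite normr0.
move=> _ _; rewrite integral0 => cv.
have [n hn] : exists n, (\int[mu]_x (g n x)%:E < e%:E)%E.
  apply: contrapT => /forallNP h; have : (e%:E <= 0 :> \bar R)%E.
    rewrite -(cvg_lim _ cv)//; apply: lime_ge; first by apply/cvg_ex; exists 0%E.
    by apply: nearW => n; rewrite leNgt; apply/negP; exact: h.
  by rewrite lee_fin leNgt e0.
by exists n.+1%:R => //; exact: ltW.
Qed.

Lemma ergodic_sumB (f g : X -> R) m n x :
  esum (fun y => f y - g y) m n x = esum f m n x - esum g m n x.
Proof. by rewrite /esum /ergodic_sum -sumrB; apply: eq_bigr => k _; rewrite mulrBr. Qed.

Lemma integrable_convergence (f : X -> R) : measurable_fun setT f ->
  (\int[mu]_x (`|f x|)%:E < +oo)%E ->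
  {ae mu, forall x, cvgn (fun N => esum f 0 N x)}.
Proof.
move=> mf fI.
have [A A0 weak] := weak_type_measure mT T_preserving osc.
(* Remainders of integral 4^-k tested at height 2^-k have exceptional sets of measure at most 2 A
   2^-k, which is summable. *)
have /choice[c hc] : forall k : nat, exists c : R, 0 < c /\
    (\int[mu]_x (`|if (`|f x| <= c)%R then 0 else f x|)%:E <= ((4 ^+ k)^-1)%:E)%E.
  move=> k; have [|c c0 h] := @integral_tail_small f (4 ^+ k)^-1 _ mf fI.
    by rewrite invr_gt0 exprn_gt0.
  by exists c.
pose h k x := if `|f x| <= c k then f x else 0.
pose r k x := if `|f x| <= c k then 0 else f x.
have mle k : measurable_fun setT (fun x => `|f x| <= c k).
  by apply: (@measurable_fun_ler _ _ _ setT (fun x => `|f x|) (cst (c k))) => //;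
    exact: measurableT_comp.
have mh k : measurable_fun setT (h k) by apply: measurable_fun_ifT.
have mr k : measurable_fun setT (r k) by apply: measurable_fun_ifT.
have fE k x : r k x = f x - h k x by rewrite /r /h; case: ifP; rewrite ?subrr ?subr0.
pose B k := [set x | exists N, 4 * (2 ^+ k)^-1 < `|esum (r k) 0 N x|].
have BP k : measurable (B k) /\ (mu (B k) <= (2 * A * 2^-1 ^+ k)%:E)%E.
  have lam0 : 0 < (2 ^+ k)^-1 :> R by rewrite invr_gt0 exprn_gt0.
  have [mB B1] := weak (r k) _ (mr k) lam0.
  split=> //; apply: (le_trans B1).
  have [ck0 rI] := hc k.
  under eq_integral do rewrite EFinM.
  rewrite ge0_integralZl_EFin//; last 2 first.
  - by apply/measurable_EFinP; exact: measurableT_comp.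
  - by rewrite divr_ge0// ltW.
  apply: (@le_trans _ _ (2%:E * ((A / (2 ^+ k)^-1)%:E * ((4 ^+ k)^-1)%:E))%E).
    rewrite lee_wpmul2l ?lee_fin// lee_wpmul2l// lee_fin divr_ge0// ltW//.
  rewrite -!EFinM lee_fin invrK le_eqVlt; apply/orP; left; apply/eqP.
  rewrite exprVn (_ : 4 = 2 * 2 :> R); last by ring.
  by rewrite exprMn; field; rewrite expf_neq0.
have t01 : 0 <= (2^-1 : R) < 1 by rewrite invr_ge0 ler0n invf_lt1 ?ltr1n.
have K0 : 0 <= 2 * A by rewrite mulr_ge0.
have bc := borel_cantelli_geometric K0 t01 (fun k => (BP k).1) (fun k => (BP k).2).
have hcv : {ae mu, forall x, forall k, cvgn (fun N => esum (h k) 0 N x)}.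
  apply: ae_foralln => k; have [ck0 _] := hc k.
  have ckn : c k != 0 by rewrite lt0r_neq0.
  pose h1 x := h k x / c k.
  have mh1 : measurable_fun setT h1 by apply: measurable_funM.
  have h1b x : `|h1 x| <= 1.
    rewrite /h1 normrM normfV (gtr0_norm ck0) ler_pdivrMr// mul1r /h.
    by case: ifP => // _; rewrite normr0 ltW.
  have h1I : (\int[mu]_x (`|h1 x| ^+ 1)%:E < +oo)%E.
    apply: (@le_lt_trans _ _ (\int[mu]_x ((c k)^-1%:E * (`|f x|)%:E))%E).
      apply: ge0_le_integral => //.
      - by apply/measurable_EFinP; apply: measurable_funX; exact: measurableT_comp.
      - by apply/measurable_EFinP; apply: measurable_funM => //; exact: measurableT_comp.
      move=> x _; rewrite -EFinM lee_fin expr1 /h1 normrM normfV (gtr0_norm ck0) mulrC.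
      by rewrite ler_wpM2l ?invr_ge0 ?(ltW ck0)// /h; case: ifP; rewrite ?normr0.
    rewrite ge0_integralZl_EFin ?invr_ge0 ?(ltW ck0)//.
      by rewrite lte_mul_pinfty ?lee_fin ?invr_ge0 ?(ltW ck0).
    by apply/measurable_EFinP; exact: measurableT_comp.
  apply: filterS (bounded_convergence mT T_preserving osc (isT : (0 < 1)%N) mh1 h1b h1I) => x cv.
  have -> : (fun N => esum (h k) 0 N x) = (fun N => c k * ergodic_sum T u h1 0 N x).
    apply/funext => N; rewrite /esum /ergodic_sum mulr_sumr; apply: eq_bigr => n _.
    by rewrite /h1 mulrCA (mulrCA (c k)) divff// mulr1.
  by apply: is_cvgMr.
apply: filterS2 bc hcv => x [k0 hx] hcvx.
apply: cauchy_ball_cvg => e e0.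
have [k kk0 ke] : exists2 k, (k0 <= k)%N & 4 * (2 ^+ k)^-1 <= e / 2 :> R.
  pose n := (Num.truncn (8 / e)).+1; exists (maxn k0 n); first exact: leq_maxl.
  have en : 8 / e <= 2 ^+ maxn k0 n.
    apply: (@le_trans _ _ n%:R); first by rewrite ltW// truncnS_gt.
    rewrite -natrX ler_nat (leq_trans (leq_maxr k0 n))// ltnW// ltn_expl//.
  rewrite ler_pdivrMr ?exprn_gt0// -ler_pdivrMl ?divr_gt0//.
  by apply: le_trans en; rewrite invf_div le_eqVlt; apply/orP; left; apply/eqP; field; rewrite lt0r_neq0.
have e20 : 0 < e / 2 by rewrite divr_gt0.
have /cvgrPdist_lt/(_ _ e20)[N0 _ hN] := hcvx k.
exists (lim (esum (h k) 0 N x @[N --> \oo])), N0 => N NN.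
have := hN N NN => /= h1.
have h2 : `|esum (r k) 0 N x| <= e / 2.
  apply: le_trans ke; rewrite leNgt; apply/negP => bad_; apply: (hx k kk0).
  by exists N.
have rE : esum (r k) 0 N x = esum f 0 N x - esum (h k) 0 N x.
  by rewrite -ergodic_sumB; apply: eq_bigr => n _; rewrite fE.
rewrite (splitr e) -[X in `|X|](_ : (lim (esum (h k) 0 N x @[N --> \oo]) - esum (h k) 0 N x)
  - esum (r k) 0 N x = _); last by rewrite rE; ring.
apply: (le_lt_trans (ler_normB _ _)); exact: ltr_leD.
Qed.

Lemma Lr_convergence (f : X -> R) (r : R) : 1 <= r -> measurable_fun setT f ->
  (\int[mu]_x (`|f x| `^ r)%:E < +oo)%E ->
  {ae mu, forall x, cvgn (fun N => esum f 0 N x)}.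
Proof.
move=> r1 mf fI; pose q := (Num.truncn r).+1.
have rq : r <= q%:R by rewrite ltW// truncnS_gt.
pose a x := if `|f x| <= 1 then f x else 0.
pose b x := if `|f x| <= 1 then 0 else f x.
have mle : measurable_fun setT (fun x => `|f x| <= 1).
  by apply: (@measurable_fun_ler _ _ _ setT (fun x => `|f x|) (cst 1)) => //;
    exact: measurableT_comp.
have ma : measurable_fun setT a by apply: measurable_fun_ifT.
have mb : measurable_fun setT b by apply: measurable_fun_ifT.
have mfr : measurable_fun setT (fun x => (`|f x| `^ r)%:E).
  apply/measurable_EFinP; apply: (@measurableT_comp _ _ _ _ _ _ (fun t : R => t `^ r)) => //.
  exact: measurableT_comp.
have a1 x : `|a x| <= 1 by rewrite /a; case: ifP; rewrite ?normr0.
have aI : (\int[mu]_x (`|a x| ^+ q)%:E < +oo)%E.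
  apply: le_lt_trans fI; apply: ge0_le_integral => //.
  - by apply/measurable_EFinP; apply: measurable_funX; exact: measurableT_comp.
  move=> x _; rewrite lee_fin /a; case: ifP => [f1|_]; last by rewrite normr0 expr0n powR_ge0.
  have [->|f0] := eqVneq (f x) 0; first by rewrite normr0 expr0n powR_ge0.
  by rewrite -powR_mulrn// ger_powR// normr_gt0 f0.
have bI : (\int[mu]_x (`|b x|)%:E < +oo)%E.
  apply: le_lt_trans fI; apply: ge0_le_integral => //.
  - by apply/measurable_EFinP; exact: measurableT_comp.
  move=> x _; rewrite lee_fin /b; case: ifPn => [_|]; first by rewrite normr0 powR_ge0.
  by rewrite -ltNge => f1; rewrite le1r_powR// ltW.
have ca := bounded_convergence mT T_preserving osc (isT : (0 < q)%N) ma a1 aI.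
have cb := integrable_convergence mb bI.
apply: filterS2 ca cb => x cax cbx.
have -> : (fun N => esum f 0 N x) = (fun N => ergodic_sum T u a 0 N x + esum b 0 N x).
  apply/funext => N; rewrite /esum /ergodic_sum -big_split; apply: eq_bigr => n _ /=.
  by rewrite -mulrDr /a /b; case: ifP; rewrite ?addr0 ?add0r.
exact: is_cvgD.
Qed.
End LebesgueConvergence.

(** * Complex-valued functions and conclusion *)

Lemma cvgn_complex (R : realType) (S : nat -> R[i]) :
  cvgn (fun N => complex.Re (S N)) -> cvgn (fun N => complex.Im (S N)) ->
  cvgn (S : nat -> R[i]^o).
Proof.
move=> cR cI; set a := lim (complex.Re (S N) @[N --> \oo]).
set b := lim (complex.Im (S N) @[N --> \oo]).
apply/cvg_ex; exists (Complex a b : R[i]^o); apply/cvgrPdist_lt => e.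
(* In the partial order of [R[i]] a positive radius is a positive real number. *)
rewrite ltcE /= => /andP[/eqP ie re0].
have e0 : 0 < complex.Re e / 2 by rewrite divr_gt0.
have /cvgrPdist_lt/(_ _ e0) hR := cR; have /cvgrPdist_lt/(_ _ e0) hI := cI.
near=> N.
have h1 : `|a - complex.Re (S N)| < complex.Re e / 2 by near: N; exact: hR.
have h2 : `|b - complex.Im (S N)| < complex.Re e / 2 by near: N; exact: hI.
rewrite normc_def ltcE /= ie eqxx /=.
case: (S N) h1 h2 => x y /= h1 h2.
have n1 := normr_ge0 (a - x); have n2 := normr_ge0 (b - y).
apply: (@le_lt_trans _ _ (`|a - x| + `|b - y|)); last first.
  by rewrite (splitr (complex.Re e)) ltrD.
rewrite -[leRHS]ger0_norm ?addr_ge0// -sqrtr_sqr ler_wsqrtr//.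
rewrite -(real_normK (num_real (a - x))) -(real_normK (num_real (b - y))) sqrrD.
by rewrite -addrA [leRHS]addrCA lerDr mulrn_wge0// mulr_ge0.
Unshelve. all: by end_near. Qed.

(** Beyond [n0] the two partial sums differ by the constant [D]; this restores the small [n] removed
    from [trig_kernel]. *)
Lemma eventually_equal_kernel_cvg (R : realType) (v v' g : nat -> R) (n0 : nat) :
  (forall n, (n0 <= n)%N -> v n = v' n) ->
  cvgn (fun N => \sum_(0 <= n < N) v n * g n) ->
  cvgn (fun N => \sum_(1 <= n < N.+1) v' n * g n).
Proof.
move=> vv cv; apply: cauchy_ball_cvg => e e0.
have /cvgrPdist_lt/(_ e e0)[N0 _ hN] := cv.
pose D := \sum_(1 <= n < n0.+1) v' n * g n - \sum_(0 <= n < n0.+1) v n * g n.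
exists (lim (\sum_(0 <= n < N) v n * g n @[N --> \oo]) + D), (maxn n0 N0) => N.
rewrite geq_max => /andP[n0N N0N].
have -> : \sum_(1 <= n < N.+1) v' n * g n = \sum_(0 <= n < N.+1) v n * g n + D.
  rewrite (@big_cat_nat _ _ _ n0.+1 1 N.+1)//= (@big_cat_nat _ _ _ n0.+1 0 N.+1)//=.
  have -> : \sum_(n0.+1 <= n < N.+1) v n * g n = \sum_(n0.+1 <= n < N.+1) v' n * g n.
    by apply: eq_big_nat => n /andP[n1 _]; rewrite vv// ltnW.
  by rewrite /D; ring.
rewrite [X in `|X|](_ : _ = lim (\sum_(0 <= n < N) v n * g n @[N --> \oo])
  - \sum_(0 <= n < N.+1) v n * g n); last by ring.
by apply: hN => /=; exact: leqW.
Qed.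

Lemma expi_div_nat (R : realType) (t : R) (n : nat) :
  expi t / n%:R = Complex (cos t / n%:R) (sin t / n%:R).
Proof.
rewrite /expi -(rmorph_nat (real_complex R)) -fmorphV.
by apply/eqP; rewrite eq_complex /= !mulr0 subr0 add0r !eqxx.
Qed.

Lemma Re_sum (R : realType) (m n : nat) (z : nat -> R[i]) :
  complex.Re (\sum_(m <= k < n) z k) = \sum_(m <= k < n) complex.Re (z k).
Proof. by apply: (big_morph (@complex.Re R)) => // -[a b] [a' b']. Qed.

Lemma Im_sum (R : realType) (m n : nat) (z : nat -> R[i]) :
  complex.Im (\sum_(m <= k < n) z k) = \sum_(m <= k < n) complex.Im (z k).
Proof. by apply: (big_morph (@complex.Im R)) => // -[a b] [a' b']. Qed.

Lemma normc_ge_parts (R : realType) (z : R[i]) :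
  `|complex.Re z| <= ComplexField.Normc.normc z /\
  `|complex.Im z| <= ComplexField.Normc.normc z.
Proof.
by case: z => a b /=; rewrite -!sqrtr_sqr !ler_wsqrtr// ?lerDl ?lerDr sqr_ge0.
Qed.

Lemma finite_norm_part d (X : measurableType d) (R : realType)
    (mu : {measure set X -> \bar R}) (r : R) (h g : X -> R) : 1 <= r ->
  measurable_fun setT h -> measurable_fun setT g -> (forall x, `|g x| <= h x) ->
  finite_norm mu r%:E h -> (\int[mu]_x (`|g x| `^ r)%:E < +oo)%E.
Proof.
move=> r1 mh mg gh; have r0 : 0 < r by apply: lt_le_trans r1.
rewrite /finite_norm unlock /= => /lty_poweRy.
rewrite invr_neq0 ?lt0r_neq0// => /(_ isT); apply: le_lt_trans.
have mp (k : X -> R) : measurable_fun setT k -> measurable_fun setT (fun x => (`|k x| `^ r)%:E).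
  move=> mk; apply/measurable_EFinP.
  apply: (@measurableT_comp _ _ _ _ _ _ (fun t : R => t `^ r)) => //.
  exact: measurableT_comp.
apply: ge0_le_integral => //.
- exact: mp.
- exact: mp.
move=> x _; rewrite lee_fin ge0_ler_powR ?nnegrE ?(ltW r0)//.
by apply: (le_trans (gh x)); exact: ler_norm.
Qed.


Unset Implicit Arguments.
Theorem theorem1p6 (R : realType) :
  exists eta0 : R -> nat -> R,
    (forall (delta : R) (m : nat),
        0 < delta < 2^-1 -> (1 <= m)%N -> 0 < eta0 delta m) /\
    forall p : R -> R, admissible eta0 p ->
    forall (d : measure_display) (X : measurableType d)
           (mu : {measure set X -> \bar R}) (tau : int -> X -> X),
      non_atomic mu ->
      sigma_finite setT mu ->
      measure_preserving_Zaction mu tau ->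
    forall (r : R) (f : X -> R[i]), 1 <= r -> complex_Lspace mu r f ->
      {ae mu, forall x, cvgn (hilbert_partial_sum p tau f x : nat -> R[i]^o)}.
Proof.
exists (@eta0 R); split=> [delta m _ _|p adm d X mu tau _ _ act r f r1 [mRe mIm fin]].
  by rewrite /eta0 invr_gt0 ltr0n.
have [J [C [w [gap osc]]]] := admissible_oscillating_kernel adm.
pose T := tau 1.
have mT : measurable_fun setT T := Zaction_measurable act 1.
have pT A : measurable A -> mu (T @^-1` A) = mu A by exact: Zaction_preserving act 1 A.
pose sq (x : X) : R := ComplexField.Normc.normc (f x).
have msq : measurable_fun setT sq.
  rewrite (_ : sq = (fun t => Num.sqrt t) \o
    (fun x => complex.Re (f x) ^+ 2 + complex.Im (f x) ^+ 2)); last first.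
    by apply/funext => x; rewrite /sq /=; case: (f x).
  apply: measurableT_comp; first by apply: continuous_measurable_fun; exact: sqrt_continuous.
  by apply: measurable_funD; exact: measurable_funX.
have IRe := finite_norm_part r1 msq mRe (fun x => (normc_ge_parts (f x)).1) fin.
have IIm := finite_norm_part r1 msq mIm (fun x => (normc_ge_parts (f x)).2) fin.
have part phi (v : nat -> R) (g : X -> R) : measurable_fun setT g ->
    (\int[mu]_x (`|g x| `^ r)%:E < +oo)%E ->
    (forall n, cos (2 * pi * p n%:R + phi) = v n) ->
    {ae mu, forall x, cvgn (fun N => \sum_(1 <= n < N.+1) v n / n%:R * g (iter n T x))}.
  move=> mg Ig hv; apply: filterS (Lr_convergence mT pT (osc phi) r1 mg Ig) => x.
  apply: (@eventually_equal_kernel_cvg R _ (fun n => v n / n%:R)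
    (fun n => g (iter n T x)) (2 ^ J)) => n Jn.
  by rewrite /trig_kernel Jn hv.
have hc n : cos (2 * pi * p n%:R + 0) = cos (2 * pi * p n%:R) by rewrite addr0.
(* The phase [- (pi / 2)] turns the cosine kernel into the sine kernel. *)
have hs n : cos (2 * pi * p n%:R + - (pi / 2)) = sin (2 * pi * p n%:R).
  by rewrite cosB cos_pihalf sin_pihalf mulr0 mulr1 add0r.
have both phi (v : nat -> R) : (forall n, cos (2 * pi * p n%:R + phi) = v n) ->
    {ae mu, forall x,
      cvgn (fun N => \sum_(1 <= n < N.+1) v n / n%:R * complex.Re (f (iter n T x))) /\
      cvgn (fun N => \sum_(1 <= n < N.+1) v n / n%:R * complex.Im (f (iter n T x)))}.
  by move=> hv; apply: filterS2 (part phi v _ mRe IRe hv) (part phi v _ mIm IIm hv).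
(* Four real series converge together almost everywhere: cosine and sine, each against the real and
   the imaginary part of [f]. *)
apply: filterS2 (both _ _ hc) (both _ _ hs) => x [c1 c2] [s1 s2]; apply: cvgn_complex.
  have -> : (fun N => complex.Re (hilbert_partial_sum p tau f x N)) = (fun N =>
      \sum_(1 <= n < N.+1) cos (2 * pi * p n%:R) / n%:R * complex.Re (f (iter n T x)) -
      \sum_(1 <= n < N.+1) sin (2 * pi * p n%:R) / n%:R * complex.Im (f (iter n T x))).
    apply/funext => N; rewrite /hilbert_partial_sum Re_sum -sumrB; apply: eq_bigr => n _.
    by rewrite expi_div_nat -/T; case: (f _).
  exact: is_cvgB.
have -> : (fun N => complex.Im (hilbert_partial_sum p tau f x N)) = (fun N =>
    \sum_(1 <= n < N.+1) cos (2 * pi * p n%:R) / n%:R * complex.Im (f (iter n T x)) +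
    \sum_(1 <= n < N.+1) sin (2 * pi * p n%:R) / n%:R * complex.Re (f (iter n T x))).
  apply/funext => N; rewrite /hilbert_partial_sum Im_sum -big_split; apply: eq_bigr => n _.
  by rewrite expi_div_nat -/T; case: (f _).
exact: is_cvgD.
Qed.
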